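(* Let $\mathcal{G}$ be a compact matrix quantum group with dense $\ast$-Hopf algebra $H$, let $\zeta=(P,B,\Delta_P)$ be a quantum principal $\mathcal{G}$-bundle over $B$, where $B$ is a $C^\ast$-algebra or can be completed to a $C^\ast$-algebra, and let $\zeta$ be endowed with a differential calculus, given by a graded differential $\ast$-algebra $(\Omega^\bullet(P),d,\ast)$, a bicovariant first order differential $\ast$-calculus $(\Gamma,d)$ over $\mathcal{G}$ with universal differential envelope $\Gamma^\wedge$, and the extension $\Delta_{\Omega^\bullet(P)}:\Omega^\bullet(P)\to\Omega^\bullet(P)\otimes\Gamma^\wedge$ of $\Delta_P$. Let $\Omega^\bullet(B)$ be the algebra of base forms. Then there exists a group isomorphism between (i) the group, under the convolution product, of all convolution invertible maps, that is, graded linear maps $\mathfrak{f}:\Gamma^\wedge\to\Omega^\bullet(P)$ satisfying $$\mathfrak{f}(\mathbb{1})=\mathbb{1},\qquad (\mathfrak{f}\otimes\mathrm{id}_{\Gamma^\wedge})\circ\mathrm{Ad}=\Delta_{\Omega^\bullet(P)}\circ\mathfrak{f},$$ for which there is a graded linear map $\mathfrak{f}^{-1}:\Gamma^\wedge\to\Omega^\bullet(P)$ with $\mathfrak{f}\ast\mathfrak{f}^{-1}=\mathfrak{f}^{-1}\ast\mathfrak{f}=\mathbb{1}\epsilon$; and (ii) the group of all graded left $\Omega^\bullet(B)$-module isomorphisms $\mathfrak{F}:\Omega^\bullet(P)\to\Omega^\bullet(P)$ satisfying $$\mathfrak{F}(\mathbb{1})=\mathbb{1},\qquad (\mathfrak{F}\otimes\mathrm{id}_{\Gamma^\wedge})\circ\Delta_{\Omega^\bullet(P)}=\Delta_{\Omega^\bullet(P)}\circ\mathfrak{F},$$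 with group product $(\mathfrak{F}_1\circ\mathfrak{F}_2)(w)=\mathfrak{F}_2(\mathfrak{F}_1(w))$.
   Context: All algebras are unital complex algebras; Sweedler notation $\Delta(t)=t^{(1)}\otimes t^{(2)}$ is used, and $\partial x$ denotes the degree of a homogeneous element $x$. Compact matrix quantum group: $\mathcal{G}$ is a compact matrix quantum group in the sense of Woronowicz, with dense $\ast$-Hopf algebra $(H,\cdot,\mathbb{1},\Delta,\epsilon,S,\ast)$ spanned by the matrix coefficients of finite-dimensional unitary corepresentations. A (right) $\mathcal{G}$-corepresentation on a complex vector space $V$ is a linear map $\delta^V:V\to V\otimes H$ with $(\mathrm{id}_V\otimes\epsilon)\circ\delta^V\cong\mathrm{id}_V$ and $(\mathrm{id}_V\otimes\Delta)\circ\delta^V=(\delta^V\otimes\mathrm{id}_H)\circ\delta^V$. Graded differential $\ast$-algebras: $\mathbb{N}_0$-graded unital algebras with a degree-one differential $d$ ($d^2=0$, graded Leibniz rule) and an antilinear involution with $(xy)^\ast=(-1)^{\partial x\,\partial y}y^\ast x^\ast$ and $d(x^\ast)=(dx)^\ast$. Tensor products of such algebras are graded: $(x\otimes y)(x'\otimes y')=(-1)^{\partial y\,\partial x'}xx'\otimes yy'$, with $d(x\otimes y)=dx\otimes y+(-1)^{\partial x}x\otimes dy$ and $(x\otimes y)^\ast=x^\ast\otimes y^\ast$. ''Generated by its degree $0$ elements'' means that the degree $k$ part is spanned by elements $x_0\,dx_1\cdots dx_k$ with $x_i$ of degree $0$. Bicovariant $\ast$-FODC: a first order differential $\ast$-calculus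 $(\Gamma,d)$ over $\mathcal{G}$ is an $H$-bimodule $\Gamma$ with a derivation $d:H\to\Gamma$ such that $\Gamma$ is spanned by the elements $g\,dh$, together with a compatible antilinear involution ($(g\vartheta h)^\ast=h^\ast\vartheta^\ast g^\ast$, $(dg)^\ast=d(g^\ast)$). It is bicovariant if $\Phi_\Gamma(g\,dh)=\Delta(g)(\mathrm{id}\otimes d)\Delta(h)\in H\otimes\Gamma$ and ${}_\Gamma\Phi(g\,dh)=\Delta(g)(d\otimes\mathrm{id})\Delta(h)\in\Gamma\otimes H$ are well defined (by linear extension) on $\Gamma$. Universal differential envelope: $\Gamma^\wedge:=\left(\bigoplus_k\Gamma^{\otimes_H k}\right)/\mathcal{Q}$, with $\Gamma^{\otimes_H 0}=H$, where $\mathcal{Q}$ is the two-sided ideal generated by all $\sum_i dg_i\otimes_H dh_i$ with $g_i,h_i\in H$ and $\sum_i g_i\,dh_i=0$. It is a graded differential $\ast$-algebra generated by $\Gamma^{\wedge 0}=H$. The coproduct extends uniquely to a graded differential $\ast$-algebra morphism $\Delta:\Gamma^\wedge\to\Gamma^\wedge\otimes\Gamma^\wedge$; the counit extends by $\epsilon|_{\Gamma^{\wedge k}}=0$ for $k\ge1$; the antipode extends uniquely to a graded antimultiplicative linear map $S:\Gamma^\wedge\to\Gamma^\wedge$ commuting with $d$. This makes $\Gamma^\wedge$ a graded differential $\ast$-Hopf algebra. The right adjoint coaction is $$\mathrm{Ad}:\Gamma^\wedge\to\Gamma^\wedge\otimes\Gamma^\wedge,\qquad \mathrm{Ad}(t)=(-1)^{\partial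 t^{(1)}\partial t^{(2)}}\,t^{(2)}\otimes S(t^{(1)})\,t^{(3)}.$$ Quantum principal $\mathcal{G}$-bundle $\zeta=(P,B,\Delta_P)$: $P$ is a unital $\ast$-algebra, $B\subseteq P$ a unital $\ast$-subalgebra, and $\Delta_P:P\to P\otimes H$ a $\ast$-algebra morphism such that (1) $\Delta_P$ is a $\mathcal{G}$-corepresentation; (2) $\Delta_P(x)=x\otimes\mathbb{1}$ if and only if $x\in B$; (3) the map $\beta:P\otimes P\to P\otimes H$, $\beta(x\otimes y)=(x\otimes\mathbb{1})\Delta_P(y)$, is surjective. Differential calculus on $\zeta$: (1) a graded differential $\ast$-algebra $(\Omega^\bullet(P),d,\ast)$ generated by $\Omega^0(P)=P$; (2) a bicovariant $\ast$-FODC $(\Gamma,d)$ over $\mathcal{G}$; (3) $\Delta_P$ extends to a (necessarily unique) graded differential $\ast$-algebra morphism $\Delta_{\Omega^\bullet(P)}:\Omega^\bullet(P)\to\Omega^\bullet(P)\otimes\Gamma^\wedge$. The base forms are $\Omega^\bullet(B):=\{\mu\in\Omega^\bullet(P)\mid\Delta_{\Omega^\bullet(P)}(\mu)=\mu\otimes\mathbb{1}\}$. Convolution product: for graded linear maps $\mathfrak{f}_1,\mathfrak{f}_2:\Gamma^\wedge\to\Omega^\bullet(P)$, $\mathfrak{f}_1\ast\mathfrak{f}_2:=m_\Omega\circ(\mathfrak{f}_1\otimes\mathfrak{f}_2)\circ\Delta$, with $m_\Omega$ the product of $\Omega^\bullet(P)$. Here $\mathbb{1}\epsilon$ is the map $\vartheta\mapsto\epsilon(\vartheta)\mathbb{1}$.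 Consequence of the standing $C^\ast$-assumption on $B$: let $\mathcal{T}$ be a complete set of mutually non-equivalent irreducible unitary (finite-dimensional) $\mathcal{G}$-corepresentations containing the trivial one on $\mathbb{C}$. For each $\delta^V\in\mathcal{T}$ with orthonormal basis $\{e_i\}$ of $V$ there are finitely many linear maps $T_k:V\to P$ with $\Delta_P\circ T_k=(T_k\otimes\mathrm{id}_H)\circ\delta^V$ and $\sum_k T_k(e_i)^\ast T_k(e_j)=\delta_{ij}\mathbb{1}$. *)

(* Defs.v *)
From HB Require Import structures.
From mathcomp Require Import all_boot all_order all_algebra.
From mathcomp Require Import complex.
From mathcomp Require Import boolp classical_sets functions fsbigop reals.

Set Implicit Arguments.
Unset Strict Implicit.
Unset Printing Implicit Defensive.

Import Order.TTheory GRing.Theory Num.Theory.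
Local Open Scope quotient_scope.
Local Open Scope ring_scope.

(** The product of a right module [M] and a left module [N] over a set [A] of
    scalars: finite formal sums of pairs (lists), two of which are identified
    when every balanced biadditive map takes the same value on them. *)

Section BalancedTensor.
Variables (A : Type) (M N : zmodType) (ra : M -> A -> M) (la : A -> N -> N).

Definition balanced (G : zmodType) (f : M -> N -> G) : Prop :=
  [/\ forall m m' n, f (m + m') n = f m n + f m' n,
      forall m n n', f m (n + n') = f m n + f m n'
    & forall m a n, f (ra m a) n = f m (la a n)].

Definition fsum (G : zmodType) (f : M -> N -> G) (s : seq (M * N)) : G :=
  \sum_(p <- s) f p.1 p.2.

Definition bt_equiv (s t : seq (M * N)) : bool :=
  `[< forall (G : zmodType) (f : M -> N -> G),
        balanced f -> fsum f s = fsum f t >].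

Lemma bt_equiv_refl : reflexive bt_equiv.
Proof. by move=> s; apply/asboolP. Qed.

Lemma bt_equiv_sym : symmetric bt_equiv.
Proof. by move=> s t; apply/asboolP/asboolP => h G f fb; rewrite h. Qed.

Lemma bt_equiv_trans : transitive bt_equiv.
Proof.
by move=> t s u /asboolP st /asboolP tu; apply/asboolP => G f fb; rewrite st ?tu.
Qed.

Canonical bt_equiv_rel :=
  EquivRel bt_equiv bt_equiv_refl bt_equiv_sym bt_equiv_trans.

Definition btens := {eq_quot bt_equiv_rel}.
HB.instance Definition _ := Choice.on btens.

Definition bt_class (s : seq (M * N)) : btens := \pi_btens s.
Definition bt_pure (m : M) (n : N) : btens := bt_class [:: (m, n)].

(** The additive map induced by a balanced map [f] (a junk value otherwise). *)
Definition bt_lift (G : zmodType) (f : M -> N -> G) (t : btens) : G :=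
  fsum f (repr t).

Lemma bt_classP s t : reflect (bt_class s = bt_class t) (bt_equiv s t).
Proof. by apply: (iffP idP) => /eqmodP. Qed.

Lemma bt_lift_class (G : zmodType) (f : M -> N -> G) s :
  balanced f -> bt_lift f (bt_class s) = fsum f s.
Proof.
move=> fb; rewrite /bt_lift.
have /bt_classP/asboolP/(_ G f fb) // : bt_class (repr (bt_class s)) = bt_class s.
by rewrite /bt_class reprK.
Qed.

Lemma bt_lift_ext (x y : btens) :
  (forall (G : zmodType) (f : M -> N -> G),
      balanced f -> bt_lift f x = bt_lift f y) -> x = y.
Proof.
move=> h; rewrite -[x]reprK -[y]reprK; apply/bt_classP/asboolP => G f fb.
exact: h.
Qed.

Lemma fsum_cat (G : zmodType) (f : M -> N -> G) s t :
  fsum f (s ++ t) = fsum f s + fsum f t.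
Proof. by rewrite /fsum big_cat. Qed.

Definition bt_add (x y : btens) : btens := bt_class (repr x ++ repr y).
Definition bt_zero : btens := bt_class [::].
Definition bt_opp (x : btens) : btens :=
  bt_class [seq (- p.1, p.2) | p <- repr x].

Lemma bt_lift_add (G : zmodType) (f : M -> N -> G) (x y : btens) :
  balanced f -> bt_lift f (bt_add x y) = bt_lift f x + bt_lift f y.
Proof. by move=> fb; rewrite bt_lift_class// fsum_cat. Qed.

Lemma bt_lift_zero (G : zmodType) (f : M -> N -> G) :
  balanced f -> bt_lift f bt_zero = 0.
Proof. by move=> fb; rewrite bt_lift_class// /fsum big_nil. Qed.

Lemma bt_lift_opp (G : zmodType) (f : M -> N -> G) (x : btens) :
  balanced f -> bt_lift f (bt_opp x) = - bt_lift f x.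
Proof.
move=> fb; rewrite bt_lift_class// /bt_lift /fsum big_map -sumrN.
apply: eq_bigr => -[m n] _ /=; apply/eqP; rewrite -addr_eq0.
case: fb => fD _ _; rewrite -fD addNr.
by rewrite -(inj_eq (addrI (f 0 n))) -fD !addr0.
Qed.

Fact bt_addA : associative bt_add.
Proof.
by move=> x y z; apply: bt_lift_ext => G f fb; rewrite !bt_lift_add// addrA.
Qed.

Fact bt_addC : commutative bt_add.
Proof.
by move=> x y; apply: bt_lift_ext => G f fb; rewrite !bt_lift_add// addrC.
Qed.

Fact bt_add0 : left_id bt_zero bt_add.
Proof.
by move=> x; apply: bt_lift_ext => G f fb;
   rewrite bt_lift_add// bt_lift_zero// add0r.
Qed.

Fact bt_addN : left_inverse bt_zero bt_opp bt_add.
Proof.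
by move=> x; apply: bt_lift_ext => G f fb;
   rewrite bt_lift_add// bt_lift_opp// bt_lift_zero// addNr.
Qed.

HB.instance Definition _ :=
  GRing.isZmodule.Build btens bt_addA bt_addC bt_add0 bt_addN.

Lemma bt_liftE (G : zmodType) (f : M -> N -> G) m n :
  balanced f -> bt_lift f (bt_pure m n) = f m n.
Proof. by move=> fb; rewrite bt_lift_class// /fsum big_seq1. Qed.

Lemma bt_liftD (G : zmodType) (f : M -> N -> G) (x y : btens) :
  balanced f -> bt_lift f (x + y) = bt_lift f x + bt_lift f y.
Proof. exact: bt_lift_add. Qed.

Lemma bt_class_sum (s : seq (M * N)) :
  bt_class s = \sum_(p <- s) bt_pure p.1 p.2.
Proof.
apply: bt_lift_ext => G f fb; rewrite bt_lift_class// /fsum.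
elim: s => [|p s IH]; first by rewrite !big_nil [RHS]bt_lift_zero.
by rewrite !big_cons bt_liftD// bt_liftE// IH.
Qed.

Lemma bt_pure_balanced : balanced bt_pure.
Proof.
by split=> *; apply: bt_lift_ext => G f fb;
   rewrite ?bt_liftD// !bt_liftE//; case: fb.
Qed.

Lemma bt_sum_pure (x : btens) :
  exists s : seq (M * N), x = \sum_(p <- s) bt_pure p.1 p.2.
Proof. by exists (repr x); rewrite -bt_class_sum /bt_class reprK. Qed.

End BalancedTensor.

Section Tensor.
Variables (K : fieldType) (V W : lmodType K).

Definition tens := btens (fun (v : V) (c : K) => c *: v) (fun c (w : W) => c *: w).
HB.instance Definition _ := GRing.Zmodule.on tens.

Definition tensor (v : V) (w : W) : tens := bt_pure _ _ v w.

Definition tbalanced (G : zmodType) (f : V -> W -> G) : Prop :=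
  balanced (fun (v : V) (c : K) => c *: v) (fun c (w : W) => c *: w) f.

(** The additive map v ⊗ w |-> f v w induced by a [tbalanced] [f] (see
    [tliftE], [tliftD]); conjugate-bilinear maps are allowed. *)
Definition tlift (G : zmodType) (f : V -> W -> G) (t : tens) : G := bt_lift f t.

Definition tscale (c : K) : tens -> tens := tlift (fun v w => tensor (c *: v) w).

Lemma tensor_balanced : tbalanced tensor.
Proof. exact: bt_pure_balanced. Qed.

Lemma tensorDl v v' w : tensor (v + v') w = tensor v w + tensor v' w.
Proof. by case: tensor_balanced. Qed.

Lemma tensorDr v w w' : tensor v (w + w') = tensor v w + tensor v w'.
Proof. by case: tensor_balanced. Qed.

Lemma tensorZ c v w : tensor (c *: v) w = tensor v (c *: w).
Proof. by case: tensor_balanced. Qed.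

Lemma tens_ind (Q : tens -> Prop) :
  Q 0 -> (forall x y, Q x -> Q y -> Q (x + y)) ->
  (forall v w, Q (tensor v w)) -> forall t, Q t.
Proof.
move=> Q0 QD Qt t; have [s ->] := bt_sum_pure t.
by elim/big_ind: _ => // -[v w] _; apply: Qt.
Qed.

Section Lift.
Variables (G : zmodType) (f : V -> W -> G).
Hypothesis fb : tbalanced f.

Lemma tliftE v w : tlift f (tensor v w) = f v w. Proof. exact: bt_liftE. Qed.
Lemma tliftD x y : tlift f (x + y) = tlift f x + tlift f y.
Proof. exact: bt_liftD. Qed.
Lemma tlift0 : tlift f 0 = 0. Proof. exact: bt_lift_zero. Qed.
End Lift.

Lemma tscale_balanced c :
  tbalanced (fun v w => tensor (c *: v) w).
Proof.
split=> *; rewrite ?scalerDr ?tensorDl ?tensorDr// -tensorZ !scalerA.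
by rewrite mulrC.
Qed.

Lemma tscaleE c v w : tscale c (tensor v w) = tensor (c *: v) w.
Proof. exact: (tliftE (tscale_balanced c)). Qed.

Lemma tscaleD c x y : tscale c (x + y) = tscale c x + tscale c y.
Proof. exact: (tliftD (tscale_balanced c)). Qed.

Lemma tscale0 c : tscale c 0 = 0.
Proof. exact: (tlift0 (tscale_balanced c)). Qed.

Fact tscaleA a b t : tscale a (tscale b t) = tscale (a * b) t.
Proof.
elim/tens_ind: t => [|x y hx hy|v w]; first by rewrite !tscale0.
  by rewrite !tscaleD hx hy.
by rewrite !tscaleE scalerA.
Qed.

Fact tscale1 : left_id 1 tscale.
Proof.
elim/tens_ind => [|x y hx hy|v w]; first by rewrite tscale0.
  by rewrite tscaleD hx hy.
by rewrite tscaleE scale1r.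
Qed.

Fact tscaleDl t : {morph tscale^~ t : a b / a + b}.
Proof.
move=> a b; elim/tens_ind: t => [|x y hx hy|v w]; first by rewrite !tscale0 addr0.
  by rewrite !tscaleD hx hy addrACA.
by rewrite !tscaleE scalerDl tensorDl.
Qed.

HB.instance Definition _ :=
  GRing.Zmodule_isLmodule.Build K tens tscaleA tscale1 (fun c => tscaleD c) tscaleDl.

End Tensor.

Notation "V ⊗ W" := (tens V%type W%type) (at level 40, left associativity) : type_scope.
Notation "v ⊗ w" := (tensor v w) (at level 40, left associativity) : ring_scope.

Section TensorTheory.
Variable K : fieldType.

Lemma tensorZl (V W : lmodType K) c (v : V) (w : W) : (c *: v) ⊗ w = c *: (v ⊗ w).
Proof. by rewrite [RHS]tscaleE. Qed.

Lemma tensorZr (V W : lmodType K) c (v : V) (w : W) : v ⊗ (c *: w) = c *: (v ⊗ w).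
Proof. by rewrite -tensorZ tensorZl. Qed.

Lemma tlift_fD (V W : lmodType K) (G : zmodType) (f g : V -> W -> G) t :
  tlift (fun v w => f v w + g v w) t = tlift f t + tlift g t.
Proof. by rewrite /tlift /bt_lift /fsum big_split. Qed.

Lemma eq_tlift (V W : lmodType K) (G : zmodType) (f g : V -> W -> G) t :
  (forall v w, f v w = g v w) -> tlift f t = tlift g t.
Proof. by move=> fg; apply: eq_bigr => p _. Qed.

Lemma tliftZ (V W U : lmodType K) (f : V -> W -> U) c t : tbalanced f ->
  (forall v w, f (c *: v) w = c *: f v w) ->
  tlift f (c *: t) = c *: tlift f t.
Proof.
move=> fb fZ; elim/tens_ind: t => [|x y hx hy|v w].
- by rewrite scaler0 (tlift0 fb) scaler0.
- by rewrite scalerDr !(tliftD fb) hx hy scalerDr.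
- by rewrite -tensorZl !(tliftE fb).
Qed.

End TensorTheory.

Section TensorMaps.
Variables (K : fieldType) (U V W V' W' : lmodType K).

Definition tmap (f : V -> V') (g : W -> W') : V ⊗ W -> V' ⊗ W' :=
  tlift (fun v w => f v ⊗ g w).

Definition tassoc : (U ⊗ V) ⊗ W -> U ⊗ (V ⊗ W) :=
  tlift (fun uv w => tlift (fun u v => u ⊗ (v ⊗ w)) uv).

End TensorMaps.

Section TensorMapsTheory.
Variable K : fieldType.

Lemma tmapE (V W V' W' : lmodType K) (f : {linear V -> V'})
  (g : {linear W -> W'}) v w : tmap f g (v ⊗ w) = f v ⊗ g w.
Proof.
rewrite /tmap tliftE//.
by split=> *; rewrite ?linearD ?linearZ ?tensorDl ?tensorDr ?tensorZ.
Qed.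

Lemma tassocE (U V W : lmodType K) (u : U) (v : V) (w : W) :
  tassoc ((u ⊗ v) ⊗ w) = u ⊗ (v ⊗ w).
Proof.
have b (w' : W) : tbalanced (fun (u : U) (v : V) => u ⊗ (v ⊗ w')).
  by split=> *; rewrite ?tensorDl ?tensorDr// !(tensorZl, tensorZr).
rewrite /tassoc tliftE ?(tliftE (b w))//.
split=> [m m' n|m n n'|m a n]; first exact: (tliftD (b n)).
  by rewrite -tlift_fD; apply: eq_tlift => *; rewrite !tensorDr.
rewrite (@tliftZ _ _ _ _ _ _ _ (b n)) => [|v' w']; last by rewrite tensorZl.
elim/tens_ind: m => [|x y hx hy|x y].
- by rewrite (tlift0 (b n)) (tlift0 (b (a *: n))) scaler0.
- by rewrite (tliftD (b n)) (tliftD (b (a *: n))) scalerDr hx hy.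
by rewrite (tliftE (b n)) (tliftE (b (a *: n))) !tensorZr.
Qed.

End TensorMapsTheory.

Definition amul (K : fieldType) (A B : algType K) (s t : A ⊗ B) : A ⊗ B :=
  tlift (fun x y => tlift (fun x' y' => (x * x') ⊗ (y * y')) t) s.

Lemma amulE (K : fieldType) (A B : algType K) (x x' : A) (y y' : B) :
  amul (x ⊗ y) (x' ⊗ y') = (x * x') ⊗ (y * y').
Proof.
have b (u : A) (v : B) : tbalanced (fun x' y' => (u * x') ⊗ (v * y')).
  by split=> *; rewrite ?mulrDr ?tensorDl ?tensorDr// -scalerAr tensorZ scalerAr.
rewrite /amul tliftE ?(tliftE (b _ _))//.
split=> [m m' n|m n n'|m a n]; rewrite -?tlift_fD; apply: eq_tlift => *.
- by rewrite mulrDl tensorDl.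
- by rewrite mulrDl tensorDr.
- by rewrite -!scalerAl tensorZ.
Qed.

Section QuantumBundles.
Variable R : realType.
Local Notation C := R[i].

Record star_algebra := StarAlgebra {
  sa_alg :> algType C;
  star : sa_alg -> sa_alg;
  starD : forall x y, star (x + y) = star x + star y;
  starZ : forall (c : C) x, star (c *: x) = c^* *: star x;
  starM : forall x y, star (x * y) = star y * star x;
  starK : involutive star
}.

Definition tstar (A B : star_algebra) : A ⊗ B -> A ⊗ B :=
  tlift (fun x y => star x ⊗ star y).

Definition star_subalgebra (A : star_algebra) (D : set A) : Prop :=
  D 1 /\
  [/\ forall x y, D x -> D y -> D (x + y),
      forall (c : C) x, D x -> D (c *: x),
      forall x y, D x -> D y -> D (x * y)
    & forall x, D x -> D (star x)].

Record hopf_star_algebra := HopfStarAlgebra {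
  ha_alg :> star_algebra;
  comul : {linear ha_alg -> (ha_alg ⊗ ha_alg)%type};
  counit : {scalar ha_alg};
  antipode : {linear ha_alg -> ha_alg};
  comul1 : comul 1 = 1 ⊗ 1;
  comulM : forall a b, comul (a * b) = amul (comul a) (comul b);
  comul_star : forall a, comul (star a) = tstar (comul a);
  counit1 : counit 1 = 1;
  counitM : forall a b, counit (a * b) = counit a * counit b;
  counit_star : forall a, counit (star a) = (counit a)^*;
  comulA : forall a, tassoc (tmap comul id (comul a)) = tmap id comul (comul a);
  counitl : forall a, tlift (fun b c => counit b *: c) (comul a) = a;
  counitr : forall a, tlift (fun b c => counit c *: b) (comul a) = a;
  antipodel : forall a,
    tlift (fun b c => antipode b * c) (comul a) = counit a *: 1;
  antipoder : forall a,
    tlift (fun b c => b * antipode c) (comul a) = counit a *: 1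
}.

Arguments comul {h}.
Arguments counit {h}.
Arguments antipode {h}.

Definition corepresentation (H : hopf_star_algebra) (V : lmodType C)
    (delta : {linear V -> (V ⊗ H)%type}) : Prop :=
  (forall v, tlift (fun (w : V) (h : H) => counit h *: w) (delta v) = v) /\
  (forall v, tmap id comul (delta v) = tassoc (tmap delta id (delta v))).

(** The matrix [u] of a corepresentation on C^n,
    e_j |-> \sum_i e_i ⊗ u i j. *)
Definition matrix_corep (H : hopf_star_algebra) (n : nat) (u : 'M[H]_n) : Prop :=
  (forall i j, comul (u i j) = \sum_k u i k ⊗ u k j) /\
  (forall i j, counit (u i j) = (i == j)%:R).

Definition unitary_matrix (A : star_algebra) (n : nat) (u : 'M[A]_n) : Prop :=
  forall i j, \sum_k star (u k i) * u k j = (i == j)%:R /\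
              \sum_k u i k * star (u j k) = (i == j)%:R.

Definition unitary_coefficient (H : hopf_star_algebra) (h : H) : Prop :=
  exists n (u : 'M[H]_n) (i j : 'I_n),
    [/\ matrix_corep u, unitary_matrix u & h = u i j].

(** A compact matrix quantum group, given by its dense Hopf *-algebra. *)
Record cmqg := Cmqg {
  qg_hopf :> hopf_star_algebra;
  qg_fundamental : exists n (u : 'M[qg_hopf]_n), matrix_corep u /\
    forall D : set qg_hopf, star_subalgebra D ->
      (forall i j, D (u i j)) -> forall h, D h;
  qg_span : forall h : qg_hopf, exists m (c : 'I_m -> C) (x : 'I_m -> qg_hopf),
    (forall k, unitary_coefficient (x k)) /\ h = \sum_k c k *: x k
}.

Record qpbundle (G : cmqg) := QPBundle {
  qp_total :> star_algebra;
  qp_base : set qp_total;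
  qp_coact : {linear qp_total -> (qp_total ⊗ G)%type};
  qp_base_sub : star_subalgebra qp_base;
  qp_coact1 : qp_coact 1 = 1 ⊗ 1;
  qp_coactM : forall x y, qp_coact (x * y) = amul (qp_coact x) (qp_coact y);
  qp_coact_star : forall x, qp_coact (star x) = tstar (qp_coact x);
  qp_corep : corepresentation qp_coact;
  qp_baseP : forall x, qp_coact x = x ⊗ 1 <-> qp_base x;
  qp_free : forall t : qp_total ⊗ G, exists s : qp_total ⊗ qp_total,
    tlift (fun x y : qp_total => amul (x ⊗ 1) (qp_coact y)) s = t
}.

Arguments qp_base {G} q _.

Definition cstar_norm (A : star_algebra) (D : set A) (N : A -> R) : Prop :=
  [/\ forall x, D x -> 0 <= N x,
      forall x, D x -> N x = 0 -> x = 0,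
      forall x y, D x -> D y -> N (x + y) <= N x + N y
    & forall (c : C) x, D x -> N (c *: x) = complex.Re `|c| * N x] /\
  [/\ forall x y, D x -> D y -> N (x * y) <= N x * N y
    & forall x, D x -> N (star x * x) = N x ^+ 2].

(** A C*-norm, complete or not: the completion of [D] is then a C*-algebra. *)
Definition cstar_completable (A : star_algebra) (D : set A) : Prop :=
  exists N : A -> R, cstar_norm D N.

(** The grading is given by the projections [hcomp k] onto the homogeneous
    components: the algebra is the direct sum of their images. *)
Record gdsa := GDSA {
  gd_alg :> algType C;
  hcomp : nat -> {linear gd_alg -> gd_alg};
  gd_d : {linear gd_alg -> gd_alg};
  gd_star : gd_alg -> gd_alg;
  hcompK : forall i j x, hcomp i (hcomp j x) = if i == j then hcomp j x else 0;
  hcomp_sum : forall x, exists n, x = \sum_(i < n) hcomp i x;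
  homog1 : hcomp 0%N 1 = 1;
  homogM : forall i j x y, hcomp i x = x -> hcomp j y = y ->
    hcomp (i + j)%N (x * y) = x * y;
  homog_d : forall i x, hcomp i x = x -> hcomp i.+1 (gd_d x) = gd_d x;
  gd_dd : forall x, gd_d (gd_d x) = 0;
  gd_leibniz : forall i x y, hcomp i x = x ->
    gd_d (x * y) = gd_d x * y + (-1) ^+ i * (x * gd_d y);
  homog_star : forall i x, hcomp i x = x -> hcomp i (gd_star x) = gd_star x;
  gd_starD : forall x y, gd_star (x + y) = gd_star x + gd_star y;
  gd_starZ : forall (c : C) x, gd_star (c *: x) = c^* *: gd_star x;
  gd_starK : involutive gd_star;
  gd_starM : forall i j x y, hcomp i x = x -> hcomp j y = y ->
    gd_star (x * y) = (-1) ^+ (i * j) * (gd_star y * gd_star x);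
  gd_star_d : forall x, gd_star (gd_d x) = gd_d (gd_star x)
}.

Definition homog (A : gdsa) (k : nat) (x : A) : Prop := hcomp A k x = x.

Definition generated0 (A : gdsa) : Prop :=
  forall k (x : A), homog k x -> exists s : seq (A * k.-tuple A),
    (forall p, p \in s -> homog 0 p.1 /\ forall i, homog 0 (tnth p.2 i)) /\
    x = \sum_(p <- s) p.1 * \prod_(i < k) gd_d A (tnth p.2 i).

(** For additive [F k], the additive map given by [F k] in degree [k]
    ([gsumE], [gsumD]). *)
Definition gsum (A : gdsa) (G : zmodType) (F : nat -> A -> G) (x : A) : G :=
  \sum_(k \in [set: nat]) F k (hcomp A k x).

Section GsumTheory.
Variables (A : gdsa) (G : zmodType).
Implicit Types (F : nat -> A -> G) (x : A).

Lemma hcomp_fin x : exists n, forall k, (n <= k)%N -> hcomp A k x = 0.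
Proof.
have [n e] := hcomp_sum x; exists n => k nk; rewrite e raddf_sum big1 // => i _.
by rewrite /= hcompK gtn_eqF// (leq_trans _ nk).
Qed.

Lemma gsum_ord F x n : (forall k, F k 0 = 0) ->
  (forall k, (n <= k)%N -> hcomp A k x = 0) ->
  gsum F x = \sum_(k < n) F k (hcomp A k x).
Proof.
move=> F0 xn; rewrite /gsum (fsbigE (iota 0 n)) ?iota_uniq//.
  rewrite -(big_mkord xpredT (fun k => F k (hcomp A k x))) /index_iota subn0.
  by apply: eq_bigl => i; apply: mem_set.
by move=> i _; rewrite mem_iota add0n -leqNgt => /xn ->.
Qed.

Lemma gsumE F x k : (forall k, F k 0 = 0) -> homog k x -> gsum F x = F k x.
Proof.
move=> F0 xk; have [n xn] := hcomp_fin x.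
have xm j : (maxn n k.+1 <= j)%N -> hcomp A j x = 0.
  by rewrite geq_max => /andP[nj _]; apply: xn.
rewrite (gsum_ord F0 xm) (bigD1 (Ordinal (leq_maxr n k.+1))); last by [].
rewrite /= xk big1 ?addr0 // => i ik; rewrite -xk hcompK ifF ?F0 //.
by apply/negbTE/eqP => e; case/eqP: ik; apply/val_inj.
Qed.

Lemma gsumD F x y : (forall k a b, F k (a + b) = F k a + F k b) ->
  gsum F (x + y) = gsum F x + gsum F y.
Proof.
move=> FD; have F0 k : F k 0 = 0.
  by apply: (addrI (F k 0)); rewrite -FD !addr0.
have [n xn] := hcomp_fin x; have [m ym] := hcomp_fin y.
have lx k : (maxn n m <= k)%N -> hcomp A k x = 0.
  by rewrite geq_max => /andP[/xn].
have ly k : (maxn n m <= k)%N -> hcomp A k y = 0.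
  by rewrite geq_max => /andP[_ /ym].
have lxy k : (maxn n m <= k)%N -> hcomp A k (x + y) = 0.
  by move=> nk; rewrite linearD /= lx // ly // addr0.
rewrite (gsum_ord F0 lx) (gsum_ord F0 ly) (gsum_ord F0 lxy) -big_split /=.
by apply: eq_bigr => i _; rewrite linearD FD.
Qed.

Lemma gsum_fD F F' x : (forall k, F k 0 = 0) -> (forall k, F' k 0 = 0) ->
  gsum (fun k a => F k a + F' k a) x = gsum F x + gsum F' x.
Proof.
move=> F0 F'0; have [n xn] := hcomp_fin x.
have FF0 k : F k 0 + F' k 0 = 0 by rewrite F0 F'0 addr0.
by rewrite (gsum_ord F0 xn) (gsum_ord F'0 xn) (gsum_ord FF0 xn) big_split.
Qed.

Lemma eq_gsum F F' x : (forall k a, F k a = F' k a) -> gsum F x = gsum F' x.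
Proof. by move=> e; congr (gsum _ x); apply/funext => k; apply/funext. Qed.

Lemma gsumZ F F' c x : (forall k, F k 0 = 0) -> (forall k a, F k (c *: a) = F' k a) ->
  gsum F (c *: x) = gsum F' x.
Proof.
move=> F0 FZ; have [n xn] := hcomp_fin x.
have F'0 k : F' k 0 = 0 by rewrite -(FZ k 0) scaler0.
have cxn k : (n <= k)%N -> hcomp A k (c *: x) = 0.
  by move=> nk; rewrite linearZ /= xn // scaler0.
rewrite (gsum_ord F0 cxn) (gsum_ord F'0 xn).
by apply: eq_bigr => i _; rewrite linearZ FZ.
Qed.

End GsumTheory.

Section GradedTensor.
Variables A B : gdsa.

Definition gmul (s t : A ⊗ B) : A ⊗ B :=
  tlift (fun x y => tlift (fun x' y' =>
    gsum (fun i yi => gsum (fun j xj' =>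
      (-1) ^+ (i * j) *: ((x * xj') ⊗ (yi * y'))) x') y) t) s.

Definition gtens_d : A ⊗ B -> A ⊗ B :=
  tlift (fun x y =>
    gd_d A x ⊗ y + gsum (fun i xi => (-1) ^+ i *: (xi ⊗ gd_d B y)) x).

Definition gtens_star : A ⊗ B -> A ⊗ B :=
  tlift (fun x y => gd_star x ⊗ gd_star y).

Definition gtens_comp (k : nat) : A ⊗ B -> A ⊗ B :=
  tlift (fun x y => \sum_(i < k.+1) hcomp A i x ⊗ hcomp B (k - i) y).

Lemma gmulE i j (x x' : A) (y y' : B) : homog i y -> homog j x' ->
  gmul (x ⊗ y) (x' ⊗ y') = (-1) ^+ (i * j) *: ((x * x') ⊗ (y * y')).
Proof.
move=> yi x'j.
pose f (u : A) (v : B) (u' : A) (v' : B) := gsum (fun i yi => gsum (fun j xj' =>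
      (-1) ^+ (i * j) *: ((u * xj') ⊗ (yi * v'))) u') v.
have f0 (u : A) v v' k : (-1) ^+ k *: ((u * 0) ⊗ (v * v')) = 0 :> (A ⊗ B)%type.
  by rewrite mulr0 -(scale0r 0) tensorZl scale0r scaler0.
have f1 (u : A) u' (v' : B) k : (-1) ^+ k *: ((u * u') ⊗ (0 * v')) = 0 :> (A ⊗ B)%type.
  by rewrite mul0r -(scale0r 0) tensorZr scale0r scaler0.
have f2 (u u' : A) (v' : B) k : gsum (fun j xj' =>
      (-1) ^+ (k * j) *: ((u * xj') ⊗ (0 * v'))) u' = 0.
  have [n xn] := hcomp_fin u'.
  by rewrite (gsum_ord (n := n))// big1.
have b u v : tbalanced (f u v).
  split=> *; rewrite /f.
  - rewrite -gsum_fD//; apply: eq_gsum => k a.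
    by rewrite gsumD// => *; rewrite mulrDr tensorDl scalerDr.
  - rewrite -gsum_fD//; apply: eq_gsum => k c.
    rewrite -gsum_fD//; apply: eq_gsum => ? ?.
    by rewrite mulrDr tensorDr scalerDr.
  - apply: eq_gsum => k c; apply: gsumZ => // ? ?.
    by rewrite -!scalerAr tensorZl tensorZr.
rewrite /gmul tliftE ?(tliftE (b _ _)).
  by rewrite /f (gsumE _ yi)// (gsumE _ x'j).
split=> [m m' n|m n n'|m a n]; rewrite -?tlift_fD; apply: eq_tlift => v w.
- rewrite -gsum_fD//; apply: eq_gsum => k c.
  rewrite -gsum_fD//; apply: eq_gsum => ? ?.
  by rewrite mulrDl tensorDl scalerDr.
- rewrite gsumD// => k c d.
  rewrite -gsum_fD//; apply: eq_gsum => ? ?.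
  by rewrite mulrDl tensorDr scalerDr.
- symmetry; apply: gsumZ => // k c; apply: eq_gsum => ? ?.
  by rewrite -!scalerAl tensorZl tensorZr.
Qed.

Lemma gtens_dE i (x : A) (y : B) : homog i x ->
  gtens_d (x ⊗ y) = gd_d A x ⊗ y + (-1) ^+ i *: (x ⊗ gd_d B y).
Proof.
move=> xi; have f0 k (v : B) : (-1) ^+ k *: (0 ⊗ v) = 0 :> (A ⊗ B)%type.
  by rewrite -(scale0r 0) tensorZl scale0r scaler0.
rewrite /gtens_d tliftE ?(gsumE _ xi)//.
split=> [m m' n|m n n'|m a n].
- rewrite (linearD (gd_d A)) tensorDl gsumD => [|k a b]; last first.
    by rewrite tensorDl scalerDr.
  by rewrite addrACA.
- rewrite (linearD (gd_d B)) tensorDr addrACA -gsum_fD//.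
  by congr (_ + _); apply: eq_gsum => k a; rewrite tensorDr scalerDr.
- rewrite (linearZZ (gd_d A)) tensorZ /=; congr (_ + _).
  by apply: gsumZ => // k b; rewrite (linearZZ (gd_d B)) tensorZ.
Qed.

Lemma gtens_starE (x : A) (y : B) :
  gtens_star (x ⊗ y) = gd_star x ⊗ gd_star y.
Proof.
rewrite /gtens_star tliftE//; split=> *;
  by rewrite ?gd_starD ?gd_starZ ?tensorDl ?tensorDr ?tensorZ.
Qed.

Lemma gtens_compE i j k (x : A) (y : B) : homog i x -> homog j y ->
  gtens_comp k (x ⊗ y) = if (i + j)%N == k then x ⊗ y else 0.
Proof.
move=> xi yj; have t0 (v : B) : 0 ⊗ v = 0 :> (A ⊗ B)%type.
  by rewrite -(scale0r 0) tensorZl scale0r.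
have t1 (v : A) : v ⊗ 0 = 0 :> (A ⊗ B)%type.
  by rewrite -(scale0r 0) tensorZr scale0r.
rewrite /gtens_comp tliftE; last first.
  split=> *; rewrite -?big_split/=; apply: eq_bigr => ? _;
  by rewrite ?raddfD ?linearZ ?tensorDl ?tensorDr ?tensorZ.
have [ik|ki] := ltnP i k.+1; last first.
  rewrite ifF; last by apply/negbTE; rewrite neq_ltn (leq_trans ki) ?orbT ?leq_addr.
  rewrite big1// => l _; rewrite -xi hcompK ifF ?t0//.
  by apply/negbTE; rewrite neq_ltn (leq_trans (ltn_ord l)).
rewrite (bigD1 (Ordinal ik))//= xi big1 ?addr0 => [|l li]; last first.
  rewrite -xi hcompK ifF ?t0//.
  by apply/negbTE/eqP => e; case/eqP: li; apply/val_inj.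
rewrite -yj hcompK; rewrite ltnS in ik.
have -> : ((k - i)%N == j) = ((i + j)%N == k).
  by rewrite -(eqn_add2l i) subnKC// eq_sym.
by case: ifP.
Qed.

End GradedTensor.

Record gdsa_tmorphism (A B B' : gdsa) (f : A -> B ⊗ B') : Prop := {
  gm_comp : forall k x, f (hcomp A k x) = gtens_comp k (f x);
  gm_1 : f 1 = 1 ⊗ 1;
  gm_M : forall x y, f (x * y) = gmul (f x) (f y);
  gm_d : forall x, f (gd_d A x) = gtens_d (f x);
  gm_star : forall x, f (gd_star x) = gtens_star (f x)
}.

Record bimodule (H : algType C) := Bimodule {
  bm_sort :> lmodType C;
  lact : H -> bm_sort -> bm_sort;
  ract : bm_sort -> H -> bm_sort;
  lactDl : forall g h x, lact (g + h) x = lact g x + lact h x;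
  lactDr : forall h x y, lact h (x + y) = lact h x + lact h y;
  lactZl : forall (c : C) h x, lact (c *: h) x = c *: lact h x;
  lactZr : forall (c : C) h x, lact h (c *: x) = c *: lact h x;
  lact1 : forall x, lact 1 x = x;
  lactM : forall g h x, lact (g * h) x = lact g (lact h x);
  ractDl : forall x y h, ract (x + y) h = ract x h + ract y h;
  ractDr : forall x g h, ract x (g + h) = ract x g + ract x h;
  ractZl : forall (c : C) x h, ract (c *: x) h = c *: ract x h;
  ractZr : forall (c : C) x h, ract x (c *: h) = c *: ract x h;
  ract1 : forall x, ract x 1 = x;
  ractM : forall x g h, ract x (g * h) = ract (ract x g) h;
  lractA : forall g x h, ract (lact g x) h = lact g (ract x h)
}.

Record star_fodc (H : star_algebra) := StarFodc {
  fo_bim :> bimodule H;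
  fo_d : {linear H -> fo_bim};
  fo_star : fo_bim -> fo_bim;
  fo_leibniz : forall g h, fo_d (g * h) = ract (fo_d g) h + lact g (fo_d h);
  fo_span : forall x : fo_bim, exists s : seq (H * H),
    x = \sum_(p <- s) lact p.1 (fo_d p.2);
  fo_starD : forall x y, fo_star (x + y) = fo_star x + fo_star y;
  fo_starZ : forall (c : C) x, fo_star (c *: x) = c^* *: fo_star x;
  fo_starK : involutive fo_star;
  fo_star_act : forall g x h,
    fo_star (ract (lact g x) h) = ract (lact (star h) (fo_star x)) (star g);
  fo_star_d : forall h, fo_star (fo_d h) = fo_d (star h)
}.

Definition bicovariant (H : hopf_star_algebra) (Gam : star_fodc H) : Prop :=
  (exists Phi : {linear Gam -> (H ⊗ Gam)%type}, forall g h,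
     Phi (lact g (fo_d Gam h)) =
     tlift (fun a b => tlift (fun a' x => (a * a') ⊗ lact b x)
       (tmap id (fo_d Gam) (comul h))) (comul g)) /\
  (exists Phi : {linear Gam -> (Gam ⊗ H)%type}, forall g h,
     Phi (lact g (fo_d Gam h)) =
     tlift (fun a b => tlift (fun x b' => lact a x ⊗ (b * b'))
       (tmap (fo_d Gam) id (comul h))) (comul g)).

Record biact (H : Type) := Biact {
  ba_sort :> zmodType;
  ba_l : H -> ba_sort -> ba_sort;
  ba_r : ba_sort -> H -> ba_sort
}.

Section Envelope.
Variables (H : hopf_star_algebra) (Gam : star_fodc H).

(** The k-th tensor power over [H], as ((H ⊗_H Gam) ⊗_H Gam) ... ⊗_H Gam. *)
Fixpoint tpow (k : nat) : biact H :=
  if k is k'.+1 then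
    @Biact H (btens (@ba_r H (tpow k')) (@lact H Gam))
      (fun h => bt_lift (fun t x => bt_pure _ _ (ba_l h t) x))
      (fun z h => bt_lift (fun t x => bt_pure _ _ t (ract x h)) z)
  else @Biact H H *%R *%R.

Definition tsnoc (k : nat) (t : tpow k) (x : Gam) : tpow k.+1 :=
  bt_pure (@ba_r H (tpow k)) (@lact H Gam) t x.

(** Degree [k] part of the two-sided ideal of the tensor algebra generated by
    the elements \sum_i dg_i ⊗_H dh_i with \sum_i g_i dh_i = 0. *)
Inductive env_ideal : forall k, tpow k -> Prop :=
| env_ideal0 k : env_ideal (0 : tpow k)
| env_idealD k (q r : tpow k) :
    env_ideal q -> env_ideal r -> env_ideal (q + r)
| env_ideal_gen k (t : tpow k) (s : seq (H * H)) :
    \sum_(p <- s) lact p.1 (fo_d Gam p.2) = 0 ->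
    env_ideal (\sum_(p <- s) tsnoc (tsnoc t (fo_d Gam p.1)) (fo_d Gam p.2))
| env_ideal_r k (q : tpow k) (h : H) :
    env_ideal q -> env_ideal (ba_r q h)
| env_ideal_snoc k (q : tpow k) (x : Gam) :
    env_ideal q -> env_ideal (tsnoc q x).

Fixpoint tprod (E : algType C) (fH : H -> E) (fG : Gam -> E) (k : nat) :
    tpow k -> E :=
  if k is k'.+1 return tpow k -> E
  then bt_lift (fun t x => tprod fH fG t * fG x)
  else fH.

(** [E] is the quotient of the tensor algebra of [Gam] over [H] by the ideal
    [env_ideal], with the differential and involution extending the given
    ones. *)
Record universal_envelope := UniversalEnvelope {
  ue_alg :> gdsa;
  ue_H : {lrmorphism H -> ue_alg};
  ue_G : {linear Gam -> ue_alg};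
  ue_lact : forall h x, ue_G (lact h x) = ue_H h * ue_G x;
  ue_ract : forall x h, ue_G (ract x h) = ue_G x * ue_H h;
  ue_homog : forall k (x : ue_alg),
    homog k x <-> exists t : tpow k, tprod ue_H ue_G t = x;
  ue_ker : forall k (t : tpow k), tprod ue_H ue_G t = 0 <-> env_ideal t;
  ue_d : forall h, gd_d ue_alg (ue_H h) = ue_G (fo_d Gam h);
  ue_starH : forall h, gd_star (ue_H h) = ue_H (star h);
  ue_starG : forall x, gd_star (ue_G x) = ue_G (fo_star x)
}.

(** The Hopf structure on the envelope; each map is determined by [H]. *)
Record envelope_hopf (E : universal_envelope) := EnvelopeHopf {
  e_comul : {linear E -> (E ⊗ E)%type};
  e_counit : {scalar E};
  e_antipode : {linear E -> E};
  e_comul_morph : gdsa_tmorphism e_comul;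
  e_comulH : forall h, e_comul (ue_H E h) = tmap (ue_H E) (ue_H E) (comul h);
  e_counitH : forall h, e_counit (ue_H E h) = counit h;
  e_counit_pos : forall k x, homog k.+1 x -> e_counit x = 0;
  e_antipodeH : forall h, e_antipode (ue_H E h) = ue_H E (antipode h);
  e_antipode_homog : forall k x, homog k x -> homog k (e_antipode x);
  e_antipodeM : forall i j x y, homog i x -> homog j y ->
    e_antipode (x * y) = (-1) ^+ (i * j) * (e_antipode y * e_antipode x);
  e_antipode_d : forall x, e_antipode (gd_d E x) = gd_d E (e_antipode x)
}.

(** t |-> (-1)^(∂t1 ∂t2) t2 ⊗ S(t1) t3, where (id ⊗ Δ)(Δ t) = t1 ⊗ (t2 ⊗ t3). *)
Definition Ad (E : universal_envelope) (eh : envelope_hopf E) (t : E) : E ⊗ E :=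
  tlift (fun t1 t23 => tlift (fun t2 t3 =>
    gsum (fun i t1i => gsum (fun j t2j =>
      (-1) ^+ (i * j) *: (t2j ⊗ (e_antipode eh t1i * t3))) t2) t1) t23)
    (tmap id (e_comul eh) (e_comul eh t)).

End Envelope.

Record diff_calculus (G : cmqg) (zeta : qpbundle G) := DiffCalculus {
  dc_forms : gdsa;
  dc_P : {lrmorphism zeta -> dc_forms};
  dc_P_inj : injective dc_P;
  dc_P_homog : forall w : dc_forms, homog 0 w <-> exists x, dc_P x = w;
  dc_P_star : forall x, gd_star (dc_P x) = dc_P (star x);
  dc_generated : generated0 dc_forms;
  dc_fodc : star_fodc G;
  dc_bicov : bicovariant dc_fodc;
  dc_env : universal_envelope dc_fodc;
  dc_hopf : envelope_hopf dc_env;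
  dc_coact : {linear dc_forms -> (dc_forms ⊗ dc_env)%type};
  dc_coact_morph : gdsa_tmorphism dc_coact;
  dc_coactP : forall x, dc_coact (dc_P x) = tmap dc_P (ue_H dc_env) (qp_coact zeta x)
}.

Section GaugeGroups.
Variables (G : cmqg) (zeta : qpbundle G) (calc : diff_calculus zeta).
Local Notation Om := (dc_forms calc).
Local Notation Env := (dc_env calc).
Local Notation coact := (dc_coact calc).

Definition base_form (mu : Om) : Prop := coact mu = mu ⊗ 1.

Definition graded_linear (A B : gdsa) (f : A -> B) : Prop :=
  linear f /\ forall k x, homog k x -> homog k (f x).

Definition convolution (f1 f2 : Env -> Om) (t : Env) : Om :=
  tlift (fun a b => f1 a * f2 b) (e_comul (dc_hopf calc) t).

Definition conv_unit (t : Env) : Om := e_counit (dc_hopf calc) t *: 1.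

Definition conv_invertible_maps : set (Env -> Om) := fun f =>
  [/\ graded_linear f,
      f 1 = 1,
      forall t, tmap f id (Ad (dc_hopf calc) t) = coact (f t)
    & exists g : Env -> Om, [/\ graded_linear g,
        convolution f g = conv_unit & convolution g f = conv_unit]].

Definition gauge_transformations : set (Om -> Om) := fun F =>
  [/\ graded_linear F, bijective F,
      forall mu w, base_form mu -> F (mu * w) = mu * F w,
      F 1 = 1
    & forall w, tmap F id (coact w) = coact (F w)].

(** The product is composition in diagrammatic order. *)
Definition gauge_comp (F1 F2 : Om -> Om) : Om -> Om := fun w => F2 (F1 w).

End GaugeGroups.

End QuantumBundles.

Arguments comul {R h}.
Arguments counit {R h}.
Arguments antipode {R h}.
Arguments qp_base {R G} q _.
Arguments base_form {R G zeta} calc mu.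
Arguments convolution {R G zeta} calc f1 f2 t.
Arguments conv_unit {R G zeta} calc t.
Arguments conv_invertible_maps {R G zeta} calc _.
Arguments gauge_transformations {R G zeta} calc _.
Arguments gauge_comp {R G zeta} calc F1 F2 w.

Definition group_on (T : Type) (D : set T) (op : T -> T -> T) (e : T) : Prop :=
  [/\ D e,
      forall x y, D x -> D y -> D (op x y),
      forall x y z, D x -> D y -> D z -> op x (op y z) = op (op x y) z,
      forall x, D x -> op e x = x /\ op x e = x
    & forall x, D x -> exists y, [/\ D y, op x y = e & op y x = e]].

Definition group_isomorphic (T T' : Type)
    (D : set T) (op : T -> T -> T) (D' : set T') (op' : T' -> T' -> T') : Prop :=
  exists Phi : T -> T', set_bij D D' Phi /\
    forall x y, D x -> D y -> Phi (op x y) = op' (Phi x) (Phi y).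

(* Main.v *)
Require Import Defs.
From mathcomp Require Import all_boot all_order all_algebra complex.
From mathcomp Require Import boolp classical_sets functions fsbigop reals.

Set Implicit Arguments.
Unset Strict Implicit.
Unset Printing Implicit Defensive.

Import Order.TTheory GRing.Theory Num.Theory.
Local Open Scope ring_scope.

(** For f : Γ^∧ -> Ω(P) put F_f(w) = w0 f(w1), where w0 ⊗ w1 is the coaction.
    Since the elements x Δ(y) span Ω(P) ⊗ Γ^∧, f is determined by F_f, and the
    Ad-covariance of f amounts to the colinearity of F_f; then
    F_(f * g) = F_g ∘ F_f, so everything reduces to showing that each left
    Ω(B)-linear F is some F_f.

    In degree 0 this rests on averaging.  The Haar functional λ of H gives a
    projection E(a) = a0 λ(a1) of the horizontal forms onto Ω(B), and if X ⊗ Y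
    depends linearly on t with X Δ(Y) = 1 ⊗ t, then
    w = E(w0 X(w1)) Y(w1), hence F(w) = E(w0 X(w1)) F(Y(w1)) = w0 f(w1).  The Haar
    functional does not extend to an integral on Γ^∧, so the general case goes by
    induction on the vertical degree of w (the largest degree of w1): if F
    vanishes in vertical degree < k, the same argument with X in Ω^0 and Y in Ω^k
    gives an f_k such that F - F_(f_k) vanishes in vertical degree <= k. *)

(** * Complements and generalized inverses *)

Section Complement.
Variables (K : fieldType) (V : lmodType K).

(** The bundle provides surjectivity of the canonical map in degree 0 only. Applying d to a preimage
    of 1 ⊗ h yields one of 1 ⊗ dh, so every 1 ⊗ t is reached, and a generalized inverse makes the
    choice of X ⊗ Y linear in t. The legs of this X ⊗ Y need not be homogeneous. Truncating them to
    Ω^0 and Ω^k controls the component of vertical degree k of X Δ(Y) and nothing below it; this is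
    why [F] is corrected one vertical degree at a time. A second obstacle is that E(a) is a base
    form only for horizontal a, whereas w0 is not horizontal in general. In the component of top
    vertical degree it can be chosen horizontal, by coassociativity and a count of degrees. The
    vertical degree is finite for each form but not bounded on Ω(P). The f_k still glue to a single
    f, because f_k only sees the degree k part of Γ^∧. The Haar functional is not among the data of
    [cmqg]. It is built from Zorn's lemma, orthogonal complements for unitary matrices playing the
    role of complete reducibility. *)

Definition subspace (S : set V) : Prop :=
  S 0 /\ forall c x y, S x -> S y -> S (c *: x + y).

Lemma subspaceZ S c x : subspace S -> S x -> S (c *: x).
Proof. by move=> [S0 SD] Sx; rewrite -[_ *: _]addr0; apply: SD. Qed.

Lemma subspaceD S x y : subspace S -> S x -> S y -> S (x + y).
Proof. by move=> [S0 SD] Sx Sy; rewrite -[x]scale1r; apply: SD. Qed.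

Lemma subspaceN S x : subspace S -> S x -> S (- x).
Proof. by move=> sS Sx; rewrite -scaleN1r; apply: subspaceZ. Qed.

Lemma subspaceB S x y : subspace S -> S x -> S y -> S (x - y).
Proof. by move=> sS Sx Sy; apply: subspaceD => //; apply: subspaceN. Qed.

Lemma complement (S : set V) : subspace S ->
  exists T : set V, [/\ subspace T, forall x, S x -> T x -> x = 0 &
    forall x, exists s t, [/\ S s, T t & x = s + t]].
Proof.
move=> sS.
(* [P] does not ask for 0, since it must hold for the union of the empty chain. A maximal [T]
   without 0 would be empty, hence strictly smaller than {0}. *)
pose P (T : set V) := (forall c x y, T x -> T y -> T (c *: x + y)) /\
  forall x, S x -> T x -> x = 0.
have [|T [[TD TS] Tmax]] := @Zorn_bigcup V P.
  move=> F FP Ftot; split.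
    move=> c x y [A FA Ax] [B FB By].
    have [AB|BA] := Ftot A B FA FB.
      by exists B => //; apply: (FP _ FB).1 => //; apply: AB.
    by exists A => //; apply: (FP _ FA).1 => //; apply: BA.
  by move=> x Sx [A FA Ax]; apply: (FP _ FA).2.
have T0 : T 0.
  apply: contrapT => nT0.
  have Te x : ~ T x.
    by move=> Tx; apply: nT0; rewrite -(addNr x) -scaleN1r; apply: TD.
  case: (Tmax [set 0]%classic); first by split=> [x /Te//|/(_ 0 erefl)/Te].
  by split=> [c x y -> ->|x _ ->//]; rewrite scaler0 addr0.
have sT : subspace T by split.
exists T; split=> // x; apply: contrapT => nx.
case: (Tmax (fun z => exists c y, T y /\ z = y + c *: x)).
  split=> [y Ty|TT]; first by exists 0, y; rewrite scale0r addr0.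
  apply: nx; exists 0, x; rewrite add0r; split=> //; first by case: sS.
  by apply: TT; exists 1, 0; rewrite add0r scale1r.
split=> [c z z' [a [y [Ty ->]]] [a' [y' [Ty' ->]]]|z Sz [c [y [Ty zE]]]].
  exists (c * a + a'), (c *: y + y'); split; first exact: TD.
  by rewrite scalerDr scalerA scalerDl addrACA.
have [c0|c0] := eqVneq c 0.
  by apply: TS => //; rewrite zE c0 scale0r addr0.
case: nx; exists (c^-1 *: z), (- (c^-1 *: y)); split.
- exact: subspaceZ.
- by apply: subspaceN => //; apply: subspaceZ.
- by rewrite zE scalerDr scalerA mulVf// scale1r addrAC subrr add0r.
Qed.

End Complement.

(** Unbundled, so that it can be proved by [lin_tac] for functions abstracted from Sweedler sums. *)
Definition lin (K : fieldType) (U V : lmodType K) (f : U -> V) : Prop :=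
  forall a u v, f (a *: u + v) = a *: f u + f v.

Section Lin.
Variables (K : fieldType) (U V W : lmodType K).

Lemma linD (f : U -> V) : lin f -> {morph f : x y / x + y}.
Proof. by move=> lf x y; rewrite -[x]scale1r lf !scale1r. Qed.

Lemma lin0 (f : U -> V) : lin f -> f 0 = 0.
Proof. by move=> lf; apply: (addrI (f 0)); rewrite -linD// !addr0. Qed.

Lemma linZ (f : U -> V) c x : lin f -> f (c *: x) = c *: f x.
Proof. by move=> lf; rewrite -[c *: x]addr0 lf lin0// addr0. Qed.

Lemma linN (f : U -> V) x : lin f -> f (- x) = - f x.
Proof. by move=> lf; rewrite -scaleN1r linZ// scaleN1r. Qed.

Lemma linB (f : U -> V) : lin f -> {morph f : x y / x - y}.
Proof. by move=> lf x y; rewrite linD// linN. Qed.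

Lemma lin_sum (f : U -> V) I (r : seq I) P (F : I -> U) : lin f ->
  f (\sum_(i <- r | P i) F i) = \sum_(i <- r | P i) f (F i).
Proof. by move=> lf; apply: big_morph; [apply: linD | apply: lin0]. Qed.

(** With [T] a complement of the kernel and [L] a complement of the image, [g y] is the only x in
    [T] with y - D x in [L]; uniqueness makes [g] linear. The lemma serves for a linear section of
    the canonical map and for the projection onto horizontal forms. *)
Lemma pseudo_inverse (D : U -> V) : lin D ->
  exists g : V -> U, lin g /\ forall x, D (g (D x)) = D x.
Proof.
move=> lD.
have sK : subspace (fun x => D x = 0).
  by split=> [|c x y Dx Dy]; rewrite ?lin0// lD Dx Dy scaler0 addr0.
have sI : subspace (fun y => exists x, D x = y).
  split=> [|c _ _ [x <-] [y <-]]; first by exists 0; rewrite lin0.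
  by exists (c *: x + y); rewrite lD.
have [T [sT KT KTs]] := complement sK.
have [L [sL IL ILs]] := complement sI.
have ex y : exists x, T x /\ L (y - D x).
  have [_ [t [[x <-] Lt ->]]] := ILs y.
  have [k [x' [Dk Tx' ->]]] := KTs x.
  by exists x'; split=> //; rewrite (linD lD) Dk add0r addrAC subrr add0r.
pose g y := projT1 (cid (ex y)).
have gP y : T (g y) /\ L (y - D (g y)) by exact: projT2 (cid (ex y)).
have gU y x : T x -> L (y - D x) -> x = g y.
  move=> Tx Lx; have [Tg Lg] := gP y.
  apply/eqP; rewrite -subr_eq0; apply/eqP/KT; last exact: subspaceB.
  apply: IL; first by eexists.
  have -> : D (x - g y) = (y - D (g y)) - (y - D x).
    by rewrite (linB lD) opprB [RHS]addrC addrA subrK.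
  exact: subspaceB.
exists g; split=> [a u v|x].
  apply/esym/gU; first by apply: sT.2; apply: (gP _).1.
  have -> : a *: u + v - D (a *: g u + g v) = a *: (u - D (g u)) + (v - D (g v)).
    by rewrite lD scalerBr opprD addrACA.
  by apply: sL.2; apply: (gP _).2.
have [Tg Lg] := gP (D x).
apply/esym/eqP; rewrite -subr_eq0; apply/eqP/IL => //.
by exists (x - g (D x)); rewrite (linB lD).
Qed.

End Lin.

(** A generalized inverse g of c |-> c x is a functional with g(x) x = x. *)
Lemma functional_separation (K : fieldType) (V : lmodType K) (x : V) :
  (forall f : V -> K^o, lin f -> f x = 0) -> x = 0.
Proof.
move=> h; have lD : lin (fun c : K^o => c *: x).
  by move=> a u v; rewrite scalerDl -scalerA.
have [g [lg gP]] := pseudo_inverse lD.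
by have := gP 1; rewrite scale1r (h _ lg) scale0r => /esym.
Qed.

(** * Multilinear maps on tensors

    [tlift f t] is by definition the sum of the [f a b] over the representative
    chosen for [t], whether or not [f] is bilinear.  It is used as a Sweedler sum:
    for a coproduct [D], [tlift (fun a b => e) (D t)] is e(t1, t2). *)

Definition bilin (K : fieldType) (U V W : lmodType K) (f : U -> V -> W) : Prop :=
  (forall v, lin (fun u => f u v)) /\ (forall u, lin (f u)).

Definition trilin (K : fieldType) (U V W X : lmodType K) (f : U -> V -> W -> X) : Prop :=
  [/\ forall v w, lin (fun u => f u v w), forall u w, lin (fun v => f u v w)
    & forall u v, lin (f u v)].

Section TensorCalculus.
Variable K : fieldType.
Implicit Types U V W X Y : lmodType K.

Lemma lin_linear U V (f : {linear U -> V}) : lin f.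
Proof. exact: linearP. Qed.

Lemma lin_id U : lin (fun x : U => x).
Proof. by []. Qed.

Lemma lin_comp U V W (g : V -> W) (f : U -> V) : lin g -> lin f -> lin (fun x => g (f x)).
Proof. by move=> lg lf a u v; rewrite lf lg. Qed.

Lemma lin_add U V (f g : U -> V) : lin f -> lin g -> lin (fun x => f x + g x).
Proof. by move=> lf lg a u v; rewrite lf lg scalerDr addrACA. Qed.

Lemma lin_opp U V (f : U -> V) : lin f -> lin (fun x => - f x).
Proof. by move=> lf a u v; rewrite lf opprD scalerN. Qed.

Lemma lin_scale U V c (f : U -> V) : lin f -> lin (fun x => c *: f x).
Proof. by move=> lf a u v; rewrite lf scalerDr !scalerA mulrC. Qed.

Lemma lin_scale_comp U V W (g : V -> K^o) (f : U -> V) (w : W) :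
  lin g -> lin f -> lin (fun x => g (f x) *: w).
Proof. by move=> lg lf a u v; rewrite lf lg scalerDl -scalerA. Qed.

Lemma lin_scalel U V (f : U -> K^o) (v : V) : lin f -> lin (fun x => f x *: v).
Proof. by move=> lf a u w; rewrite lf scalerDl -scalerA. Qed.

Lemma lin_bigsum U V I (r : seq I) P (f : I -> U -> V) :
  (forall i, lin (f i)) -> lin (fun x => \sum_(i <- r | P i) f i x).
Proof.
move=> lf a u v; rewrite scaler_sumr -big_split.
by apply: eq_bigr => i _; rewrite lf.
Qed.

Lemma lin_mull U (A : algType K) (c : A) (f : U -> A) : lin f -> lin (fun x => c * f x).
Proof. by move=> lf a u v; rewrite lf mulrDr scalerAr. Qed.

Lemma lin_mulr U (A : algType K) (c : A) (f : U -> A) : lin f -> lin (fun x => f x * c).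
Proof. by move=> lf a u v; rewrite lf mulrDl scalerAl. Qed.

Lemma lin_tensl U V W (w : W) (f : U -> V) : lin f -> lin (fun x => f x ⊗ w).
Proof. by move=> lf a u v; rewrite lf tensorDl tensorZl. Qed.

Lemma lin_tensr U V W (w : W) (f : U -> V) : lin f -> lin (fun x => w ⊗ f x).
Proof. by move=> lf a u v; rewrite lf tensorDr tensorZr. Qed.

Lemma tens0l V W (w : W) : (0 : V) ⊗ w = 0.
Proof. by rewrite -(scale0r 0) tensorZl scale0r. Qed.

Lemma tens0r V W (v : V) : v ⊗ (0 : W) = 0.
Proof. by rewrite -(scale0r 0) tensorZr scale0r. Qed.

Lemma lin_tlift_body U V W X (g : U -> V -> W -> X) t :
  (forall v w, lin (fun x => g x v w)) -> lin (fun x => tlift (g x) t).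
Proof.
move=> lg a x y; rewrite /tlift /bt_lift /fsum scaler_sumr -big_split.
by apply: eq_bigr => p _; rewrite lg.
Qed.

Lemma bilin_balanced U V W (f : U -> V -> W) : bilin f -> tbalanced f.
Proof.
move=> [fl fr]; split=> [u u' v|u v v'|u c v].
- exact: (linD (fl v)).
- exact: (linD (fr u)).
- by rewrite (linZ _ _ (fl v)) (linZ _ _ (fr u)).
Qed.

Lemma swE U V W (f : U -> V -> W) u v : bilin f -> tlift f (u ⊗ v) = f u v.
Proof. by move=> /bilin_balanced fb; rewrite tliftE. Qed.

Lemma lin_sw U V W (f : U -> V -> W) : bilin f -> lin (tlift f).
Proof.
move=> bf a s t; have fb := bilin_balanced bf; rewrite tliftD// tliftZ// => u v.
exact: (linZ _ _ (bf.1 v)).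
Qed.

Lemma lin_tlift U V W X (f : U -> V -> W) (g : X -> (U ⊗ V)%type) :
  bilin f -> lin g -> lin (fun x => tlift f (g x)).
Proof. by move=> /lin_sw lf lg; apply: lin_comp. Qed.

(** [g] is arbitrary, as only a finite sum is involved: linear maps move in and out of nested
    Sweedler sums without side conditions on the bodies. *)
Lemma lin_out U V W X (F : W -> X) (g : U -> V -> W) t :
  lin F -> F (tlift g t) = tlift (fun a b => F (g a b)) t.
Proof. by move=> lF; rewrite /tlift /bt_lift /fsum lin_sum. Qed.

Lemma sw_sw U V W X Y (f : W -> X -> Y) (g : U -> V -> (W ⊗ X)%type) t :
  bilin f -> tlift f (tlift g t) = tlift (fun a b => tlift f (g a b)) t.
Proof. by move=> /lin_sw/lin_out->. Qed.

Lemma sw_exchange U V W X Y (f : U -> V -> W -> X -> Y) s t :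
  tlift (fun a b => tlift (f a b) t) s =
  tlift (fun c d => tlift (fun a b => f a b c d) s) t.
Proof. exact: exchange_big. Qed.

Lemma sw0 U V W (f : U -> V -> W) t : (forall a b, f a b = 0) -> tlift f t = 0.
Proof. by move=> f0; rewrite /tlift /bt_lift /fsum big1. Qed.

Lemma sw_id U V (t : (U ⊗ V)%type) : tlift (fun a b => a ⊗ b) t = t.
Proof.
by rewrite -[RHS]reprK -/(bt_class _ _ (repr t)) bt_class_sum.
Qed.

Lemma lin_tens_ext U V W (f g : (U ⊗ V)%type -> W) : lin f -> lin g ->
  (forall u v, f (u ⊗ v) = g (u ⊗ v)) -> f =1 g.
Proof.
move=> lf lg fg; elim/tens_ind => [|x y hx hy|//]; first by rewrite !lin0.
by rewrite (linD lf) (linD lg) hx hy.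
Qed.

Lemma bilin_tens U V W X (f : U -> W) (g : V -> X) : lin f -> lin g ->
  bilin (fun a b => f a ⊗ g b).
Proof. by move=> lf lg; split=> ?; [apply: lin_tensl | apply: lin_tensr]. Qed.

Lemma lin_tmap U V W X Y (f : U -> W) (g : V -> X) (h : Y -> (U ⊗ V)%type) :
  lin f -> lin g -> lin h -> lin (fun x => tmap f g (h x)).
Proof. by move=> lf lg; apply: lin_tlift; apply: bilin_tens. Qed.

Lemma sw_tmap U V W X Y (f : W -> X -> Y) (g : U -> W) (h : V -> X) t :
  bilin f -> tlift f (tmap g h t) = tlift (fun a b => f (g a) (h b)) t.
Proof. by move=> bf; rewrite sw_sw//; apply: eq_tlift => a b; rewrite swE. Qed.

Lemma tmap_tens U V W X (f : U -> W) (g : V -> X) u v : lin f -> lin g ->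
  tmap f g (u ⊗ v) = f u ⊗ g v.
Proof. by move=> lf lg; rewrite /tmap swE//; apply: bilin_tens. Qed.

Lemma trilin1 U V W X Y (f : U -> V -> W -> X) (g : Y -> U) v w :
  trilin f -> lin g -> lin (fun x => f (g x) v w).
Proof. by case=> fl _ _; apply: (lin_comp (fl v w)). Qed.

Lemma trilin2 U V W X Y (f : U -> V -> W -> X) (g : Y -> V) u w :
  trilin f -> lin g -> lin (fun x => f u (g x) w).
Proof. by case=> _ fl _; apply: (lin_comp (fl u w)). Qed.

Lemma trilin3 U V W X Y (f : U -> V -> W -> X) (g : Y -> W) u v :
  trilin f -> lin g -> lin (fun x => f u v (g x)).
Proof. by case=> _ _ fl; apply: (lin_comp (fl u v)). Qed.

(** Converts an equality of triple tensors into an exchange rule for Sweedler sums, the form in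
    which coassociativity is used below. *)
Lemma tassoc_trilin U V W X (f : U -> V -> W -> X) t : trilin f ->
  tlift (fun u vw => tlift (f u) vw) (tassoc t) =
  tlift (fun uv w => tlift (fun u v => f u v w) uv) t.
Proof.
move=> [fl1 fl2 fl3]; rewrite /tassoc.
have b1 : bilin (fun u vw => tlift (f u) vw).
  split=> *; first by apply: lin_tlift_body => *; apply: fl1.
  by apply: lin_sw; split=> *; [apply: fl2 | apply: fl3].
rewrite sw_sw//; apply: eq_tlift => uv w; rewrite sw_sw//.
by apply: eq_tlift => u v; rewrite swE// swE.
Qed.

End TensorCalculus.

(** A hook of [lin_step], redefined once the graded operations are known to be linear. *)
Ltac lin_graded_step := fail.

Ltac lin_step :=
  match goal with
  | |- bilin _ => split; intros; cbv beta
  | |- trilin _ => split; intros; cbv beta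
  | |- lin (fun x => x) => exact: lin_id
  | |- lin id => exact: lin_id
  | |- lin (GRing.Linear.sort _) => exact: lin_linear
  | |- lin (GRing.LRMorphism.sort _) => exact: lin_linear
  | H : lin ?f |- lin ?f => exact: H
  | H : bilin ?f |- lin (?f _) => apply: (proj2 H)
  | |- lin (fun x => _ + _) => apply: lin_add
  | |- lin (fun x => - _) => apply: lin_opp
  | H : lin ?g |- lin (fun x => ?g _ *: ?w) => apply: (lin_scale_comp _ H)
  | |- lin (fun x => ?c *: _) => apply: lin_scale
  | |- lin (fun x => _ *: ?v) => apply: lin_scalel
  | |- lin (fun x => ?c * _) => apply: lin_mull
  | |- lin (fun x => _ * ?c) => apply: lin_mulr
  | |- lin (fun x => ?c ⊗ _) => apply: lin_tensr
  | |- lin (fun x => _ ⊗ ?c) => apply: lin_tensl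
  | |- lin ( *%R ?c) => exact: (lin_mull c (@lin_id _ _))
  | |- lin ( *:%R ?c) => exact: (lin_scale c (@lin_id _ _))
  | |- lin (tensor ?c) => exact: (lin_tensr c (@lin_id _ _))
  | |- lin (tlift _) => apply: lin_sw
  | |- lin (fun x => tlift _ ?t) => apply: lin_tlift_body; intros; cbv beta
  | |- lin (fun x => tlift ?f _) => apply: lin_tlift; cbv beta
  | |- lin (tmap _ _) => apply: (lin_tmap _ _ (@lin_id _ _)); cbv beta
  | |- lin (fun x => tmap _ _ _) => apply: lin_tmap; cbv beta
  | |- lin (fun x => GRing.Linear.sort _ _) => apply: (lin_comp (lin_linear _)); cbv beta
  | |- lin (fun x => GRing.LRMorphism.sort _ _) => apply: (lin_comp (lin_linear _)); cbv beta
  | H : lin ?f |- lin (fun x => ?f _) => apply: (lin_comp H); cbv beta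
  | H : bilin ?f |- lin (fun x => ?f ?a _) => apply: (lin_comp (proj2 H a)); cbv beta
  | H : bilin ?f |- lin (fun x => ?f _ ?b) => apply: (lin_comp (proj1 H b)); cbv beta
  | H : trilin ?f |- lin (?f _ _) => apply: (trilin3 _ _ H (@lin_id _ _))
  | H : trilin ?f |- lin (fun x => ?f ?a ?b _) => apply: (trilin3 a b H)
  | H : trilin ?f |- lin (fun x => ?f ?a _ ?c) => apply: (trilin2 a c H)
  | H : trilin ?f |- lin (fun x => ?f _ ?b ?c) => apply: (trilin1 b c H)
  | |- lin (fun x => \sum_(i <- _ | _) _) => apply: lin_bigsum; intros; cbv beta
  | H : (forall a, lin _) |- lin _ => apply: H
  | |- _ => lin_graded_step
  end.
Ltac lin_tac := repeat lin_step; try done.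

(** * Graded tensor products *)

Section GradedAlgebra.
Variables (R : realType) (A : gdsa R).
Local Notation C := R[i].

Lemma homogK k (x : A) : homog k (hcomp A k x).
Proof. by rewrite /homog hcompK eqxx. Qed.

Lemma hcomp_homog j k (x : A) : homog j x -> hcomp A k x = if k == j then x else 0.
Proof. by move=> <-; rewrite hcompK; case: eqP => // ->. Qed.

Lemma homog_decomp (x : A) : exists n, x = \sum_(i < n) hcomp A i x.
Proof. exact: hcomp_sum. Qed.

Lemma homog_ind (Q : A -> Prop) : Q 0 -> (forall x y, Q x -> Q y -> Q (x + y)) ->
  (forall k x, homog k x -> Q x) -> forall x, Q x.
Proof.
move=> Q0 QD Qh x; have [n ->] := homog_decomp x.
elim/big_ind: _ => // i _; exact: Qh (homogK _ _).
Qed.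

Lemma lin_homog_ext (V : lmodType C) (f g : A -> V) : lin f -> lin g ->
  (forall k x, homog k x -> f x = g x) -> f =1 g.
Proof.
move=> lf lg fg; elim/homog_ind => [|x y hx hy|//]; first by rewrite !lin0.
by rewrite (linD lf) (linD lg) hx hy.
Qed.

Lemma lin_gsum (V : lmodType C) (F : nat -> A -> V) : (forall k, lin (F k)) -> lin (gsum F).
Proof.
move=> lF a x y; rewrite gsumD => [|k u v]; last exact: (linD (lF k)).
congr (_ + _); have [n xn] := hcomp_fin x.
have F0 k : F k 0 = 0 by rewrite (lin0 (lF k)).
rewrite (gsum_ord F0 xn) (@gsum_ord _ _ _ _ _ n)//.
  by rewrite scaler_sumr; apply: eq_bigr => i _; rewrite linearZ (linZ _ _ (lF i)).
by move=> k /xn xk; rewrite linearZ /= xk scaler0.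
Qed.

Lemma lin_gsum_body (U V : lmodType C) (F : U -> nat -> A -> V) t :
  (forall u k, F u k 0 = 0) -> (forall k a, lin (fun u => F u k a)) ->
  lin (fun u => gsum (F u) t).
Proof.
move=> F0 lF a x y; have [n tn] := hcomp_fin t.
rewrite !(gsum_ord _ tn)// scaler_sumr -big_split.
by apply: eq_bigr => i _; rewrite lF.
Qed.

(** The operator (-1)^∂x turns the signs of products with a factor of degree 1
    into linear operations on non-homogeneous elements. *)
Definition parity (x : A) : A := gsum (fun k a => (-1) ^+ k *: a) x.

Lemma lin_parity : lin parity.
Proof. by apply: lin_gsum => k; apply: lin_scale. Qed.

Lemma parityE k (x : A) : homog k x -> parity x = (-1) ^+ k *: x.
Proof. by move=> xk; rewrite /parity (gsumE _ xk)// => j; rewrite scaler0. Qed.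

Lemma homogM' i j (x y : A) : homog i x -> homog j y -> homog (i + j) (x * y).
Proof. exact: homogM. Qed.

Lemma homogZ k c (x : A) : homog k x -> homog k (c *: x).
Proof. by rewrite /homog linearZ => /= ->. Qed.

Lemma homog_parity k (x : A) : homog k x -> homog k (parity x).
Proof. by move=> xk; rewrite (parityE xk); apply: homogZ. Qed.

Lemma parityM (x y : A) : parity (x * y) = parity x * parity y.
Proof.
move: x; apply: lin_homog_ext => [||i x xi].
- by apply: (lin_comp lin_parity); apply: lin_mulr.
- by apply: lin_mulr; apply: lin_parity.
move: y; apply: lin_homog_ext => [||j y yj].
- by apply: (lin_comp lin_parity); apply: lin_mull.
- by apply: lin_mull; apply: lin_parity.
rewrite (parityE (homogM' xi yj)) (parityE xi) (parityE yj).
by rewrite -scalerAl -scalerAr scalerA exprD.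
Qed.

(** Degrees are nonnegative, so a product of homogeneous elements has degree 0 only when both
    factors do. *)
Lemma hcomp0M (x y : A) : hcomp A 0 (x * y) = hcomp A 0 x * hcomp A 0 y.
Proof.
move: x; apply: lin_homog_ext => [||i x xi].
- by apply: (lin_comp (lin_linear _)); apply: lin_mulr.
- by apply: lin_mulr; apply: lin_linear.
move: y; apply: lin_homog_ext => [||j y yj].
- by apply: (lin_comp (lin_linear _)); apply: lin_mull.
- by apply: lin_mull; apply: lin_linear.
rewrite (hcomp_homog _ (homogM' xi yj)) (hcomp_homog _ xi) (hcomp_homog _ yj).
by case: i xi j yj => [|i] xi [|j] yj; rewrite /= ?mul0r ?mulr0.
Qed.

Lemma gd_d1 : gd_d A 1 = 0.
Proof.
have := gd_leibniz 1 (@homog1 _ A); rewrite !mulr1 expr0 !mul1r.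
by move/eqP; rewrite -subr_eq0 opprD addNKr oppr_eq0 => /eqP.
Qed.

End GradedAlgebra.

Arguments parity {R A} x.

Section GradedTensorProduct.
Variables (R : realType) (A B : gdsa R).
Local Notation C := R[i].
Implicit Types s t : (A ⊗ B)%type.

Lemma homog_tens_ind (Q : (A ⊗ B)%type -> Prop) :
  Q 0 -> (forall x y, Q x -> Q y -> Q (x + y)) ->
  (forall i j x y, homog i x -> homog j y -> Q (x ⊗ y)) -> forall t, Q t.
Proof.
move=> Q0 QD Qh; elim/tens_ind => // x y.
elim/homog_ind: x => [|x x' hx hx'|i x xi].
- by rewrite tens0l.
- by rewrite tensorDl; apply: QD.
elim/homog_ind: y => [|y y' hy hy'|j y yj].
- by rewrite tens0r.
- by rewrite tensorDr; apply: QD.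
exact: Qh xi yj.
Qed.

Lemma lin_homog_tens_ext (V : lmodType C) (f g : (A ⊗ B)%type -> V) : lin f -> lin g ->
  (forall i j x y, homog i x -> homog j y -> f (x ⊗ y) = g (x ⊗ y)) -> f =1 g.
Proof.
move=> lf lg fg; elim/homog_tens_ind => [|x y hx hy|//]; first by rewrite !lin0.
by rewrite (linD lf) (linD lg) hx hy.
Qed.

Let F (x : A) (y' : B) i (yi : B) j (xj : A) : (A ⊗ B)%type :=
  (-1) ^+ (i * j) *: ((x * xj) ⊗ (yi * y')).

Let F0r x y' i yi j : F x y' i yi j 0 = 0.
Proof. by rewrite /F mulr0 tens0l scaler0. Qed.

Let F0l x y' i j xj : F x y' i 0 j xj = 0.
Proof. by rewrite /F mul0r tens0r scaler0. Qed.

Let gsumF0 x y' i x' : gsum (F x y' i 0) x' = 0.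
Proof. by have [n xn] := hcomp_fin x'; rewrite (gsum_ord _ xn)// big1. Qed.

Lemma lin_gmulr s : lin (gmul s).
Proof.
apply: lin_tlift_body => x y; apply: lin_sw; split=> [y'|x'].
  apply: (@lin_gsum_body _ _ _ _ (fun u i yi => gsum (F x y' i yi) u)) => //.
  by move=> k a; apply: lin_gsum => j; rewrite /F; lin_tac.
apply: (@lin_gsum_body _ _ _ _ (fun u i yi => gsum (F x u i yi) x')) => //.
move=> k a; apply: (@lin_gsum_body _ _ _ _ (fun u => F x u k a)) => //.
by move=> j b; rewrite /F; lin_tac.
Qed.

Lemma lin_gmull t : lin (fun s => gmul s t).
Proof.
rewrite /gmul; apply: lin_sw; split=> [y|x]; apply: lin_tlift_body => x' y'.
  apply: (@lin_gsum_body _ _ _ _ (fun u i yi => gsum (F u y' i yi) x')) => //.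
  move=> k a; apply: (@lin_gsum_body _ _ _ _ (fun u => F u y' k a)) => //.
  by move=> j b; rewrite /F; lin_tac.
apply: (@lin_gsum _ _ _ (fun i yi => gsum (F x y' i yi) x')) => k.
apply: (@lin_gsum_body _ _ _ _ (fun u => F x y' k u)) => //.
by move=> j b; rewrite /F; lin_tac.
Qed.

End GradedTensorProduct.

Ltac lin_graded_step ::=
  match goal with
  | |- lin parity => exact: lin_parity
  | |- lin (gmul ?s) => apply: lin_gmulr
  | |- lin (fun x => parity _) => apply: (lin_comp (@lin_parity _ _)); cbv beta
  | |- lin (fun x => gmul ?s _) => apply: (lin_comp (lin_gmulr s)); cbv beta
  | |- lin (fun x => gmul _ ?t) => apply: (lin_comp (lin_gmull t)); cbv beta
  end.

Section GradedTensorProductTheory.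
Variables (R : realType) (A B : gdsa R).
Local Notation C := R[i].
Implicit Types s t : (A ⊗ B)%type.

Lemma gmulA s t u : gmul s (gmul t u) = gmul (gmul s t) u.
Proof.
move: s; apply: lin_homog_tens_ext => [||i j x y xi yj]; try by lin_tac.
move: t; apply: lin_homog_tens_ext => [||i' j' x' y' xi' yj']; try by lin_tac.
move: u; apply: lin_homog_tens_ext => [||i'' j'' x'' y'' xi'' yj'']; try by lin_tac.
rewrite (gmulE _ _ yj' xi'') (gmulE _ _ yj xi') (linZ _ _ (lin_gmulr _)).
rewrite (linZ _ _ (lin_gmull _)) (gmulE _ _ yj (homogM' xi' xi'')).
rewrite (gmulE _ _ (homogM' yj yj') xi'') !scalerA !mulrA -!exprD.
by congr (_ ^+ _ *: _); rewrite mulnDr mulnDl addnC addnA.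
Qed.

Lemma gmul_tensl0 (x x' : A) (y y' : B) : homog 0 y ->
  gmul (x ⊗ y) (x' ⊗ y') = (x * x') ⊗ (y * y').
Proof.
move=> y0; move: x'; apply: lin_homog_ext => [||i x' x'i]; try by lin_tac.
by rewrite (gmulE _ _ y0 x'i) mul0n expr0 scale1r.
Qed.

Lemma gmul_tensr0 (x x' : A) (y y' : B) : homog 0 x' ->
  gmul (x ⊗ y) (x' ⊗ y') = (x * x') ⊗ (y * y').
Proof.
move=> x'0; move: y; apply: lin_homog_ext => [||i y yi]; try by lin_tac.
by rewrite (gmulE _ _ yi x'0) muln0 expr0 scale1r.
Qed.

Lemma gmul_tens1 (x x' : A) (y y' : B) : homog 1 y ->
  gmul (x ⊗ y) (x' ⊗ y') = (x * parity x') ⊗ (y * y').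
Proof.
move=> y1; move: x'; apply: lin_homog_ext => [||i x' x'i]; try by lin_tac.
by rewrite (gmulE _ _ y1 x'i) mul1n (parityE x'i) -scalerAr tensorZl.
Qed.

Lemma gmul_left (x x' : A) (y' : B) : gmul (x ⊗ 1) (x' ⊗ y') = (x * x') ⊗ y'.
Proof. by rewrite gmul_tensl0 ?mul1r//; apply: homog1. Qed.

Lemma gmul_right (x : A) (y y' : B) : gmul (x ⊗ y) (1 ⊗ y') = x ⊗ (y * y').
Proof. by rewrite gmul_tensr0 ?mulr1//; apply: homog1. Qed.

Lemma gmul1l t : gmul (1 ⊗ 1) t = t.
Proof.
move: t; apply: lin_tens_ext; try by lin_tac.
by move=> u v; rewrite gmul_left mul1r.
Qed.

Lemma gmul1r t : gmul t (1 ⊗ 1) = t.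
Proof.
move: t; apply: lin_tens_ext; try by lin_tac.
by move=> u v; rewrite gmul_right mulr1.
Qed.

Lemma lin_gtens_d : lin (@gtens_d R A B).
Proof.
apply: lin_sw; split=> [y|x]; apply: lin_add; try by lin_tac.
  by apply: lin_gsum => k; lin_tac.
apply: lin_gsum_body => [u k|k a]; lin_tac.
by rewrite tens0l scaler0.
Qed.

Lemma gtens_d_tens (x : A) (y : B) :
  gtens_d (x ⊗ y) = gd_d A x ⊗ y + parity x ⊗ gd_d B y.
Proof.
move: x; apply: lin_homog_ext => [||i x xi].
- by apply: (lin_comp lin_gtens_d); lin_tac.
- by lin_tac.
by rewrite (gtens_dE _ xi) (parityE xi) tensorZl.
Qed.

Lemma lin_gtens_comp k : lin (@gtens_comp R A B k).
Proof. by apply: lin_sw; lin_tac. Qed.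

End GradedTensorProductTheory.

(** * Coactions determined by their degree 0 part *)

Section GradedCoaction.
Variables (R : realType) (A E : gdsa R).
Local Notation C := R[i].
Variables (P H : algType C) (i : {linear P -> A}) (j : {linear H -> E}).
Variables (rho : {linear P -> (P ⊗ H)%type}) (D : {linear A -> (A ⊗ E)%type}).
Hypotheses (i0 : forall p, homog 0 (i p)) (j0 : forall h, homog 0 (j h)).
Hypotheses (Dm : gdsa_tmorphism D) (Di : forall p, D (i p) = tmap i j (rho p)).

(** [A] and [E] are abstract in order to cover both the coaction on Ω(P) and the coproduct of the
    envelope. No sign arises because [j p1] has degree 0. *)
Lemma coact_mul0 p w :
  D (i p * w) = tlift (fun p0 p1 => tlift (fun w0 w1 =>
    (i p0 * w0) ⊗ (j p1 * w1)) (D w)) (rho p).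
Proof.
rewrite (gm_M Dm) Di /tmap (lin_out _ _ (lin_gmull _)); apply: eq_tlift => p0 p1.
rewrite -[in LHS](sw_id (D w)) (lin_out _ _ (lin_gmulr _)).
by apply: eq_tlift => w0 w1; rewrite gmul_tensl0.
Qed.

(** The two summands are those of d on a tensor product; [parity] is the sign of d (j p1) passing
    w0. *)
Lemma coact_muld p w :
  D (gd_d A (i p) * w) = tlift (fun p0 p1 => tlift (fun w0 w1 =>
    (gd_d A (i p0) * w0) ⊗ (j p1 * w1) +
    (i p0 * parity w0) ⊗ (gd_d E (j p1) * w1)) (D w)) (rho p).
Proof.
rewrite (gm_M Dm) (gm_d Dm) Di /tmap (lin_out _ _ (@lin_gtens_d _ _ _)).
rewrite (lin_out _ _ (lin_gmull _)); apply: eq_tlift => p0 p1.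
rewrite -[in LHS](sw_id (D w)) (lin_out _ _ (lin_gmulr _)).
apply: eq_tlift => w0 w1; rewrite gtens_d_tens (linD (lin_gmull _)).
rewrite gmul_tensl0// gmul_tens1; last exact: homog_d (j0 _).
by rewrite (parityE (i0 _)) expr0 scale1r.
Qed.

(** [D] preserves the total degree a + b, and (-1)^(a + b) splits over the two legs. *)
Lemma coact_parity w : D (parity w) = tmap parity parity (D w).
Proof.
move: w; apply: lin_homog_ext => [||k w wk]; try by lin_tac.
rewrite (parityE wk) linearZ /= -wk (gm_comp Dm).
rewrite -(linZ _ _ (lin_gtens_comp _)); move: (D w) => {w wk}.
apply: lin_homog_tens_ext => [||a b x y xa yb]; try by lin_tac.
  by apply: (lin_comp (lin_gtens_comp k)); lin_tac.
apply: (lin_comp (g := tmap parity parity)); first by apply: lin_tmap; lin_tac.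
  exact: lin_gtens_comp.
rewrite (linZ _ _ (lin_gtens_comp _)) (gtens_compE _ xa yb); case: eqP => [<-|_].
  rewrite tmap_tens; try by lin_tac.
  rewrite (parityE xa) (parityE yb) tensorZl tensorZr scalerA.
  by rewrite exprD.
by rewrite scaler0 (lin0 (lin_tmap _ _ (@lin_id _ _)))//; lin_tac.
Qed.

End GradedCoaction.

(** * Coassociativity, propagated from degree 0 along generators *)

Section Coassociativity.
Variables (R : realType) (A E : gdsa R).
Local Notation C := R[i].
Variables (P H : algType C) (i : {linear P -> A}) (j : {linear H -> E}).
Variables (rho : {linear P -> (P ⊗ H)%type}) (D : {linear A -> (A ⊗ E)%type}).
Variables (DH : {linear H -> (H ⊗ H)%type}) (DE : {linear E -> (E ⊗ E)%type}).
Hypotheses (i0 : forall p, homog 0 (i p)) (j0 : forall h, homog 0 (j h)).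
Hypotheses (Dm : gdsa_tmorphism D) (Di : forall p, D (i p) = tmap i j (rho p)).
Hypotheses (DEm : gdsa_tmorphism DE) (DEj : forall h, DE (j h) = tmap j j (DH h)).
Hypothesis gen : forall Q : A -> Prop,
  (forall x y, Q x -> Q y -> Q (x + y)) -> Q 1 ->
  (forall p w, Q w -> Q (i p * w)) -> (forall p w, Q w -> Q (gd_d A (i p) * w)) ->
  forall w, Q w.
Hypothesis rhoA : forall p, tassoc (tmap rho id (rho p)) = tmap id DH (rho p).

Let rho_trilin (V : lmodType C) (T : P -> H -> H -> V) p : trilin T ->
  tlift (fun a b => tlift (fun a0 a1 => T a0 a1 b) (rho a)) (rho p) =
  tlift (fun a b => tlift (T a) (DH b)) (rho p).
Proof.
move=> tT; have := congr1 (tlift (fun u vw => tlift (T u) vw)) (rhoA p).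
by rewrite (tassoc_trilin _ tT) !sw_tmap; lin_tac.
Qed.

(** Coassociativity, contracted with a trilinear map.  It propagates from [w] to
    [i p * w] and to [d (i p) * w], and these operations generate everything. *)
Lemma coact_trilin (V : lmodType C) (T : A -> E -> E -> V) w : trilin T ->
  tlift (fun a b => tlift (fun a0 a1 => T a0 a1 b) (D a)) (D w) =
  tlift (fun a b => tlift (T a) (DE b)) (D w).
Proof.
move: w V T; apply: gen => [x y hx hy V T tT|V T tT|p w IH V T tT|p w IH V T tT].
- rewrite linearD /=.
  by rewrite !(linD (lin_sw _)) ?hx ?hy//; lin_tac.
- by rewrite (gm_1 Dm) !swE ?(gm_1 Dm) ?(gm_1 DEm) ?swE//; lin_tac.
- have bF : bilin (fun a b => tlift (fun a0 a1 => T a0 a1 b) (D a)) by lin_tac.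
  have bG : bilin (fun a b => tlift (T a) (DE b)) by lin_tac.
  have bT c : bilin (fun a b => T a b c) by lin_tac.
  have bT' a : bilin (T a) by lin_tac.
  rewrite (coact_mul0 j0 Dm Di) !sw_sw//.
  transitivity (tlift (fun p0 p1 => tlift (fun p00 p01 =>
      tlift (fun w0 w1 => tlift (fun w00 w01 =>
        T (i p00 * w00) (j p01 * w01) (j p1 * w1)) (D w0)) (D w)) (rho p0)) (rho p)).
    apply: eq_tlift => p0 p1; rewrite sw_sw// sw_exchange; apply: eq_tlift => w0 w1.
    rewrite swE// (coact_mul0 j0 Dm Di) sw_sw//.
    apply: eq_tlift => p00 p01; rewrite sw_sw//.
    by apply: eq_tlift => w00 w01; rewrite swE.
  transitivity (tlift (fun p0 p1 => tlift (fun p00 p01 =>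
      tlift (fun w0 w1 => tlift (fun w10 w11 =>
        T (i p00 * w0) (j p01 * w10) (j p1 * w11)) (DE w1)) (D w)) (rho p0)) (rho p)).
    apply: eq_tlift => p0 p1; apply: eq_tlift => p00 p01.
    by rewrite (IH _ (fun a b c => T (i p00 * a) (j p01 * b) (j p1 * c)))//; lin_tac.
  rewrite (rho_trilin (T := fun a b c => tlift (fun w0 w1 => tlift (fun w10 w11 =>
        T (i a * w0) (j b * w10) (j c * w11)) (DE w1)) (D w))); last by lin_tac.
  apply: eq_tlift => p0 p1; rewrite sw_sw// sw_exchange; apply: eq_tlift => w0 w1.
  rewrite swE// (coact_mul0 j0 DEm DEj) sw_sw//.
  apply: eq_tlift => p10 p11; rewrite sw_sw//.
  by apply: eq_tlift => w10 w11; rewrite swE.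
- have bF : bilin (fun a b => tlift (fun a0 a1 => T a0 a1 b) (D a)) by lin_tac.
  have bG : bilin (fun a b => tlift (T a) (DE b)) by lin_tac.
  have bT c : bilin (fun a b => T a b c) by lin_tac.
  have bT' a : bilin (T a) by lin_tac.
  (* The three places where d can fall in a triple tensor product, with the signs of the w-legs that
     it passes. *)
  pose X a b c x y z :=
    T (gd_d A (i a) * x) (j b * y) (j c * z) +
    T (i a * parity x) (gd_d E (j b) * y) (j c * z) +
    T (i a * parity x) (j b * parity y) (gd_d E (j c) * z).
  rewrite (coact_muld i0 j0 Dm Di) !sw_sw//.
  transitivity (tlift (fun p0 p1 => tlift (fun p00 p01 =>
      tlift (fun w0 w1 => tlift (fun w00 w01 =>
        X p00 p01 p1 w00 w01 w1) (D w0)) (D w)) (rho p0)) (rho p)).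
    apply: eq_tlift => p0 p1; rewrite sw_sw// sw_exchange; apply: eq_tlift => w0 w1.
    rewrite (linD (lin_sw bF)) !swE// (coact_muld i0 j0 Dm Di) (coact_mul0 j0 Dm Di).
    rewrite !sw_sw// -tlift_fD; apply: eq_tlift => p00 p01.
    rewrite !sw_sw// (coact_parity Dm) sw_tmap; last by lin_tac.
    rewrite -tlift_fD; apply: eq_tlift => w00 w01.
    by rewrite (linD (lin_sw (bT _))) !swE.
  transitivity (tlift (fun p0 p1 => tlift (fun p00 p01 =>
      tlift (fun w0 w1 => tlift (fun w10 w11 =>
        X p00 p01 p1 w0 w10 w11) (DE w1)) (D w)) (rho p0)) (rho p)).
    apply: eq_tlift => p0 p1; apply: eq_tlift => p00 p01.
    by rewrite (IH _ (X p00 p01 p1))//; rewrite /X; lin_tac.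
  rewrite (rho_trilin (T := fun a b c => tlift (fun w0 w1 => tlift (fun w10 w11 =>
        X a b c w0 w10 w11) (DE w1)) (D w))); last by rewrite /X; lin_tac.
  apply: eq_tlift => p0 p1; rewrite sw_sw// sw_exchange; apply: eq_tlift => w0 w1.
  rewrite (linD (lin_sw bG)) !swE// (coact_muld j0 j0 DEm DEj) (coact_mul0 j0 DEm DEj).
  rewrite !sw_sw// -tlift_fD; apply: eq_tlift => p10 p11.
  rewrite !sw_sw// -tlift_fD; apply: eq_tlift => w10 w11.
  by rewrite (linD (lin_sw (bT' _))) !swE// addrA.
Qed.

End Coassociativity.

(** * Right counit identity, propagated from degree 0 *)

Section RightCounit.
Variables (R : realType) (A E : gdsa R).
Local Notation C := R[i].
Variables (P H : algType C) (i : {linear P -> A}) (j : {linear H -> E}).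
Variables (rho : {linear P -> (P ⊗ H)%type}) (D : {linear A -> (A ⊗ E)%type}).
Variables (eH : H -> C) (eE : E -> C).
Hypotheses (i0 : forall p, homog 0 (i p)) (j0 : forall h, homog 0 (j h)).
Hypotheses (Dm : gdsa_tmorphism D) (Di : forall p, D (i p) = tmap i j (rho p)).
Hypothesis eEl : lin (eE : E -> C^o).
Hypotheses (eE1 : eE 1 = 1) (eEM : forall h t, eE (j h * t) = eH h * eE t).
Hypothesis eEd : forall h t, eE (gd_d E (j h) * t) = 0.
Hypothesis gen : forall Q : A -> Prop,
  (forall x y, Q x -> Q y -> Q (x + y)) -> Q 1 ->
  (forall p w, Q w -> Q (i p * w)) -> (forall p w, Q w -> Q (gd_d A (i p) * w)) ->
  forall w, Q w.
Hypothesis rho_counit : forall p, tlift (fun a h => eH h *: a) (rho p) = p.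

(** For a factor d p, the summand with d on the second leg dies under [eE], and the other one is d
    applied to the counit identity for p. *)
Lemma coact_counit w : tlift (fun a t => eE t *: a) (D w) = w.
Proof.
have bF : bilin (fun (a : A) t => eE t *: a).
  by split=> ?; [lin_tac | apply: (@lin_scalel _ _ _ eE)].
move: w; apply: gen => [x y hx hy||p w IH|p w IH].
- by rewrite linearD /= (linD (lin_sw bF)) hx hy.
- by rewrite (gm_1 Dm) swE// eE1 scale1r.
- rewrite (coact_mul0 j0 Dm Di) sw_sw// -[in RHS](rho_counit p).
  rewrite (lin_out _ _ (lin_linear i)) (lin_out _ _ (lin_mulr _ (@lin_id _ _))).
  apply: eq_tlift => p0 p1; rewrite sw_sw// -[in RHS]IH (lin_out _ _ (lin_mull _ (@lin_id _ _))).
  apply: eq_tlift => w0 w1; rewrite swE// eEM linearZ /=.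
  by rewrite -scalerAl -scalerAr scalerA.
- rewrite (coact_muld i0 j0 Dm Di) sw_sw// -[in RHS](rho_counit p).
  rewrite (lin_out _ _ (lin_linear i)) (lin_out _ _ (lin_linear (gd_d A))).
  rewrite (lin_out _ _ (lin_mulr _ (@lin_id _ _))).
  apply: eq_tlift => p0 p1; rewrite sw_sw// -[in RHS]IH (lin_out _ _ (lin_mull _ (@lin_id _ _))).
  apply: eq_tlift => w0 w1; rewrite (linD (lin_sw bF)) !swE// eEM eEd scale0r addr0.
  by rewrite !linearZ /= -scalerAl -scalerAr scalerA.
Qed.

End RightCounit.

(** * The Hopf algebra structure of the envelope *)

Section EnvelopeTheory.
Variables (R : realType) (H : hopf_star_algebra R) (Gam : star_fodc H).
Variables (E : universal_envelope Gam).
Local Notation C := R[i].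
Local Notation j := (ue_H E).

Lemma ue_H_homog0 h : homog 0 (j h).
Proof. by apply/ue_homog; exists h. Qed.

(** Γ is spanned by the g dh, so the envelope is spanned by products of elements h and dh. [S]
    collects the left multipliers preserving [Q], a set closed under sums and products. *)
Lemma ue_ind (Q : E -> Prop) :
  (forall x y, Q x -> Q y -> Q (x + y)) -> Q 1 ->
  (forall h w, Q w -> Q (j h * w)) -> (forall h w, Q w -> Q (gd_d E (j h) * w)) ->
  forall w, Q w.
Proof.
move=> QD Q1 QH Qd.
have Q0 : Q 0 by rewrite -(mul0r 1) -(rmorph0 j); apply: QH.
pose S t := forall w, Q w -> Q (t * w).
have S0 : S 0 by move=> w; rewrite mul0r.
have SD x y : S x -> S y -> S (x + y).
  by move=> Sx Sy w Qw; rewrite mulrDl; apply: QD; [apply: Sx | apply: Sy].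
have SM x y : S x -> S y -> S (x * y).
  by move=> Sx Sy w Qw; rewrite -mulrA; apply/Sx/Sy.
have SG x : S (ue_G E x).
  have [s ->] := fo_span x; rewrite raddf_sum; elim/big_ind: _ => // p _.
  by rewrite /= ue_lact -ue_d; apply: SM; [apply: QH | apply: Qd].
have St k (t : tpow Gam k) : S (tprod j (ue_G E) t).
  elim: k t => [|k IH] t /=; first exact: QH.
  by rewrite /bt_lift /fsum; elim/big_ind: _ => // p _; apply: SM.
by apply: homog_ind => // k x /ue_homog[t <-]; rewrite -[tprod _ _ _]mulr1; apply: St.
Qed.

(** The generators of the ideal have degree at least 2 and no constructor lowers the degree. The
    match on [k] singles out degree 0 within the induction over all degrees. *)
Lemma env_ideal_tpow0 (h : H) : @env_ideal R H Gam 0 h -> h = 0.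
Proof.
suff gen k (t : tpow Gam k) : env_ideal t ->
    match k return tpow Gam k -> Prop with 0 => fun t => t = 0 | _ => fun=> True end t.
  exact: gen.
elim=> {k t} // [[]//|k q r _ qP _ rP|k q h' _ qP].
  by case: k q r qP rP => //= q r -> ->; rewrite addr0.
by case: k q qP => //= q ->; rewrite mul0r.
Qed.

Lemma ue_H_inj : injective j.
Proof.
move=> g h /eqP; rewrite -subr_eq0 -rmorphB => /eqP e.
by apply/eqP; rewrite -subr_eq0; apply/eqP/env_ideal_tpow0/(ue_ker E (k := 0)).
Qed.

Lemma homog0_ue_H t : homog 0 t -> exists h, t = j h.
Proof. by move/ue_homog => [h <-]; exists h. Qed.

Variable eh : envelope_hopf E.
Local Notation D := (e_comul eh).
Local Notation eps := (e_counit eh).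
Local Notation S := (e_antipode eh).

Lemma e_comul_trilin (V : lmodType C) (T : E -> E -> E -> V) w : trilin T ->
  tlift (fun a b => tlift (fun a0 a1 => T a0 a1 b) (D a)) (D w) =
  tlift (fun a b => tlift (T a) (D b)) (D w).
Proof.
apply: (coact_trilin (i := j) (j := j) (rho := comul) (DH := comul)).
- exact: ue_H_homog0.
- exact: ue_H_homog0.
- exact: e_comul_morph.
- exact: e_comulH.
- exact: e_comul_morph.
- exact: e_comulH.
- exact: ue_ind.
- exact: comulA.
Qed.

Lemma e_comul_mul0 h w :
  D (j h * w) = tlift (fun h0 h1 => tlift (fun w0 w1 =>
    (j h0 * w0) ⊗ (j h1 * w1)) (D w)) (comul h).
Proof.
exact: (coact_mul0 ue_H_homog0 (e_comul_morph eh) (e_comulH eh)).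
Qed.

Lemma e_comul_muld h w :
  D (gd_d E (j h) * w) = tlift (fun h0 h1 => tlift (fun w0 w1 =>
    (gd_d E (j h0) * w0) ⊗ (j h1 * w1) +
    (j h0 * parity w0) ⊗ (gd_d E (j h1) * w1)) (D w)) (comul h).
Proof.
exact: (coact_muld ue_H_homog0 ue_H_homog0 (e_comul_morph eh) (e_comulH eh)).
Qed.

Lemma lin_e_counit : lin (eps : E -> C^o).
Proof. by move=> a u v; exact: (linearP eps). Qed.

Lemma e_counit1 : eps 1 = 1.
Proof. by rewrite -(rmorph1 j) e_counitH counit1. Qed.

Lemma e_counit_mul0 h t : eps (j h * t) = counit h * eps t.
Proof.
move: t; apply: (@lin_homog_ext _ _ C^o (fun t => eps (j h * t)) (fun t => counit h * eps t)).
- by apply: (lin_comp lin_e_counit); lin_tac.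
- by move=> a u v; rewrite lin_e_counit mulrDr; congr (_ + _); apply: mulrCA.
move=> [|k] t tk; last first.
  by rewrite (e_counit_pos eh tk) mulr0 (@e_counit_pos _ _ _ _ eh k)//;
     apply: (homogM' (ue_H_homog0 h)).
by have [g ->] := homog0_ue_H tk; rewrite -rmorphM !e_counitH counitM.
Qed.

Lemma e_counit_muld h t : eps (gd_d E (j h) * t) = 0.
Proof.
move: t; apply: (@lin_homog_ext _ _ C^o (fun t => eps (gd_d E (j h) * t)) (fun=> 0)).
- by apply: (lin_comp lin_e_counit); lin_tac.
- by move=> a u v; rewrite addr0 scaler0.
move=> k t tk; apply: (@e_counit_pos _ _ _ _ eh k).
exact: (homogM' (homog_d (ue_H_homog0 h)) tk).
Qed.

Lemma e_counitr t : tlift (fun a b => eps b *: a) (D t) = t.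
Proof.
apply: (coact_counit (i := j) (j := j) (rho := comul) (eH := counit)).
- exact: ue_H_homog0.
- exact: ue_H_homog0.
- exact: e_comul_morph.
- exact: e_comulH.
- exact: lin_e_counit.
- exact: e_counit1.
- exact: e_counit_mul0.
- exact: e_counit_muld.
- exact: ue_ind.
- exact: counitr.
Qed.

Lemma bilin_counitl : bilin (fun a (b : E) => eps a *: b).
Proof. by split=> ?; [apply: (@lin_scalel _ _ _ eps); apply: lin_e_counit | lin_tac]. Qed.

Lemma e_counitl t : tlift (fun a b => eps a *: b) (D t) = t.
Proof.
have bF := bilin_counitl.
move: t; apply: ue_ind => [x y hx hy||h w IH|h w IH].
- by rewrite linearD /= (linD (lin_sw bF)) hx hy.
- by rewrite (gm_1 (e_comul_morph eh)) swE// e_counit1 scale1r.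
- rewrite e_comul_mul0 sw_sw// -[in RHS](counitl h).
  rewrite (lin_out _ _ (lin_linear j)) (lin_out _ _ (lin_mulr _ (@lin_id _ _))).
  apply: eq_tlift => p0 p1; rewrite sw_sw// -[in RHS]IH (lin_out _ _ (lin_mull _ (@lin_id _ _))).
  apply: eq_tlift => w0 w1; rewrite swE// e_counit_mul0 linearZ /=.
  by rewrite -scalerAl -scalerAr scalerA.
- rewrite e_comul_muld sw_sw// -[in RHS](counitl h).
  rewrite (lin_out _ _ (lin_linear j)) (lin_out _ _ (lin_linear (gd_d E))).
  rewrite (lin_out _ _ (lin_mulr _ (@lin_id _ _))).
  apply: eq_tlift => p0 p1; rewrite sw_sw// -[in RHS]IH (lin_out _ _ (lin_mull _ (@lin_id _ _))).
  apply: eq_tlift => w0 w1; rewrite (linD (lin_sw bF)) !swE//.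
  rewrite e_counit_mul0 e_counit_muld scale0r add0r.
  (* The counit vanishes in positive degrees, so it does not see the sign. *)
  have -> : eps (parity w0) = eps w0.
    move: w0; apply: (@lin_homog_ext _ _ C^o (fun t => eps (parity t)) eps).
    - by apply: (lin_comp lin_e_counit); lin_tac.
    - exact: lin_e_counit.
    move=> [|k] t tk; first by rewrite (parityE tk) expr0 scale1r.
    by rewrite !(@e_counit_pos _ _ _ _ eh k)//; apply: homog_parity.
  by rewrite !linearZ /= -scalerAl -scalerAr scalerA.
Qed.

Lemma e_antipode_mul0 h t : S (j h * t) = S t * j (antipode h).
Proof.
move: t; apply: lin_homog_ext => [||k t tk]; try by lin_tac.
by rewrite (e_antipodeM eh (ue_H_homog0 h) tk) mul0n expr0 mul1r e_antipodeH.
Qed.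

Lemma e_antipode_muld h t :
  S (gd_d E (j h) * t) = S (parity t) * gd_d E (j (antipode h)).
Proof.
move: t; apply: lin_homog_ext => [||k t tk]; try by lin_tac.
rewrite (e_antipodeM eh (homog_d (ue_H_homog0 h)) tk) mul1n e_antipode_d e_antipodeH.
by rewrite (parityE tk) linearZ /= -scalerAl -[in LHS]signr_odd -[in RHS]signr_odd; case: odd;
  rewrite ?expr0 ?expr1 ?mul1r ?scale1r ?mulN1r ?scaleN1r.
Qed.

Lemma e_antipode_parity t : S (parity t) = parity (S t).
Proof.
move: t; apply: lin_homog_ext => [||k t tk]; try by lin_tac.
by rewrite (parityE tk) (parityE (e_antipode_homog eh tk)) linearZ.
Qed.

Let antl h : tlift (fun a b => j (antipode a) * j b) (comul h) = counit h *: 1.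
Proof.
transitivity (j (counit h *: 1)); last by rewrite linearZ /= rmorph1.
rewrite -antipodel (lin_out _ _ (lin_linear j)).
by apply: eq_tlift => a b; rewrite rmorphM.
Qed.

Let antr h : tlift (fun a b => j a * j (antipode b)) (comul h) = counit h *: 1.
Proof.
transitivity (j (counit h *: 1)); last by rewrite linearZ /= rmorph1.
rewrite -antipoder (lin_out _ _ (lin_linear j)).
by apply: eq_tlift => a b; rewrite rmorphM.
Qed.

(** Left multiplication by h reduces to the antipode axiom in H. For dh the two summands combine
    into S(parity w0) d(S(h1) h2) w1, which is zero because S(h1) h2 sums to a multiple of 1. *)
Lemma e_antipodel t : tlift (fun a b => S a * b) (D t) = eps t *: 1.
Proof.
have bF : bilin (fun a b => S a * b) by lin_tac.
move: t; apply: ue_ind => [x y hx hy||h w IH|h w IH].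
- by rewrite linearD /= (linD (lin_sw bF)) hx hy (linD lin_e_counit) scalerDl.
- rewrite (gm_1 (e_comul_morph eh)) swE// e_counit1 scale1r mulr1 -(rmorph1 j) e_antipodeH.
  have := antipodel (1 : H); rewrite comul1 swE; last by lin_tac.
  by rewrite counit1 scale1r mulr1 => ->.
- rewrite e_comul_mul0 sw_sw// e_counit_mul0 -scalerA -IH.
  transitivity (tlift (fun w0 w1 => S w0 *
     (tlift (fun a b => j (antipode a) * j b) (comul h)) * w1) (D w)).
    under eq_tlift => h0 h1 do rewrite sw_sw//.
    rewrite sw_exchange; apply: eq_tlift => w0 w1.
    rewrite -mulrA (lin_out (F := fun x => S w0 * (x * w1))); last by lin_tac.
    by apply: eq_tlift => h0 h1; rewrite swE// e_antipode_mul0 !mulrA.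
  rewrite antl (lin_out _ _ (lin_scale _ (@lin_id _ _))); apply: eq_tlift => w0 w1.
  by rewrite -scalerAr mulr1 scalerAl.
- rewrite e_comul_muld sw_sw// e_counit_muld scale0r.
  transitivity (tlift (fun w0 w1 => S (parity w0) *
     (gd_d E (tlift (fun a b => j (antipode a) * j b) (comul h))) * w1) (D w)).
    under eq_tlift => h0 h1 do rewrite sw_sw//.
    rewrite sw_exchange; apply: eq_tlift => w0 w1.
    rewrite -mulrA (lin_out (F := fun x => S (parity w0) * (gd_d E x * w1))); last by lin_tac.
    apply: eq_tlift => h0 h1; rewrite (linD (lin_sw bF)) !swE//.
    rewrite e_antipode_muld e_antipode_mul0 (gd_leibniz (i := 0)); last exact: ue_H_homog0.
    by rewrite expr0 mul1r mulrDl mulrDr !mulrA.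
  rewrite antl; have -> : gd_d E (counit h *: 1) = 0 by rewrite linearZ /= gd_d1 scaler0.
  by apply: sw0 => w0 w1; rewrite mulr0 mul0r.
Qed.

(** Here the inner w0 S(w1) is contracted before the outer factors; for dh there remains ε(w) d(h1
    S(h2)) = 0. *)
Lemma e_antipoder t : tlift (fun a b => a * S b) (D t) = eps t *: 1.
Proof.
have bF : bilin (fun a b => a * S b) by lin_tac.
move: t; apply: ue_ind => [x y hx hy||h w IH|h w IH].
- by rewrite linearD /= (linD (lin_sw bF)) hx hy (linD lin_e_counit) scalerDl.
- rewrite (gm_1 (e_comul_morph eh)) swE// e_counit1 scale1r mul1r -(rmorph1 j) e_antipodeH.
  have := antipoder (1 : H); rewrite comul1 swE; last by lin_tac.
  by rewrite counit1 scale1r mul1r => ->.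
- rewrite e_comul_mul0 sw_sw// e_counit_mul0 mulrC -scalerA -antr.
  rewrite (lin_out _ _ (lin_scale _ (@lin_id _ _))); apply: eq_tlift => h0 h1.
  rewrite sw_sw//; transitivity (j h0 * (eps w *: 1) * j (antipode h1)).
    rewrite -IH -mulrA (lin_out (F := fun x => j h0 * (x * j (antipode h1)))); last by lin_tac.
    by apply: eq_tlift => w0 w1; rewrite swE// e_antipode_mul0 !mulrA.
  by rewrite -scalerAr mulr1 scalerAl.
- rewrite e_comul_muld sw_sw// e_counit_muld scale0r.
  transitivity (eps w *: gd_d E (tlift (fun a b => j a * j (antipode b)) (comul h))); last first.
    by rewrite antr linearZ /= gd_d1 !scaler0.
  rewrite (lin_out _ _ (lin_linear (gd_d E))) (lin_out _ _ (lin_scale _ (@lin_id _ _))).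
  apply: eq_tlift => h0 h1; rewrite sw_sw//.
  transitivity (gd_d E (j h0) * (eps w *: 1) * j (antipode h1) +
      j h0 * parity (eps w *: 1) * gd_d E (j (antipode h1))); last first.
    rewrite (gd_leibniz (i := 0)); last exact: ue_H_homog0.
    rewrite (linZ _ _ (@lin_parity _ _)) (parityE (homog1 E)) expr0 mul1r scale1r.
    by rewrite -!scalerAr !mulr1 -!scalerAl scalerDr.
  rewrite -IH -!mulrA.
  rewrite (lin_out (F := fun x => gd_d E (j h0) * (x * j (antipode h1)))); last by lin_tac.
  rewrite (lin_out (F := fun x => j h0 * (parity x * gd_d E (j (antipode h1))))); last by lin_tac.
  rewrite -tlift_fD; apply: eq_tlift => w0 w1.
  rewrite (linD (lin_sw bF)) !swE// e_antipode_mul0 e_antipode_muld parityM.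
  by rewrite e_antipode_parity !mulrA.
Qed.

End EnvelopeTheory.

(** * The graded canonical map *)

Section Calculus.
Variables (R : realType) (G : cmqg R) (zeta : qpbundle G) (calc : diff_calculus zeta).
Local Notation C := R[i].
Local Notation Om := (dc_forms calc).
Local Notation Env := (dc_env calc).
Local Notation coact := (dc_coact calc).
Local Notation i := (dc_P calc).
Local Notation j := (ue_H Env).
Local Notation rho := (qp_coact zeta).
Local Notation DE := (e_comul (dc_hopf calc)).
Local Notation eps := (e_counit (dc_hopf calc)).
Local Notation S := (e_antipode (dc_hopf calc)).

Lemma dc_P_homog0 p : homog 0 (i p).
Proof. by apply/dc_P_homog; exists p. Qed.

Lemma dc_ind (Q : Om -> Prop) :
  (forall x y, Q x -> Q y -> Q (x + y)) -> Q 1 ->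
  (forall p w, Q w -> Q (i p * w)) -> (forall p w, Q w -> Q (gd_d Om (i p) * w)) ->
  forall w, Q w.
Proof.
move=> QD Q1 QP Qd.
have Q0 : Q 0 by rewrite -(mul0r 1) -(rmorph0 i); apply: QP.
apply: homog_ind => // k x /dc_generated[s [sP ->]].
rewrite big_seq; elim/big_ind: _ => // -[p t] ps.
have [/dc_P_homog[a /= <-] tP] := sP _ ps; apply: QP.
elim: (index_enum _) => [|l r IH]; first by rewrite big_nil.
by rewrite big_cons; have /dc_P_homog[b /= <-] := tP l; apply: Qd.
Qed.

Lemma dc_coact_mul0 p w :
  coact (i p * w) = tlift (fun p0 p1 => tlift (fun w0 w1 =>
    (i p0 * w0) ⊗ (j p1 * w1)) (coact w)) (rho p).
Proof.
exact: (coact_mul0 (ue_H_homog0 Env) (dc_coact_morph calc) (@dc_coactP _ _ _ calc)).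
Qed.

Lemma dc_coact_trilin (V : lmodType C) (T : Om -> Env -> Env -> V) w : trilin T ->
  tlift (fun a b => tlift (fun a0 a1 => T a0 a1 b) (coact a)) (coact w) =
  tlift (fun a b => tlift (T a) (DE b)) (coact w).
Proof.
apply: (coact_trilin (i := i) (j := j) (rho := rho) (DH := comul)).
- exact: dc_P_homog0.
- exact: ue_H_homog0.
- exact: dc_coact_morph.
- exact: dc_coactP.
- exact: e_comul_morph.
- exact: e_comulH.
- exact: dc_ind.
- by move=> p; rewrite (proj2 (qp_corep zeta)).
Qed.

Lemma dc_coact_counit w : tlift (fun a t => eps t *: a) (coact w) = w.
Proof.
apply: (coact_counit (i := i) (j := j) (rho := rho) (eH := counit)).
- exact: dc_P_homog0.
- exact: ue_H_homog0.
- exact: dc_coact_morph.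
- exact: dc_coactP.
- exact: lin_e_counit.
- exact: e_counit1.
- exact: e_counit_mul0.
- exact: e_counit_muld.
- exact: dc_ind.
- exact: (proj1 (qp_corep zeta)).
Qed.

(** The canonical map β of the bundle, extended to forms. *)
Definition galois : (Om ⊗ Om)%type -> (Om ⊗ Env)%type :=
  tlift (fun x y => gmul (x ⊗ 1) (coact y)).

Lemma bilin_galois : bilin (fun x y : Om => gmul (x ⊗ 1) (coact y)).
Proof. by lin_tac. Qed.

Lemma lin_galois : lin galois.
Proof. exact: lin_sw bilin_galois. Qed.

Lemma galois_degree0 h : exists s : (zeta ⊗ zeta)%type,
  tlift (fun x y => gmul (i x ⊗ 1) (coact (i y))) s = 1 ⊗ j h.
Proof.
have [s sP] := qp_free (1 ⊗ h : (zeta ⊗ G)%type); exists s.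
have lij : lin (tmap i j) by apply: lin_sw; lin_tac.
have := congr1 (tmap i j) sP; rewrite (lin_out _ _ lij) tmap_tens; try by lin_tac.
rewrite rmorph1 => <-; apply: eq_tlift => x y.
rewrite dc_coactP /amul swE; last by lin_tac.
rewrite (lin_out _ _ lij) [in LHS]/tmap (lin_out _ _ (lin_gmulr _)).
apply: eq_tlift => a b; rewrite gmul_left tmap_tens; try by lin_tac.
by rewrite rmorphM mul1r.
Qed.

(** Serves to differentiate β(s) = 1 ⊗ h, which turns a preimage of 1 ⊗ h into one of 1 ⊗ dh. *)
Lemma gtens_d_left p u :
  gtens_d (gmul (i p ⊗ 1) u) =
  gmul (gd_d Om (i p) ⊗ 1) u + gmul (i p ⊗ (1 : Env)) (gtens_d u).
Proof.
have ld := @lin_gtens_d R Om Env.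
move: u; apply: lin_tens_ext => [||a b]; try by lin_tac.
rewrite gtens_d_tens (linD (lin_gmulr _)) !gmul_left gtens_d_tens addrA -tensorDl.
rewrite parityM (parityE (dc_P_homog0 p)) expr0 scale1r.
by rewrite (gd_leibniz _ (dc_P_homog0 p)) expr0 mul1r.
Qed.

Lemma galois_right t : exists z, galois z = 1 ⊗ t.
Proof.
move: t; apply: ue_ind => [x y [z zx] [z' zy]||h t [z zt]|h t [z zt]].
- by exists (z + z'); rewrite (linD lin_galois) zx zy tensorDr.
- by exists (1 ⊗ 1); rewrite /galois swE ?(gm_1 (dc_coact_morph calc)) ?gmul1l//; lin_tac.
- have [s sP] := galois_degree0 h.
  (* Summed over [s], (x' x ⊗ 1) Δ(y y') becomes (x' ⊗ 1) (1 ⊗ h) Δ(y'), and 1 ⊗ h commutes with x'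
     ⊗ 1. *)
  exists (tlift (fun x y => tlift (fun x' y' => (x' * i x) ⊗ (i y * y')) z) s).
  transitivity (tlift (fun x' y' => gmul (x' ⊗ 1) (gmul (1 ⊗ j h) (coact y'))) z).
    rewrite -sP (lin_out _ _ lin_galois).
    under eq_tlift => x y do rewrite (lin_out _ _ lin_galois).
    rewrite sw_exchange; apply: eq_tlift => x' y'.
    rewrite (lin_out (F := fun u => gmul (x' ⊗ 1) (gmul u (coact y')))); last by lin_tac.
    apply: eq_tlift => x y; rewrite /galois swE; last by lin_tac.
    by rewrite (gm_M (dc_coact_morph calc)) !gmulA gmul_left.
  transitivity (gmul (1 ⊗ j h) (galois z)); last by rewrite zt gmul_right.
  rewrite (lin_out _ _ (lin_gmulr _)); apply: eq_tlift => x' y'.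
  by rewrite !gmulA gmul_left gmul_tensl0 ?mul1r ?mulr1//; apply: ue_H_homog0.
- have [s sP] := galois_degree0 h.
  (* The two summands come from d applied to (x ⊗ 1) Δ(y); [parity x'] is the sign of 1 ⊗ dh passing
     x' ⊗ 1. *)
  exists (tlift (fun x y => tlift (fun x' y' => (parity x' * i x) ⊗ (gd_d Om (i y) * y') +
     (parity x' * gd_d Om (i x)) ⊗ (i y * y')) z) s).
  transitivity (tlift (fun x' y' => gmul (parity x' ⊗ 1)
      (gmul (gtens_d (1 ⊗ j h)) (coact y'))) z).
    rewrite -sP (lin_out _ _ lin_galois).
    under eq_tlift => x y do rewrite (lin_out _ _ lin_galois).
    have ld := @lin_gtens_d R Om Env.
    rewrite sw_exchange; apply: eq_tlift => x' y'.
    rewrite (lin_out (F := fun u => gmul (parity x' ⊗ 1) (gmul (gtens_d u) (coact y'))));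
      last by lin_tac.
    apply: eq_tlift => x y; rewrite (linD lin_galois) /galois !swE; try by lin_tac.
    rewrite gtens_d_left (linD (lin_gmull _)) (linD (lin_gmulr _)) addrC.
    by rewrite !(gm_M (dc_coact_morph calc)) (gm_d (dc_coact_morph calc)) !gmulA !gmul_left.
  have dh : gtens_d (1 ⊗ j h) = 1 ⊗ gd_d Env (j h) :> (Om ⊗ Env)%type.
    rewrite gtens_d_tens gd_d1 (parityE (homog1 Om)) expr0 scale1r.
    by rewrite tens0l add0r.
  transitivity (gmul (1 ⊗ gd_d Env (j h)) (galois z)); last by rewrite zt gmul_right.
  rewrite (lin_out _ _ (lin_gmulr _)); apply: eq_tlift => x' y'.
  rewrite dh !gmulA gmul_left gmul_tens1 ?mul1r ?mulr1//.
  exact: homog_d (ue_H_homog0 Env _).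
Qed.

(** The map a ⊗ t |-> a Z(t) vanishes on each Δ(y), hence on each (x ⊗ 1) Δ(y), and 1 ⊗ t is a sum
    of these. [M] is Ω for injectivity and Ω ⊗ Γ^∧ for covariance. *)
Lemma galois_cancel (M : lmodType C) (act : Om -> M -> M) (Z : Env -> M) :
  bilin act -> (forall m, act 1 m = m) ->
  (forall x y m, act (x * y) m = act x (act y m)) -> lin Z ->
  (forall w, tlift (fun a t => act a (Z t)) (coact w) = 0) -> forall t, Z t = 0.
Proof.
move=> bact act1 actM lZ Z0 t; have [z zt] := galois_right t.
have bL : bilin (fun a t => act a (Z t)) by lin_tac.
rewrite -(act1 (Z t)) -(swE _ _ bL) -zt /galois sw_sw//; apply: sw0 => x y.
rewrite -[coact y](sw_id) (lin_out _ _ (lin_gmulr _)) sw_sw//.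
rewrite -[RHS](lin0 ((proj2 bact) x)) -(Z0 y) (lin_out _ _ (proj2 bact x)).
by apply: eq_tlift => a b; rewrite gmul_left swE// actM.
Qed.

End Calculus.

(** * Covariant maps and colinear maps *)

Section Translation.
Variables (R : realType) (G : cmqg R) (zeta : qpbundle G) (calc : diff_calculus zeta).
Local Notation C := R[i].
Local Notation Om := (dc_forms calc).
Local Notation Env := (dc_env calc).
Local Notation coact := (dc_coact calc).
Local Notation DE := (e_comul (dc_hopf calc)).
Local Notation eps := (e_counit (dc_hopf calc)).
Local Notation S := (e_antipode (dc_hopf calc)).
Implicit Types (f g : Env -> Om) (F : Om -> Om).

Definition gauge_of f : Om -> Om := fun w => tlift (fun a t => a * f t) (coact w).

Lemma lin_gauge_of f : lin f -> lin (gauge_of f).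
Proof. by move=> lf; rewrite /gauge_of; lin_tac. Qed.

Lemma gauge_of_inj f g : lin f -> lin g -> gauge_of f =1 gauge_of g -> f =1 g.
Proof.
move=> lf lg fg t; apply/eqP; rewrite -subr_eq0; apply/eqP; move: t.
apply: (@galois_cancel _ _ _ calc _ *%R (fun t => f t - g t)).
- by lin_tac.
- exact: mul1r.
- by move=> x y m; rewrite mulrA.
- by lin_tac.
move=> w; have bg : bilin (fun a t => a * g t) by lin_tac.
transitivity (gauge_of f w - gauge_of g w); last by rewrite fg subrr.
rewrite /gauge_of [X in _ = _ - X](lin_out (F := id)) // -scaleN1r.
rewrite [X in _ = _ + X](lin_out (F := fun x : Om => -1 *: x)); last by lin_tac.
by rewrite -tlift_fD; apply: eq_tlift => a b; rewrite mulrBr scaleN1r.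
Qed.

Definition colinear F : Prop := forall w, tmap F id (coact w) = coact (F w).

(** With products taken in the graded algebra, the Ad-covariance of [f] says
    (1 ⊗ t1) Δ(f(t2)) = f(t1) ⊗ t2; this form is free of antipodes and signs. *)
Definition covariant f : Prop := forall t,
  tlift (fun a b => gmul (1 ⊗ a) (coact (f b))) (DE t) = tmap f id (DE t).

(** If [Z1] and [Z2] are the two sides of covariance, coassociativity writes the two sides of
    colinearity at w as (w0 ⊗ 1) Z1(w1) and (w0 ⊗ 1) Z2(w1); then [galois_cancel] removes w. *)
Lemma covariantP f : lin f -> covariant f <-> colinear (gauge_of f).
Proof.
move=> lf.
pose Z1 t := tlift (fun a b => gmul (1 ⊗ a) (coact (f b))) (DE t).
pose Z2 t := tmap f id (DE t).
have lZ1 : lin Z1 by rewrite /Z1; lin_tac.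
have lZ2 : lin Z2 by rewrite /Z2; lin_tac.
have bact : bilin (fun (a : Om) (m : (Om ⊗ Env)%type) => gmul (a ⊗ 1) m) by lin_tac.
have e1 w : coact (gauge_of f w) = tlift (fun a t => gmul (a ⊗ 1) (Z1 t)) (coact w).
  rewrite /gauge_of (lin_out _ _ (lin_linear coact)).
  transitivity (tlift (fun a t => tlift (fun a0 a1 =>
      gmul (a0 ⊗ a1) (coact (f t))) (coact a)) (coact w)).
    apply: eq_tlift => a t; rewrite (gm_M (dc_coact_morph calc)) -[in LHS](sw_id (coact a)).
    by rewrite (lin_out _ _ (lin_gmull _)).
  rewrite (dc_coact_trilin _ (T := fun x y z => gmul (x ⊗ y) (coact (f z)))); last by lin_tac.
  apply: eq_tlift => a t; rewrite /Z1 (lin_out _ _ (lin_gmulr _)).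
  by apply: eq_tlift => t1 t2; rewrite gmulA gmul_right mul1r.
have e2 w : tmap (gauge_of f) id (coact w) = tlift (fun a t => gmul (a ⊗ 1) (Z2 t)) (coact w).
  rewrite /tmap; transitivity (tlift (fun a t => tlift (fun a0 a1 =>
      (a0 * f a1) ⊗ t) (coact a)) (coact w)).
    apply: eq_tlift => a t; rewrite /gauge_of.
    by rewrite (lin_out _ _ (lin_tensl _ (@lin_id _ _))).
  rewrite (dc_coact_trilin _ (T := fun x y z => (x * f y) ⊗ z)); last by lin_tac.
  apply: eq_tlift => a t; rewrite /Z2 /tmap (lin_out _ _ (lin_gmulr _)).
  by apply: eq_tlift => t1 t2; rewrite gmul_left.
split=> [cf w|cF t].
  by rewrite e1 e2; apply: eq_tlift => a t; rewrite /Z1 cf.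
apply/eqP; rewrite -subr_eq0; apply/eqP; move: t.
apply: (galois_cancel bact (Z := fun t => Z1 t - Z2 t)).
- exact: gmul1l.
- by move=> x y m; rewrite gmulA gmul_left.
- by lin_tac.
move=> w; transitivity (coact (gauge_of f w) - tmap (gauge_of f) id (coact w)); last first.
  by rewrite cF subrr.
rewrite e1 e2 -scaleN1r.
rewrite [X in _ = _ + X](lin_out (F := fun x : (Om ⊗ Env)%type => -1 *: x)); last by lin_tac.
by rewrite -tlift_fD; apply: eq_tlift => a b; rewrite (linB (lin_gmulr _)) scaleN1r.
Qed.

(** The sign in [Ad] is that of S(t1) passing t2 in the graded product, since S preserves
    degrees. *)
Lemma Ad_gmul t :
  Ad (dc_hopf calc) t = tlift (fun a b => gmul (1 ⊗ S a) (DE b)) (DE t).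
Proof.
pose g t1 t2 t3 : (Env ⊗ Env)%type := gsum (fun k t1k => gsum (fun l t2l =>
      (-1) ^+ (k * l) *: (t2l ⊗ (S t1k * t3))) t2) t1.
have gE t1 t2 t3 : g t1 t2 t3 = gmul (1 ⊗ S t1) (t2 ⊗ t3).
  rewrite /g; move: t1; apply: lin_homog_ext => [||k t1 t1k].
  - apply: lin_gsum => k; apply: lin_gsum_body => [u l|l a]; last by lin_tac.
    by rewrite tens0l scaler0.
  - by lin_tac.
  rewrite (gsumE _ t1k); last first.
    move=> l; have [n tn] := hcomp_fin t2; rewrite (gsum_ord _ tn) => [|k'].
      by rewrite big1// => *; rewrite linear0 mul0r tens0r scaler0.
    by rewrite tens0l scaler0.
  move: t2; apply: lin_homog_ext => [||l t2 t2l].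
  - by apply: lin_gsum => l; lin_tac.
  - by lin_tac.
  rewrite (gsumE _ t2l); last by move=> l'; rewrite tens0l scaler0.
  by rewrite (gmulE _ _ (e_antipode_homog _ t1k) t2l) mul1r.
rewrite /Ad; transitivity (tlift (fun t1 t23 => gmul (1 ⊗ S t1) t23) (tmap id DE (DE t))).
  apply: eq_tlift => t1 t23; rewrite -[in RHS](sw_id t23) (lin_out _ _ (lin_gmulr _)).
  by apply: eq_tlift => t2 t3; apply: gE.
by rewrite sw_tmap//; lin_tac.
Qed.

Lemma gmul_right_tmap f (s : Env) (u : (Env ⊗ Env)%type) : graded_linear f ->
  tmap f id (gmul (1 ⊗ s) u) = gmul (1 ⊗ s) (tmap f id u).
Proof.
move=> [lf hf]; have {}lf : lin f by [].
move: u; apply: lin_homog_tens_ext => [||k l x y xk yl]; try by lin_tac.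
move: s; apply: lin_homog_ext => [||m s sm]; try by lin_tac.
rewrite (gmulE _ _ sm xk) tmap_tens// (gmulE _ _ sm (hf _ _ xk)) linZ; last by lin_tac.
by rewrite mul1r tmap_tens ?mul1r.
Qed.

(** Each form follows from the other by left multiplication with 1 ⊗ t1 or 1 ⊗ S(t1) and one of the
    two antipode identities. *)
Lemma Ad_covariantP f : graded_linear f ->
  (forall t, tmap f id (Ad (dc_hopf calc) t) = coact (f t)) <-> covariant f.
Proof.
move=> gf; have lf : lin f by case: gf.
have lAd : lin (Ad (dc_hopf calc)).
  by rewrite (funext Ad_gmul); lin_tac.
split=> [Af t|cf t].
  transitivity (tmap f id (tlift (fun a b => gmul (1 ⊗ a) (Ad (dc_hopf calc) b)) (DE t))).
    rewrite (lin_out (F := tmap f id)); last by lin_tac.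
    by apply: eq_tlift => a b; rewrite gmul_right_tmap// Af.
  congr (tmap f id _).
  transitivity (tlift (fun a b => tlift (fun b1 b2 =>
      gmul (1 ⊗ (a * S b1)) (DE b2)) (DE b)) (DE t)).
    apply: eq_tlift => a b; rewrite Ad_gmul (lin_out _ _ (lin_gmulr _)).
    by apply: eq_tlift => b1 b2; rewrite gmulA gmul_right.
  rewrite -(e_comul_trilin _ (T := fun x y z => gmul (1 ⊗ (x * S y)) (DE z))); last by lin_tac.
  rewrite -[in RHS](e_counitl (dc_hopf calc) t) (lin_out _ _ (lin_linear DE)).
  apply: eq_tlift => a b; rewrite linearZ /=.
  transitivity (gmul (1 ⊗ (eps a *: 1)) (DE b)); last first.
    by rewrite tensorZr (linZ _ _ (lin_gmull _)) gmul1l.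
  rewrite -(e_antipoder (dc_hopf calc) a) (lin_out (F := fun u => gmul (1 ⊗ u) (DE b)))//.
  by lin_tac.
rewrite Ad_gmul (lin_out (F := tmap f id)); last by lin_tac.
transitivity (tlift (fun a b => tlift (fun b1 b2 =>
    gmul (1 ⊗ (S a * b1)) (coact (f b2))) (DE b)) (DE t)).
  apply: eq_tlift => a b; rewrite gmul_right_tmap// -cf (lin_out _ _ (lin_gmulr _)).
  by apply: eq_tlift => b1 b2; rewrite gmulA gmul_right.
rewrite -(e_comul_trilin _ (T := fun x y z => gmul (1 ⊗ (S x * y)) (coact (f z)))); last by lin_tac.
rewrite -[in RHS](e_counitl (dc_hopf calc) t) (lin_out (F := fun u => coact (f u))); last by lin_tac.
apply: eq_tlift => a b; rewrite (linZ _ _ lf) linearZ /=.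
transitivity (gmul (1 ⊗ (eps a *: 1)) (coact (f b))); last first.
  by rewrite tensorZr (linZ _ _ (lin_gmull _)) gmul1l.
rewrite -(e_antipodel (dc_hopf calc) a) (lin_out (F := fun u => gmul (1 ⊗ u) (coact (f b))))//.
by lin_tac.
Qed.

(** The convolution inverse is only required to be graded linear, so its covariance has to be
    derived. Covariance of [f] and f * g = 1ε give (f(u1) ⊗ 1) Z(u2) = 1 ⊗ u; convolving with [g] on
    the left isolates Z(t) = g(t1) ⊗ t2. *)
Lemma covariant_inverse f g : lin f -> lin g -> covariant f ->
  convolution calc f g =1 conv_unit calc -> convolution calc g f =1 conv_unit calc ->
  covariant g.
Proof.
move=> lf lg cf fg gf t.
pose Z t := tlift (fun a b => gmul (1 ⊗ a) (coact (g b))) (DE t).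
have lZ : lin Z by rewrite /Z; lin_tac.
have fZ u : tlift (fun a b => gmul (f a ⊗ 1) (Z b)) (DE u) = 1 ⊗ u.
  transitivity (tlift (fun a b => tlift (fun b1 b2 =>
      gmul (f a ⊗ b1) (coact (g b2))) (DE b)) (DE u)).
    apply: eq_tlift => a b; rewrite /Z (lin_out _ _ (lin_gmulr _)).
    by apply: eq_tlift => b1 b2; rewrite gmulA gmul_right mul1r.
  rewrite -(e_comul_trilin _ (T := fun x y z => gmul (f x ⊗ y) (coact (g z)))); last by lin_tac.
  transitivity (tlift (fun a b => tlift (fun a1 a2 =>
      gmul (gmul (1 ⊗ a1) (coact (f a2))) (coact (g b))) (DE a)) (DE u)).
    apply: eq_tlift => a b.
    rewrite -[RHS](lin_out (F := fun v => gmul v (coact (g b)))); last by lin_tac.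
    by rewrite cf /tmap (lin_out _ _ (lin_gmull _)).
  rewrite (e_comul_trilin _ (T := fun x y z =>
    gmul (gmul (1 ⊗ x) (coact (f y))) (coact (g z)))); last by lin_tac.
  rewrite -[in RHS](e_counitr (dc_hopf calc) u) (lin_out _ _ (lin_tensr _ (@lin_id _ _))).
  apply: eq_tlift => a b; transitivity (gmul (1 ⊗ a) (coact (convolution calc f g b))).
    rewrite /convolution (lin_out (F := fun v => gmul (1 ⊗ a) (coact v))); last by lin_tac.
    by apply: eq_tlift => b1 b2; rewrite (gm_M (dc_coact_morph calc)) gmulA.
  rewrite fg /conv_unit linearZ /= (gm_1 (dc_coact_morph calc)).
  by rewrite (linZ _ _ (lin_gmulr _)) gmul1r tensorZr.
rewrite -/(Z t); symmetry.
transitivity (tlift (fun a b => tlift (fun b1 b2 =>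
    gmul ((g a * f b1) ⊗ 1) (Z b2)) (DE b)) (DE t)).
  rewrite /tmap; apply: eq_tlift => a b.
  transitivity (gmul (g a ⊗ 1) (1 ⊗ b)); first by rewrite gmul_right mul1r.
  rewrite -fZ (lin_out _ _ (lin_gmulr _)).
  by apply: eq_tlift => b1 b2; rewrite gmulA gmul_left.
rewrite -(e_comul_trilin _ (T := fun x y z => gmul ((g x * f y) ⊗ 1) (Z z))); last by lin_tac.
rewrite -[in RHS](e_counitl (dc_hopf calc) t) (lin_out _ _ lZ).
apply: eq_tlift => a b; transitivity (gmul (convolution calc g f a ⊗ 1) (Z b)).
  by rewrite /convolution (lin_out (F := fun v => gmul (v ⊗ 1) (Z b)))//; lin_tac.
by rewrite gf /conv_unit tensorZl (linZ _ _ (lin_gmull _)) gmul1l (linZ _ _ lZ).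
Qed.

Lemma gauge_of_convolution f g : lin f -> lin g -> colinear (gauge_of f) ->
  gauge_of (convolution calc f g) =1 gauge_comp calc (gauge_of f) (gauge_of g).
Proof.
move=> lf lg cf w; rewrite /gauge_comp {2}/gauge_of -cf sw_tmap; last by lin_tac.
transitivity (tlift (fun a t => tlift (fun a0 a1 => a0 * f a1 * g t) (coact a)) (coact w)).
  rewrite (dc_coact_trilin _ (T := fun x y z => x * f y * g z)); last by lin_tac.
  apply: eq_tlift => a t; rewrite /convolution (lin_out _ _ (lin_mull _ (@lin_id _ _))).
  by apply: eq_tlift => t1 t2; rewrite mulrA.
by apply: eq_tlift => a t; rewrite /gauge_of (lin_out _ _ (lin_mulr _ (@lin_id _ _))).
Qed.

Lemma gauge_of_conv_unit : gauge_of (conv_unit calc) =1 id.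
Proof.
move=> w; rewrite -[RHS]dc_coact_counit /gauge_of.
by apply: eq_tlift => a t; rewrite /conv_unit -scalerAr mulr1.
Qed.

End Translation.

(** * The Haar functional *)

Section OrthogonalVector.
Variables (C : numClosedFieldType) (n : nat).

Definition row_dot (p q : 'rV[C]_n) : C := \sum_k p 0 k * (q 0 k)^*.

Lemma row_dot_eq0 p : row_dot p p = 0 -> p = 0.
Proof.
move=> /eqP; rewrite /row_dot psumr_eq0 => [/allP h|k _]; last exact: mul_conjC_ge0.
apply/rowP => k; rewrite mxE; apply/eqP.
by have := h k (mem_index_enum k); rewrite mul_conjC_eq0.
Qed.

(** A matrix of maximal rank among those whose row space lies in [Q]. *)
Lemma subspace_row_span (Q : set 'rV[C]_n) : subspace Q ->
  exists A : 'M[C]_n, forall v, Q v <-> (v <= A)%MS.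
Proof.
move=> [Q0 QD].
pose P r := `[< exists A : 'M[C]_n, (forall v : 'rV_n, (v <= A)%MS -> Q v) /\ \rank A = r >].
have P0 : exists r, P r.
  exists 0; apply/asboolP; exists 0; split=> [v|]; last by rewrite mxrank0.
  by rewrite submx0 => /eqP->.
have Pn r : P r -> (r <= n)%N by move=> /asboolP[A [_ <-]]; apply: rank_leq_row.
case: (ex_maxnP P0 Pn) => r /asboolP[A [AQ rA]] rmax.
exists A => v; split=> [Qv|/AQ//]; apply: contrapT => /negP vA.
have /rmax : P (\rank (A + v)%MS).
  apply/asboolP; exists (A + v)%MS; split=> // w /sub_addsmxP[[x y] /= ->].
  by rewrite (mx11_scalar y) mul_scalar_mx addrC; apply: QD => //; apply: AQ; apply: submxMl.
rewrite -rA leqNgt => /negP; apply; apply: rank_ltmx.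
by apply/andP; split; [apply: addsmxSl | apply: contra vA; apply: submx_trans; apply: addsmxSr].
Qed.

Lemma orthogonal_vector (Q : set 'rV[C]_n) v : subspace Q -> ~ Q v ->
  exists2 p, p <> 0 & forall q, Q q -> row_dot p q = 0.
Proof.
move=> /subspace_row_span[A QA] /QA/negP vA.
pose B := (map_mx Num.conj A)^T; exists (nz_row (kermx B)).
  apply/eqP; rewrite nz_row_eq0 -mxrank_eq0 mxrank_ker mxrank_tr mxrank_map subn_eq0 -ltnNge.
  rewrite ltn_neqAle rank_leq_row andbT; apply: contra vA => fA.
  exact: submx_full.
move=> q /QA/submxP[x ->].
have /sub_kermxP pB : (nz_row (kermx B) <= kermx B)%MS by apply: nz_row_sub.
have := congr1 (fun M => (M *m (map_mx Num.conj x)^T) 0 0) pB.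
rewrite mul0mx -mulmxA -trmx_mul -map_mxM [RHS]mxE !mxE => h.
by rewrite /row_dot -[RHS]h; apply: eq_bigr => k _; rewrite !mxE.
Qed.

End OrthogonalVector.

(** * Existence of an invariant functional on the dense Hopf algebra *)

Section Haar.
Variables (R : realType) (G : cmqg R).
Local Notation C := R[i].
Implicit Types (psi : G -> C^o) (x y : G).

(** S(u) is a left inverse of u and its adjoint a right inverse, so the two agree. *)
Lemma antipode_unitary n (u : 'M[G]_n) : matrix_corep u -> unitary_matrix u ->
  forall k l, antipode (u k l) = star (u l k).
Proof.
move=> [uc ue] uu k l.
have SU a b : \sum_c antipode (u a c) * u c b = (a == b)%:R.
  have := antipodel (u a b); rewrite uc ue lin_sum; last by apply: lin_sw; lin_tac.
  by rewrite scaler_nat => <-; apply: eq_bigr => c _; rewrite swE//; lin_tac.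
transitivity (\sum_c antipode (u k c) * (\sum_d u c d * star (u l d))).
  under eq_bigr => c _ do rewrite (uu c l).2.
  rewrite (bigD1 l)//= eqxx mulr1 big1 ?addr0// => c /negPf->.
  by rewrite mulr0.
under eq_bigr => c _ do rewrite mulr_sumr.
rewrite exchange_big /= (bigD1 k)//= [X in _ + X]big1 => [|d dk].
  under eq_bigr => c _ do rewrite mulrA.
  by rewrite -mulr_suml SU eqxx mul1r addr0.
under eq_bigr => c _ do rewrite mulrA.
by rewrite -mulr_suml SU eq_sym (negPf dk) mul0r.
Qed.

Definition translate psi y : G := tlift (fun a b => psi a *: b) (comul y).

Lemma bilin_translate psi : lin psi -> bilin (fun a (b : G) => psi a *: b).
Proof. by move=> lp; split=> ?; [apply: (@lin_scalel _ _ _ psi) | lin_tac]. Qed.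

Lemma lin_translate psi : lin psi -> lin (translate psi).
Proof. by move=> /bilin_translate bp; apply: (lin_tlift bp); apply: lin_linear. Qed.

Lemma translate1 psi : lin psi -> translate psi 1 = psi 1 *: 1.
Proof. by move=> /bilin_translate bp; rewrite /translate comul1 swE. Qed.

(** A left coideal: Δ(N) lies in H ⊗ N, tested by functionals on the first leg. *)
Definition stable (N : set G) : Prop :=
  forall psi, lin psi -> forall y, N y -> N (translate psi y).

(** If the column [j] of [u] did not lie in [N + C 1], the orthogonal complement of
    the vectors sent into [N + C 1] would provide a stable enlargement of [N] which
    still misses 1. *)
Lemma unitary_coefficient_stable (N : set G) : subspace N -> stable N -> ~ N 1 ->
  (forall N' : set G, subspace N' -> stable N' -> ~ N' 1 -> (N `<=` N')%classic ->
    (N' `<=` N)%classic) ->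
  forall x, unitary_coefficient x -> exists c, N (x - c *: 1).
Proof.
move=> sN tN N1 Nmax _ [n [u [i [j [uc uu ->]]]]].
pose M x := exists c, N (x - c *: 1).
have sM : subspace M.
  split=> [|a x y [c cx] [d dy]]; first by exists 0; rewrite scale0r subr0; case: sN.
  exists (a * c + d); have -> : a *: x + y - (a * c + d) *: 1 =
      a *: (x - c *: 1) + (y - d *: 1).
    by rewrite scalerBr scalerA scalerDl opprD addrACA.
  by apply: (proj2 sN).
have tM : stable M.
  move=> psi lp x [c cx]; exists (c * psi 1).
  rewrite -scalerA -translate1// -(linZ _ _ (lin_translate lp)).
  by rewrite -(linB (lin_translate lp)); apply: tN.
pose img (v : 'rV[C]_n) := \sum_k v 0 k *: u k j.
have limg : lin img.
  move=> a v w; rewrite /img scaler_sumr -big_split; apply: eq_bigr => k _.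
  by rewrite !mxE scalerDl scalerA.
pose act psi (v : 'rV[C]_n) : 'rV[C]_n := \row_l \sum_k v 0 k * psi (u k l).
have imgE psi v : lin psi -> translate psi (img v) = img (act psi v).
  move=> lp; rewrite /img (lin_sum _ _ _ (lin_translate lp)).
  transitivity (\sum_k \sum_l (v 0 k * psi (u k l)) *: u l j).
    apply: eq_bigr => k _; rewrite (linZ _ _ (lin_translate lp)) /translate (proj1 uc).
    rewrite (lin_sum _ _ _ (lin_sw (bilin_translate lp))) scaler_sumr.
    apply: eq_bigr => l _; rewrite swE ?scalerA//; exact: bilin_translate.
  rewrite exchange_big; apply: eq_bigr => l _ /=.
  by rewrite mxE scaler_suml.
pose Q v := M (img v).
have sQ : subspace Q.
  split=> [|a v w Qv Qw]; first by rewrite /Q (lin0 limg); case: sM.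
  by rewrite /Q limg; apply: (proj2 sM).
suff QT v : Q v.
  have := QT (delta_mx 0 i); rewrite /Q /img (bigD1 i)//= big1 ?addr0 => [|k ki].
    by rewrite mxE !eqxx scale1r.
  by rewrite mxE (negPf ki) andbF scale0r.
apply: contrapT => nQ; have [p p0 pQ] := orthogonal_vector sQ nQ.
pose Qp v := forall q, Q q -> row_dot v q = 0.
have Qp0 r : Qp r -> Q r -> r = 0 by move=> Qpv Qv; apply/row_dot_eq0/Qpv.
have dotD a r s q : row_dot (a *: r + s) q = a * row_dot r q + row_dot s q.
  rewrite /row_dot mulr_sumr -big_split; apply: eq_bigr => k _ /=.
  by rewrite !mxE mulrDl mulrA.
have Qpact psi r : lin psi -> Qp r -> Qp (act psi r).
  (* By [antipode_unitary], adj(u_kl) is the conjugate of psi(u_lk), so [act adj] is the adjoint of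
     [act psi]. Hence the orthogonal complement of the invariant subspace [Q] is invariant too. *)
  move=> lp Qpv q Qq; pose adj y : C^o := (psi (star (antipode y)))^*.
  have la : lin adj.
    move=> a y z; rewrite /adj linearP starD starZ (linD lp) (linZ _ _ lp).
    rewrite rmorphD; congr (_ + _); rewrite -[a in RHS]conjCK; exact: rmorphM.
  rewrite -(Qpv (act adj q)); last by rewrite /Q -imgE//; apply: tM.
  rewrite /row_dot; under eq_bigr => l _ do rewrite mxE mulr_suml.
  rewrite exchange_big; apply: eq_bigr => k _ /=.
  rewrite mxE rmorph_sum mulr_sumr; apply: eq_bigr => l _ /=.
  by rewrite /adj (antipode_unitary uc uu) starK rmorphM /= conjCK mulrAC mulrA.
pose N' z := exists x v, [/\ N x, Qp v & z = x + img v].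
have NN' : (N `<=` N')%classic.
  move=> x Nx; exists x, 0; split=> //; last by rewrite (lin0 limg) addr0.
  by move=> q _; rewrite /row_dot big1// => k _; rewrite mxE mul0r.
have N'N : (N' `<=` N)%classic.
  apply: Nmax => //.
  - split=> [|a _ _ [x [r [Nx Qpr ->]]] [y [s [Ny Qps ->]]]].
      by apply: NN'; case: sN.
    exists (a *: x + y), (a *: r + s); split; first exact: (proj2 sN).
      by move=> q Qq; rewrite dotD Qpr// Qps// mulr0 addr0.
    by rewrite limg scalerDr addrACA.
  - move=> psi lp _ [x [r [Nx Qpr ->]]]; exists (translate psi x), (act psi r).
    by rewrite (linD (lin_translate lp)) imgE//; split=> //; [apply: tN | apply: Qpact].
  (* If 1 = x + img r with x in [N], then img r lies in N + C 1, so r belongs to [Q] and to its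
     orthogonal complement. *)
  - move=> [x [r [Nx Qpr e]]]; apply: N1.
    suff r0 : r = 0 by rewrite e r0 (lin0 limg) addr0.
    apply: Qp0 => //; exists 1; rewrite scale1r e opprD addrCA subrr addr0.
    exact: subspaceN.
apply/p0/Qp0 => //; exists 0; rewrite scale0r subr0; apply: N'N.
by exists 0, p; split=> //; [case: sN | rewrite add0r].
Qed.

(** The projection onto C 1 along a maximal stable subspace avoiding 1. *)
Lemma haar_exists : exists h : G -> C^o, [/\ lin h, h 1 = 1 &
  forall y, tlift (fun a b => h b *: a) (comul y) = h y *: 1].
Proof.
(* As for complements, 0 is omitted because of the empty chain and recovered by maximality. *)
pose P (N : set G) := [/\ forall c x y, N x -> N y -> N (c *: x + y), stable N & ~ N 1].
have [|N [[ND Nt N1] Nmax]] := @Zorn_bigcup G P.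
  move=> F FP Ftot; split.
  - move=> c x y [A FA Ax] [B FB By].
    have [AB|BA] := Ftot A B FA FB.
      by exists B => //; have [BD _ _] := FP _ FB; apply: BD => //; apply: AB.
    by exists A => //; have [AD _ _] := FP _ FA; apply: AD => //; apply: BA.
  - by move=> psi lp y [A FA Ay]; exists A => //; have [_ At _] := FP _ FA; apply: At.
  - by move=> [A FA A1]; have [_ _] := FP _ FA.
have N0 : N 0.
  apply: contrapT => nN0.
  have Ne x : ~ N x.
    by move=> Nx; apply: nN0; rewrite -(addNr x) -scaleN1r; apply: ND.
  case: (Nmax [set 0]%classic); first by split=> [x /Ne//|/(_ 0 erefl)/Ne].
  split=> [c x y -> ->|psi lp y ->|/eqP].
  - by rewrite scaler0 addr0.
  - by rewrite (lin0 (lin_translate lp)).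
  - by rewrite oner_eq0.
have sN : subspace N by split.
have M x : exists c : C^o, N (x - c *: 1).
  have [m [c [z [zu ->]]]] := qg_span x.
  suff h k : exists d, N (z k - d *: 1).
    have [d dN] := choice h; exists (\sum_k c k * d k).
    rewrite scaler_suml -sumrB; elim/big_ind: _ => //.
      by move=> a b; apply: subspaceD.
    by move=> k _; rewrite -scalerA -scalerBr; apply: subspaceZ.
  apply: unitary_coefficient_stable => // N' sN' tN' N'1 NN'.
  apply: contrapT => nN; apply: (Nmax N') => //.
  by split=> //; exact: (proj2 sN').
have [h hP] := choice M.
have hU x c : N (x - c *: 1) -> h x = c.
  move=> Nc; apply/eqP; rewrite -subr_eq0; apply/negPn/negP => d0; apply: N1.
  rewrite -[1](scalerK d0); apply: subspaceZ => //.
  have -> : (h x - c) *: 1 = (x - c *: 1) - (x - h x *: 1).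
    by rewrite scalerBl opprB [RHS]addrC addrA subrK.
  exact: subspaceB.
have lh : lin h.
  move=> a x y; apply: hU; have -> : a *: x + y - (a *: h x + h y) *: 1 =
      a *: (x - h x *: 1) + (y - h y *: 1).
    by rewrite scalerBr scalerA scalerDl opprD addrACA.
  exact: ND.
have h1 : h 1 = 1 by apply: hU; rewrite scale1r subrr.
exists h; split=> // y; apply/eqP; rewrite -subr_eq0; apply/eqP.
(* After applying psi, invariance reads h(translate psi y) = h(y) psi(1), which is the stability of
   [N] at y - h(y) 1. *)
apply: functional_separation => psi lp; rewrite (linB lp) (lin_out _ _ lp).
have -> : tlift (fun a b => psi (h b *: a)) (comul y) = h (translate psi y) :> C^o.
  rewrite /translate (lin_out _ _ lh); apply: eq_tlift => a b.
  by rewrite (linZ _ _ lp) (linZ _ _ lh) [LHS]mulrC.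
rewrite (linZ _ _ lp) (hU _ (h y * psi 1)) ?subrr//.
rewrite -scalerA -translate1// -(linZ _ _ (lin_translate lp)).
by rewrite -(linB (lin_translate lp)); apply: Nt.
Qed.

End Haar.

(** * Averaging *)

Section DegreeComponents.
Variables (R : realType).
Local Notation C := R[i].

Lemma hcomp_total (E : gdsa R) n (x : E) :
  (forall k, (n <= k)%N -> hcomp E k x = 0) -> x = \sum_(k < n) hcomp E k x.
Proof.
move=> xn; rewrite -[RHS](@gsum_ord _ _ _ (fun _ a => a) x n)//.
move: x {xn}; apply: lin_homog_ext => [||k x xk]; first exact: lin_id.
  by apply: lin_gsum => k; apply: lin_id.
by rewrite (gsumE _ xk).
Qed.

(** In total degree k, a second leg of degree k leaves degree 0 for the first. *)
Lemma sw_gtens_comp (A E : gdsa R) (V : lmodType C) (g : A -> E -> V) k t : bilin g ->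
  (forall a b, g a (hcomp E k b) = g a b) ->
  tlift g (gtens_comp k t) = tlift (fun a b => g (hcomp A 0 a) b) t.
Proof.
move=> bg gk; have lk := @lin_gtens_comp R A E k.
move: t; apply: lin_homog_tens_ext => [||m n x y xm yn]; try by lin_tac.
rewrite (gtens_compE _ xm yn) [in RHS]swE; last by lin_tac.
rewrite (hcomp_homog _ xm) -[in RHS]gk (hcomp_homog _ yn).
have g0 a : g a 0 = 0 by rewrite (lin0 ((proj2 bg) a)).
have g0' b : g 0 b = 0 by rewrite (lin0 ((proj1 bg) b)).
have sw0' : tlift g 0 = 0 by apply: (lin0 (lin_sw bg)).
case: (eqVneq k n) => [kn|kn].
  rewrite kn -[X in _ == X]add0n eqn_add2r [m == _]eq_sym.
  by case: eqP => _; rewrite ?swE// sw0' g0'.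
by rewrite g0; case: eqP => _ //; rewrite swE// -gk (hcomp_homog _ yn) (negPf kn) g0.
Qed.

Lemma tmap_hcomp_fin (V : lmodType C) (E : gdsa R) (t : (V ⊗ E)%type) :
  exists n, forall l, (n <= l)%N -> tmap id (hcomp E l) t = 0.
Proof.
have lk l : lin (tmap (id : V -> V) (hcomp E l)) by lin_tac.
elim/tens_ind: t => [|x y [n hn] [m hm]|v x].
- by exists 0 => l _; rewrite lin0.
- exists (maxn n m) => l; rewrite geq_max => /andP[nl ml].
  by rewrite (linD (lk l)) hn// hm// addr0.
- have [n xn] := hcomp_fin x; exists n => l /xn xl.
  by rewrite tmap_tens ?xl ?tens0r//; lin_tac.
Qed.

Lemma tmap_hcomp_sum (V : lmodType C) (E : gdsa R) (t : (V ⊗ E)%type) k :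
  (forall l, (k <= l)%N -> tmap id (hcomp E l) t = 0) ->
  t = \sum_(l < k) tmap id (hcomp E l) t.
Proof.
move=> tk; have lk l : lin (tmap (id : V -> V) (hcomp E l)) by lin_tac.
suff [n nk e] : exists2 n, (k <= n)%N & t = \sum_(l < n) tmap id (hcomp E l) t.
  rewrite {1}e -(big_mkord xpredT (fun l => tmap id (hcomp E l) t)).
  rewrite (big_cat_nat (n := k))//= big_mkord -[RHS]addr0.
  congr (_ + _); rewrite big_nat_cond big1// => l /andP[/andP[kl _] _].
  exact: tk.
suff [n e] : exists n, forall m, (n <= m)%N -> t = \sum_(l < m) tmap id (hcomp E l) t.
  by exists (maxn n k); [apply: leq_maxr | apply/e/leq_maxl].
elim/tens_ind: t {tk} => [|x y [n hn] [m hm]|v x].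
- by exists 0 => m _; rewrite big1// => l _; rewrite lin0.
- exists (maxn n m) => p; rewrite geq_max => /andP[np mp].
  rewrite {1}(hn p np) {1}(hm p mp) -big_split; apply: eq_bigr => l _.
  by rewrite (linD (lk l)).
- have [n xn] := hcomp_fin x; exists n => m nm.
  rewrite {1}(hcomp_total (n := m) (x := x)) => [|l ml]; last exact: xn (leq_trans nm ml).
  rewrite (lin_sum _ _ _ (lin_tensr v (@lin_id _ _))); apply: eq_bigr => l _.
  by rewrite tmap_tens//; lin_tac.
Qed.

End DegreeComponents.

(** * The Haar functional on the degree 0 part of the envelope *)

Section EnvelopeHaar.
Variables (R : realType) (G : cmqg R) (Gam : star_fodc G) (Env : universal_envelope Gam).
Variable eh : envelope_hopf Env.
Local Notation C := R[i].

(** The Haar functional, extended by zero to positive degrees; injectivity of [ue_H] makes the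
    identification of degree 0 with H linear. Invariance is claimed in degree 0 only. *)
Lemma env_haar_exists : exists lam : Env -> C^o,
  [/\ lin lam, lam 1 = 1, forall t, lam (hcomp Env 0 t) = lam t &
  forall t, tlift (fun a b => lam b *: a) (e_comul eh (hcomp Env 0 t)) = lam t *: 1].
Proof.
have [h [lh h1 hinv]] := haar_exists G.
have ex t : exists g, hcomp Env 0 t = ue_H Env g by apply/homog0_ue_H/homogK.
have [p pE] := choice ex.
have lp : lin p.
  by move=> a u v; apply: (ue_H_inj (E := Env)); rewrite linearP /= -!pE linearP.
have pH g : p (ue_H Env g) = g.
  by apply: (ue_H_inj (E := Env)); rewrite -pE; apply: ue_H_homog0.
exists (fun t => h (p t)); split.
- exact: (lin_comp lh lp).
- by rewrite -(rmorph1 (ue_H Env)) pH.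
- by move=> t; rewrite pE pH.
move=> t; rewrite pE e_comulH sw_tmap; last first.
  split=> [b|a]; first by lin_tac.
  by apply: (@lin_scalel _ _ _ (fun b => h (p b))); apply: (lin_comp lh lp).
rewrite -(rmorph1 (ue_H Env)) -linearZ -hinv (lin_out _ _ (lin_linear (ue_H Env))).
by apply: eq_tlift => a b; rewrite pH linearZ.
Qed.

Lemma e_antipode_hcomp k t : hcomp Env k (e_antipode eh t) = e_antipode eh (hcomp Env k t).
Proof.
move: t; apply: (@lin_homog_ext _ Env) => [||l t tl]; try by lin_tac.
rewrite (hcomp_homog _ (e_antipode_homog eh tl)) (hcomp_homog _ tl).
by case: eqP => // _; rewrite linear0.
Qed.

End EnvelopeHaar.

(** * Averages of horizontal forms and truncated lifts *)

Section Averaging.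
Variables (R : realType) (G : cmqg R) (zeta : qpbundle G) (calc : diff_calculus zeta).
Local Notation C := R[i].
Local Notation Om := (dc_forms calc).
Local Notation Env := (dc_env calc).
Local Notation coact := (dc_coact calc).
Local Notation DE := (e_comul (dc_hopf calc)).
Local Notation eps := (e_counit (dc_hopf calc)).
Local Notation S := (e_antipode (dc_hopf calc)).
Local Notation pi0 := (hcomp Om 0).
Local Notation pi := (hcomp Env).
Implicit Types (f g : Env -> Om) (F : Om -> Om).

Variable lam : Env -> C^o.
Hypotheses (llam : lin lam) (lam1 : lam 1 = 1) (lam0 : forall t, lam (pi 0 t) = lam t).
Hypothesis lam_inv : forall t, tlift (fun a b => lam b *: a) (DE (pi 0 t)) = lam t *: 1.
Variable sec : Env -> (Om ⊗ Om)%type.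
Hypotheses (lsec : lin sec) (secK : forall t, galois (sec t) = 1 ⊗ t).

Definition average (a : Om) : Om := tlift (fun a0 a1 => lam a1 *: a0) (coact a).

Definition horizontal (a : Om) : Prop := tmap id (pi 0) (coact a) = coact a.

Lemma lin_average : lin average.
Proof. by rewrite /average; lin_tac. Qed.

(** a0 λ(a1) is coinvariant because a1 has degree 0, where λ is an integral. *)
Lemma average_base a : horizontal a -> base_form calc (average a).
Proof.
move=> ha; rewrite /base_form /average (lin_out _ _ (lin_linear coact)).
transitivity (tlift (fun a0 a1 => tlift (fun a00 a01 =>
    lam a1 *: (a00 ⊗ a01)) (coact a0)) (coact a)).
  apply: eq_tlift => a0 a1; rewrite linearZ /= -[in LHS](sw_id (coact a0)).
  by rewrite (lin_out _ _ (lin_scale _ (@lin_id _ _))).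
rewrite (dc_coact_trilin _ (T := fun x y z => lam z *: (x ⊗ y))); last by lin_tac.
rewrite -ha !sw_tmap; try by lin_tac.
rewrite [in RHS](lin_out _ _ (lin_tensl _ (@lin_id _ _))); apply: eq_tlift => a0 a1.
rewrite tensorZl -tensorZr lam0 -lam_inv (lin_out _ _ (lin_tensr _ (@lin_id _ _))).
by apply: eq_tlift => t1 t2; rewrite tensorZr.
Qed.

Lemma coact_mulr0 a p : homog 0 p ->
  coact (a * p) = tlift (fun a0 a1 => tlift (fun p0 p1 =>
    (a0 * p0) ⊗ (a1 * p1)) (coact p)) (coact a).
Proof.
move=> /dc_P_homog[x <-]; rewrite (gm_M (dc_coact_morph calc)) -[in LHS](sw_id (coact a)).
rewrite (lin_out _ _ (lin_gmull _)); apply: eq_tlift => a0 a1.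
rewrite dc_coactP sw_tmap; last by lin_tac.
rewrite [in LHS]/tmap (lin_out _ _ (lin_gmulr _)); apply: eq_tlift => p0 p1.
by rewrite gmul_tensr0//; apply: dc_P_homog0.
Qed.

Lemma average_mulr0 a p : homog 0 p ->
  average (a * p) = tlift (fun a0 a1 => tlift (fun p0 p1 =>
    lam (a1 * p1) *: (a0 * p0)) (coact p)) (coact a).
Proof.
move=> p0; rewrite /average coact_mulr0// sw_sw; last by lin_tac.
by apply: eq_tlift => a0 a1; rewrite sw_sw ?swE//; [apply: eq_tlift => *; rewrite swE|..]; lin_tac.
Qed.

Lemma horizontal0 p : homog 0 p -> horizontal p.
Proof.
move=> /dc_P_homog[x <-]; rewrite /horizontal dc_coactP [LHS]sw_tmap; last by lin_tac.
by apply: eq_tlift => a b; rewrite (ue_H_homog0 Env b).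
Qed.

Lemma horizontal_mulr0 a p : homog 0 p -> horizontal a -> horizontal (a * p).
Proof.
move=> p0 ha; rewrite /horizontal coact_mulr0// -ha sw_tmap; last by lin_tac.
rewrite (lin_out (F := tmap id (pi 0))); last by lin_tac.
apply: eq_tlift => a0 a1; rewrite -(horizontal0 p0) sw_tmap; last by lin_tac.
rewrite (lin_out (F := tmap id (pi 0))); last by lin_tac.
by apply: eq_tlift => x y; rewrite tmap_tens ?hcomp0M ?(homogK 0)//; lin_tac.
Qed.

Lemma lam_antipode0 c t : lam (c * S (pi 0 t)) = lam (c * S t).
Proof.
by rewrite -lam0 -[RHS]lam0 !hcomp0M e_antipode_hcomp [pi 0 (S _)]e_antipode_hcomp hcompK.
Qed.

Variable k : nat.

Definition lift_section (t : Env) : (Om ⊗ Om)%type := sec (pi k t).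

Lemma lin_lift_section : lin lift_section.
Proof. by rewrite /lift_section; lin_tac. Qed.

Lemma sw_comul_degree (V : lmodType C) (g : Env -> Env -> V) t : bilin g ->
  (forall a b, g a (pi k b) = g a b) -> (forall a b, g (pi 0 a) b = g a b) ->
  tlift g (DE (pi k t)) = tlift g (DE t).
Proof.
move=> bg gk g0; rewrite (gm_comp (e_comul_morph (dc_hopf calc))) sw_gtens_comp//.
by apply: eq_tlift => a b; rewrite g0.
Qed.

(** Apply the projections to degrees 0 and k to X Δ(Y) = 1 ⊗ t. In N, degree 0 for X Y0 forces
    degree 0 for both factors, and then Y0 ⊗ Y1 of degree (0, k) comes from the degree k part of
    Y. *)
Lemma lift_sectionK t :
  tlift (fun x y => tlift (fun y0 y1 => (pi0 x * y0) ⊗ pi k y1) (coact (hcomp Om k y)))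
    (lift_section t) = 1 ⊗ pi k t.
Proof.
have := congr1 (tmap pi0 (pi k)) (secK (pi k t)); rewrite tmap_tens; try by lin_tac.
rewrite (homog1 Om) hcompK eqxx => <-.
rewrite /galois (lin_out (F := tmap pi0 (pi k))); last by lin_tac.
apply: eq_tlift => x y; rewrite (gm_comp (dc_coact_morph calc)) sw_gtens_comp.
- rewrite -[in RHS](sw_id (coact y)) (lin_out _ _ (lin_gmulr _)).
  rewrite (lin_out (F := tmap pi0 (pi k))); last by lin_tac.
  by apply: eq_tlift => a b; rewrite gmul_left tmap_tens ?hcomp0M//; lin_tac.
- by lin_tac.
- by move=> a b; rewrite hcompK eqxx.
Qed.

(** With X ⊗ Y the lift of 1 ⊗ t in Ω^0 ⊗ Ω^k, this is
    X0 Y0 ⊗ X1 ⊗ Y1 = 1 ⊗ S(t1) ⊗ t2, contracted with λ(c -) in the middle: apply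
    a ⊗ t |-> a0 ⊗ a1 S(t1) ⊗ t2 to X Y0 ⊗ Y1 = 1 ⊗ t. *)
Lemma lift_section_covariant c t :
  tlift (fun x y => tlift (fun x0 x1 => tlift (fun y0 y1 =>
    lam (c * x1) *: ((x0 * y0) ⊗ pi k y1)) (coact (hcomp Om k y))) (coact (pi0 x)))
    (lift_section t) =
  tlift (fun t1 t2 => lam (c * S t1) *: (1 ⊗ pi k t2)) (DE t).
Proof.
pose g a t1 t2 := tlift (fun a0 a1 => lam (c * (a1 * S t1)) *: (a0 ⊗ pi k t2)) (coact a).
have gk a t1 t2 : g a t1 (pi k t2) = g a t1 t2 by rewrite /g hcompK eqxx.
have g0 a t1 t2 : g a (pi 0 t1) t2 = g a t1 t2.
  by apply: eq_tlift => a0 a1; rewrite !mulrA lam_antipode0.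
have tg : trilin g by rewrite /g; lin_tac.
pose K a t := tlift (g a) (DE t).
have bK : bilin K by rewrite /K; lin_tac.
have KE a u : K a (pi k u) = K a u by apply: sw_comul_degree => //; lin_tac.
transitivity (tlift K (1 ⊗ pi k t)); last first.
  rewrite swE// KE; apply: eq_tlift => t1 t2.
  rewrite /g (gm_1 (dc_coact_morph calc)) swE ?mul1r//; lin_tac.
rewrite -(lift_sectionK t) (lin_out _ _ (lin_sw bK)); apply: eq_tlift => x y.
rewrite (lin_out _ _ (lin_sw bK)) sw_exchange.
pose T u v z := tlift (fun x0 x1 => tlift (fun t1 t2 =>
   lam (c * (x1 * v * S t1)) *: ((x0 * u) ⊗ pi k t2)) (DE z)) (coact (pi0 x)).
transitivity (tlift (fun y0 y1 => tlift (fun y00 y01 => T y00 y01 y1) (coact y0))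
    (coact (hcomp Om k y))); last first.
  apply: eq_tlift => y0 y1; rewrite swE// KE /K /g.
  have /dc_P_homog[p pE] : homog 0 (pi0 x) by apply: homogK.
  rewrite -pE dc_coact_mul0 /T -pE dc_coactP.
  under eq_tlift => y00 y01.
    rewrite sw_tmap; last by lin_tac.
    over.
  rewrite sw_exchange.
  under [RHS]eq_tlift => t1 t2.
    rewrite sw_sw; last by lin_tac.
    over.
  rewrite [RHS]sw_exchange; apply: eq_tlift => p0 p1.
  under [RHS]eq_tlift => t1 t2.
    rewrite sw_sw; last by lin_tac.
    over.
  rewrite [RHS]sw_exchange; apply: eq_tlift => y00 y01; apply: eq_tlift => t1 t2.
  by rewrite swE//; lin_tac.
rewrite (dc_coact_trilin _ (T := T)); last by rewrite /T; lin_tac.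
apply: eq_tlift => y0 y1; rewrite /T sw_exchange; apply: eq_tlift => x0 x1.
rewrite -(e_comul_trilin _ (T := fun u v z =>
  lam (c * (x1 * u * S v)) *: ((x0 * y0) ⊗ pi k z))); last by lin_tac.
rewrite -[in LHS](e_counitl (dc_hopf calc) y1).
have b2 : lin (fun u => lam (c * x1) *: (x0 * y0 ⊗ pi k u)) by lin_tac.
rewrite (lin_out _ _ b2); apply: eq_tlift => u z.
transitivity (lam (c * (x1 * (eps u *: 1))) *: (x0 * y0 ⊗ pi k z)).
  rewrite -!scalerAr mulr1 (linZ _ _ llam) linearZ /= tensorZr !scalerA.
  by congr (_ *: _); apply: mulrC.
rewrite -(e_antipoder (dc_hopf calc) u).
rewrite (lin_out (F := fun v => lam (c * (x1 * v)) *: (x0 * y0 ⊗ pi k z))); last by lin_tac.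
by apply: eq_tlift => v v'; rewrite !mulrA.
Qed.

End Averaging.

(** * Filtration by the vertical degree *)

Section VerticalFiltration.
Variables (R : realType) (G : cmqg R) (zeta : qpbundle G) (calc : diff_calculus zeta).
Local Notation C := R[i].
Local Notation Om := (dc_forms calc).
Local Notation Env := (dc_env calc).
Local Notation coact := (dc_coact calc).
Local Notation DE := (e_comul (dc_hopf calc)).
Local Notation eps := (e_counit (dc_hopf calc)).
Local Notation S := (e_antipode (dc_hopf calc)).
Local Notation pi0 := (hcomp Om 0).
Local Notation pi := (hcomp Env).
Implicit Types (f g : Env -> Om) (F : Om -> Om).

Definition vertical_degree_lt k (w : Om) : Prop :=
  forall l, (k <= l)%N -> tmap id (pi l) (coact w) = 0.

Lemma vertical_degree_lt0 w : vertical_degree_lt 0 w -> w = 0.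
Proof.
move=> w0; rewrite -[w]dc_coact_counit (tmap_hcomp_sum (w0)) big_ord0.
rewrite (lin0 (lin_sw _))//; split=> ?; first by lin_tac.
by apply: (@lin_scalel _ _ _ eps); apply: lin_e_counit.
Qed.

Lemma vertical_degree_fin w : exists k, vertical_degree_lt k w.
Proof. exact: tmap_hcomp_fin. Qed.

(** In the top component w0 ⊗ π_k(w1), w0 may be taken horizontal, as [average_base] requires: Δ(w0)
    ⊗ π_k(w1) comes from Δ(w1) with w1 of degree at most k, and a last leg of degree k leaves degree
    0 for the middle one. The kernel of [D0] is the horizontal forms, and q = id - L D0 satisfies D0
    q = 0 for a generalized inverse [L]. *)
Lemma horizontal_projection : exists q : Om -> Om, [/\ lin q,
  forall a, horizontal (q a) &
  forall k w, vertical_degree_lt k.+1 w ->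
    tmap q id (tmap id (pi k) (coact w)) = tmap id (pi k) (coact w)].
Proof.
pose D0 a := coact a - tmap id (pi 0) (coact a).
have lD0 : lin D0 by rewrite /D0; lin_tac.
have [L [lL LD]] := pseudo_inverse lD0.
pose q a := a - L (D0 a); have lq : lin q by rewrite /q; lin_tac.
exists q; split=> // [a|k w wk].
  have : D0 (q a) = 0 by rewrite /q (linB lD0) LD subrr.
  by move=> /eqP; rewrite subr_eq0 => /eqP.
have D0w : tmap D0 id (tmap id (pi k) (coact w)) = 0.
  pose T x y z : ((Om ⊗ Env) ⊗ Env)%type := (x ⊗ (y - pi 0 y)) ⊗ pi k z.
  have tT : trilin T by rewrite /T; lin_tac.
  rewrite [LHS]sw_tmap; last by lin_tac.
  transitivity (tlift (fun a b => tlift (fun a0 a1 => T a0 a1 b) (coact a)) (coact w)).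
    apply: eq_tlift => a t; rewrite /T.
    rewrite -(lin_out (F := fun u => u ⊗ pi k t)); last by lin_tac.
    congr (_ ⊗ _); rewrite /D0 /tmap -[X in X - _]sw_id -scaleN1r.
    rewrite (lin_out _ _ (lin_scale (-1) (@lin_id _ _))) -tlift_fD.
    by apply: eq_tlift => x y; rewrite scaleN1r (linB (lin_tensr _ (@lin_id _ _))).
  rewrite (dc_coact_trilin _ tT).
  have bg : bilin (fun a b => tlift (T a) (DE b)) by lin_tac.
  rewrite (tmap_hcomp_sum wk) (lin_sum _ _ _ (lin_sw bg)) big1// => l _.
  rewrite sw_tmap//; apply: sw0 => a t.
  rewrite (gm_comp (e_comul_morph (dc_hopf calc))); move: (DE t).
  have lc := @lin_gtens_comp R Env Env l.
  apply: (lin_homog_tens_ext (f := fun u => tlift (T a) (gtens_comp l u)) (g := fun=> 0)).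
  - by lin_tac.
  - by move=> c u v; rewrite scaler0 addr0.
  move=> m n x y xm yn; rewrite (gtens_compE _ xm yn).
  have bT : bilin (T a) by lin_tac.
  case: eqP => [e|_]; last by rewrite (lin0 (lin_sw bT)).
  rewrite swE// /T (hcomp_homog _ yn); case: eqP => [kn|_]; last exact: tens0r.
  have m0 : m = 0%N.
    by apply/eqP; rewrite -leqn0 -(leq_add2r n) e add0n -kn -ltnS.
  by rewrite m0 in xm; rewrite xm subrr tens0r tens0l.
have lDt : lin (tmap D0 (id : Env -> Env)) by lin_tac.
have lLt : lin (tmap L (id : Env -> Env)) by lin_tac.
have qE z : tmap q id z = z - tmap L id (tmap D0 id z).
  move: z; apply: lin_tens_ext => [||a b]; try by lin_tac.
  by rewrite !tmap_tens// /q (linB (lin_tensl _ (@lin_id _ _))).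
by rewrite qE D0w (lin0 lLt) subr0.
Qed.

Variable lam : Env -> C^o.
Hypotheses (llam : lin lam) (lam1 : lam 1 = 1) (lam0 : forall t, lam (pi 0 t) = lam t).
Hypothesis lam_inv : forall t, tlift (fun a b => lam b *: a) (DE (pi 0 t)) = lam t *: 1.
Variable sec : Env -> (Om ⊗ Om)%type.
Hypotheses (lsec : lin sec) (secK : forall t, galois (sec t) = 1 ⊗ t).

Variable k : nat.
Local Notation sk := (lift_section sec k).
Local Notation pik := (hcomp Om k).

Let lsk : lin sk. Proof. exact: lin_lift_section. Qed.
Let lavg : lin (average lam). Proof. exact: lin_average. Qed.

(** The f_k of the induction: E(w0 X) F(Y) is expanded with coassociativity, and the factor w0 is
    split off. *)
Definition component F (t : Env) : Om :=
  tlift (fun t1 t2 => tlift (fun x y => tlift (fun x0 x1 =>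
    lam (t1 * x1) *: (x0 * F (pik y))) (coact (pi0 x))) (sk t2)) (DE t).

Lemma lin_component F : lin F -> lin (component F).
Proof. by move=> lF; rewrite /component; lin_tac. Qed.

Lemma component_hcomp F t : lin F -> component F (pi k t) = component F t.
Proof.
move=> lF; rewrite /component; apply: sw_comul_degree.
- by lin_tac.
- by move=> t1 t2; rewrite /lift_section hcompK eqxx.
move=> t1 t2; apply: eq_tlift => x y; apply: eq_tlift => x0 x1.
by rewrite -lam0 -[in RHS]lam0 !hcomp0M hcompK.
Qed.

Lemma gauge_of_component F w : lin F -> gauge_of (component F) w =
  tlift (fun a t => tlift (fun x y => average lam (a * pi0 x) * F (pik y)) (sk t)) (coact w).
Proof.
move=> lF; pose T a t1 t2 := tlift (fun x y => tlift (fun x0 x1 =>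
    lam (t1 * x1) *: (a * x0 * F (pik y))) (coact (pi0 x))) (sk t2).
transitivity (tlift (fun a t => tlift (T a) (DE t)) (coact w)).
  apply: eq_tlift => a t; rewrite /component (lin_out _ _ (lin_mull _ (@lin_id _ _))).
  apply: eq_tlift => t1 t2; rewrite (lin_out _ _ (lin_mull _ (@lin_id _ _))).
  apply: eq_tlift => x y; rewrite (lin_out _ _ (lin_mull _ (@lin_id _ _))).
  by apply: eq_tlift => x0 x1; rewrite -scalerAr mulrA.
rewrite -(dc_coact_trilin _ (T := T)); last by rewrite /T; lin_tac.
apply: eq_tlift => a t; rewrite /T sw_exchange; apply: eq_tlift => x y.
rewrite (average_mulr0 llam) ?(lin_out _ _ (lin_mulr _ (@lin_id _ _))); last exact: homogK.
apply: eq_tlift => a0 a1; rewrite (lin_out _ _ (lin_mulr _ (@lin_id _ _))).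
by apply: eq_tlift => x0 x1; rewrite -scalerAl.
Qed.

(** [F w] is compared with [F w'], w' = E(w0 X) Y with X ⊗ Y the lift of w1, which has
    the same component of vertical degree [k] as [w]. *)
Lemma component_leading F : lin F ->
  (forall mu w, base_form calc mu -> F (mu * w) = mu * F w) ->
  (forall w, vertical_degree_lt k w -> F w = 0) ->
  forall w, vertical_degree_lt k.+1 w -> gauge_of (component F) w = F w.
Proof.
move=> lF Fmu Fk w wk; have [q [lq qh qw]] := horizontal_projection.
have skk t : sk (pi k t) = sk t by rewrite /lift_section hcompK eqxx.
(* Expressions that see w1 only in degree k do not change when w0 is replaced by its horizontal
   projection. *)
have unq (V : lmodType C) (U : Om -> Env -> V) : bilin U ->
    (forall a t, U a (pi k t) = U a t) ->
    tlift (fun a t => U (q a) t) (coact w) = tlift U (coact w).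
  move=> bU Uk; transitivity (tlift U (tmap id (pi k) (coact w))); last first.
    by rewrite sw_tmap//; apply: eq_tlift => a t; apply: Uk.
  rewrite -(qw k w wk) !sw_tmap//; last by lin_tac.
  by apply: eq_tlift => a t; rewrite Uk.
have qbase a x : base_form calc (average lam (q a * pi0 x)).
  apply: (average_base llam lam0 lam_inv); apply: horizontal_mulr0 => //.
  exact: homogK.
pose w' := tlift (fun a t => tlift (fun x y =>
  average lam (q a * pi0 x) * pik y) (sk t)) (coact w).
have -> : gauge_of (component F) w = F w'.
  rewrite gauge_of_component// -(unq _ (fun a t =>
    tlift (fun x y => average lam (a * pi0 x) * F (pik y)) (sk t))).
  - rewrite (lin_out _ _ lF); apply: eq_tlift => a t.
    by rewrite (lin_out _ _ lF); apply: eq_tlift => x y; rewrite Fmu.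
  - by lin_tac.
  - by move=> a t; rewrite skk.
(* As [F] vanishes in vertical degree < k, it suffices that w' - w has no component of vertical
   degree k or more. *)
apply/eqP; rewrite -subr_eq0 -(linB lF); apply/eqP/Fk => l kl.
have ll : lin (fun v => tmap id (pi l) (coact v)) by lin_tac.
rewrite (linB ll); apply/eqP; rewrite subr_eq0; apply/eqP.
pose V a t := tlift (fun x y => tmap id (pi l)
  (gmul (average lam (a * pi0 x) ⊗ 1) (coact (pik y)))) (sk t).
have -> : tmap id (pi l) (coact w') = tlift (fun a t => V (q a) t) (coact w).
  rewrite /w' (lin_out _ _ ll); apply: eq_tlift => a t.
  rewrite (lin_out _ _ ll); apply: eq_tlift => x y.
  by rewrite (gm_M (dc_coact_morph calc)) (qbase a x).
have coactk y : coact (pik y) = gtens_comp k (coact y).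
  exact: (gm_comp (dc_coact_morph calc)).
(* Above k both components vanish: base forms add no vertical degree, and Y has total degree k. *)
have [lk|lk] := eqVneq l k; last first.
  have {}kl : (k < l)%N by rewrite ltn_neqAle eq_sym lk.
  rewrite (wk _ kl); apply: sw0 => a t; apply: sw0 => x y.
  rewrite coactk; move: (coact y); have lc := @lin_gtens_comp R Om Env k.
  apply: (lin_homog_tens_ext (f := fun u => tmap id (pi l)
    (gmul (average lam (q a * pi0 x) ⊗ 1) (gtens_comp k u))) (g := fun=> 0)).
  - by lin_tac.
  - by move=> c u v; rewrite scaler0 addr0.
  move=> m n u v um vn; rewrite (gtens_compE _ um vn); case: eqP => [e|_]; last first.
    by rewrite (lin0 (lin_gmulr _)) (lin0 (f := tmap id (pi l)))//; lin_tac.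
  rewrite gmul_left tmap_tens; try by lin_tac.
  rewrite (hcomp_homog _ vn) ifF ?tens0r//; apply/negbTE.
  by rewrite neq_ltn (leq_ltn_trans _ kl) ?orbT// -e leq_addl.
rewrite {}lk in V ll *.
have VE a t : V a t = tlift (fun a0 a1 => tlift (fun t1 t2 =>
    lam (a1 * S t1) *: (a0 ⊗ pi k t2)) (DE t)) (coact a).
  transitivity (tlift (fun a0 a1 => gmul (a0 ⊗ 1)
    (tlift (fun t1 t2 => lam (a1 * S t1) *: (1 ⊗ pi k t2)) (DE t))) (coact a)); last first.
    apply: eq_tlift => a0 a1; rewrite (lin_out _ _ (lin_gmulr _)).
    by apply: eq_tlift => t1 t2; rewrite (linZ _ _ (lin_gmulr _)) gmul_left mulr1.
  under [RHS]eq_tlift => a0 a1.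
    rewrite -(lift_section_covariant llam lam0 secK) (lin_out _ _ (lin_gmulr _)).
    over.
  rewrite [RHS]sw_exchange; apply: eq_tlift => x y.
  rewrite (average_mulr0 llam); last exact: homogK.
  rewrite (lin_out (F := fun u => tmap id (pi k) (gmul (u ⊗ 1) (coact (pik y))))); last by lin_tac.
  apply: eq_tlift => a0 a1.
  rewrite (lin_out (F := fun u => tmap id (pi k) (gmul (u ⊗ 1) (coact (pik y))))); last by lin_tac.
  rewrite (lin_out _ _ (lin_gmulr _)); apply: eq_tlift => x0 x1.
  rewrite (lin_out _ _ (lin_gmulr _)) -[in LHS](sw_id (coact (pik y))).
  rewrite (lin_out _ _ (lin_gmulr _)) (lin_out (F := tmap id (pi k))); last by lin_tac.
  apply: eq_tlift => y0 y1; rewrite gmul_left tmap_tens; try by lin_tac.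
  by rewrite (linZ _ _ (lin_gmulr _)) gmul_left -scalerAl tensorZl mulrA.
have bV : bilin V by rewrite /V; lin_tac.
rewrite unq//; last by move=> a t; rewrite /V skk.
(* The component of w' is now λ(w1 S(w2)) w0 ⊗ π_k(w3); the antipode identity and λ(1) = 1 reduce it
   to that of w. *)
transitivity (tlift (fun a t => tlift (fun a0 a1 => tlift (fun t1 t2 =>
    lam (a1 * S t1) *: (a0 ⊗ pi k t2)) (DE t)) (coact a)) (coact w)).
  by apply: eq_tlift => a t; apply: VE.
rewrite (dc_coact_trilin _ (T := fun x y z => tlift (fun t1 t2 =>
  lam (y * S t1) *: (x ⊗ pi k t2)) (DE z))); last by lin_tac.
apply: eq_tlift => a t.
rewrite -(e_comul_trilin _ (T := fun x y z => lam (x * S y) *: (a ⊗ pi k z))); last by lin_tac.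
rewrite -[in RHS](e_counitl (dc_hopf calc) t) (lin_out (F := fun u => a ⊗ pi k u)); last by lin_tac.
apply: eq_tlift => t1 t2; transitivity (lam (eps t1 *: 1) *: (a ⊗ pi k t2)).
  rewrite -(e_antipoder (dc_hopf calc) t1).
  by rewrite (lin_out (F := fun v => lam v *: (a ⊗ pi k t2)))//; lin_tac.
by rewrite (linZ _ _ llam) lam1 linearZ /= tensorZr [_ *: 1]mulr1.
Qed.

End VerticalFiltration.

(** * The gauge group *)

Section GaugeGroup.
Variables (R : realType) (G : cmqg R) (zeta : qpbundle G) (calc : diff_calculus zeta).
Local Notation C := R[i].
Local Notation Om := (dc_forms calc).
Local Notation Env := (dc_env calc).
Local Notation coact := (dc_coact calc).
Local Notation DE := (e_comul (dc_hopf calc)).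
Implicit Types (f g : Env -> Om) (F : Om -> Om).

Definition base_linear F : Prop :=
  forall mu w, base_form calc mu -> F (mu * w) = mu * F w.

Lemma gauge_of_base_linear f : lin f -> base_linear (gauge_of f).
Proof.
move=> lf mu w mub; have bf : bilin (fun a t => a * f t) by lin_tac.
rewrite /gauge_of (gm_M (dc_coact_morph calc)) mub -[coact w]sw_id.
rewrite (lin_out _ _ (lin_gmulr _)) !sw_sw// (lin_out _ _ (lin_mull _ (@lin_id _ _))).
by apply: eq_tlift => a t; rewrite gmul_left !swE// mulrA.
Qed.

Lemma gauge_of1 f : lin f -> gauge_of f 1 = f 1 :> Om.
Proof. by move=> lf; rewrite /gauge_of (gm_1 (dc_coact_morph calc)) swE ?mul1r//; lin_tac. Qed.

Lemma base_linear_gauge_of F : lin F -> base_linear F -> exists2 f, lin f & gauge_of f =1 F.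
Proof.
move=> lF Fb; have [lam [llam lam1 lam0 lam_inv]] := env_haar_exists (dc_hopf calc).
have [inv [linv invK]] := pseudo_inverse (@lin_galois _ _ _ calc).
pose sec t := inv (1 ⊗ t); have lsec : lin sec by rewrite /sec; lin_tac.
have secK t : galois (sec t) = 1 ⊗ t.
  by have [z zt] := galois_right t; rewrite /sec -zt invK.
pose comp k F := component lam sec k F.
(* [Fs n] is what remains of [F] after the corrections in vertical degrees < n, and it vanishes
   there. *)
pose Fs := fix Fs n := if n is m.+1 then fun w => Fs m w - gauge_of (comp m (Fs m)) w else F.
have Fl n : lin (Fs n).
  elim: n => [//|n IH] /=; have lc := lin_component llam lsec n IH.
  by apply: lin_add => //; apply: lin_opp; apply: lin_gauge_of.
have Fsb n : base_linear (Fs n).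
  elim: n => [//|n IH] /= mu w mub; rewrite IH// gauge_of_base_linear ?mulrBr//.
  exact: lin_component.
have F0 n w : vertical_degree_lt n w -> Fs n w = 0.
  elim: n w => [|n IH] w wn; first by rewrite (vertical_degree_lt0 wn) /= (lin0 lF).
  by rewrite /= (component_leading llam lam1 lam0 lam_inv lsec secK (Fl n) (Fsb n) IH wn) subrr.
have FE n w : F w = Fs n w + \sum_(m < n) gauge_of (comp m (Fs m)) w.
  elim: n => [|n IH]; first by rewrite big_ord0 addr0.
  by rewrite big_ord_recr /= addrA addrAC subrK.
(* The n-th component only sees the degree n part of its argument, so the infinite sum is finite on
   each t. *)
pose f t := gsum (fun n => comp n (Fs n)) t.
have lc n : lin (comp n (Fs n)) by apply: lin_component.
have lf : lin f by apply: lin_gsum.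
have fE n t : f (hcomp Env n t) = comp n (Fs n) t.
  rewrite /f (gsumE _ (homogK n t)) => [|m]; last exact: (lin0 (lc m)).
  exact: component_hcomp.
exists f => // w; have [n wn] := vertical_degree_fin w.
have bf : bilin (fun a t => a * f t) by lin_tac.
rewrite (FE n w) F0// add0r /gauge_of {1}(tmap_hcomp_sum wn).
rewrite (lin_sum _ _ _ (lin_sw bf)); apply: eq_bigr => m _.
by rewrite sw_tmap//; apply: eq_tlift => a t; rewrite fE.
Qed.

Lemma hcomp_mull (A : gdsa R) m n (x y : A) : homog m x ->
  hcomp A (m + n) (x * y) = x * hcomp A n y.
Proof.
move=> xm; move: y; apply: lin_homog_ext => [||l y yl]; try by lin_tac.
rewrite (hcomp_homog _ (homogM' xm yl)) (hcomp_homog _ yl) eqn_add2l.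
by case: eqP; rewrite ?mulr0.
Qed.

Lemma gauge_of_graded f : graded_linear f -> graded_linear (gauge_of f).
Proof.
move=> [lf hf]; have {}lf : lin f by []; split; first exact: lin_gauge_of.
have bf : bilin (fun a t => a * f t) by lin_tac.
move=> n w wn; rewrite /gauge_of -wn (gm_comp (dc_coact_morph calc)) /homog.
have lc := @lin_gtens_comp R Om Env n.
move: (coact w); apply: lin_homog_tens_ext => [||k l x y xk yl]; try by lin_tac.
rewrite (gtens_compE _ xk yl); case: eqP => [<-|_].
  by rewrite swE//; apply: homogM' => //; apply: hf.
by rewrite (lin0 (lin_sw bf)) linear0.
Qed.

(** Let [f'] be the degree-preserving part of [f]. As [gauge_of f] is graded, it equals
    [gauge_of f'], and injectivity gives f = f'. *)
Lemma graded_gauge_of f : lin f ->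
  (forall k w, homog k w -> homog k (gauge_of f w)) -> graded_linear f.
Proof.
move=> lf Ff; split=> // k t tk.
pose f' t := gsum (fun n tn => hcomp Om n (f tn)) t.
have lf' : lin f' by apply: lin_gsum => n; lin_tac.
have f'E n y : homog n y -> f' y = hcomp Om n (f y).
  by move=> yn; rewrite /f' (gsumE _ yn)// => m; rewrite (lin0 lf) linear0.
rewrite /homog -(f'E _ _ tk); apply: gauge_of_inj => // {t k tk}.
apply: lin_homog_ext => [||n w wn]; try exact: lin_gauge_of.
have bf : bilin (fun a t => a * f t) by lin_tac.
have bf' : bilin (fun a t => a * f' t) by lin_tac.
rewrite -(Ff _ _ wn) /gauge_of -wn (gm_comp (dc_coact_morph calc)).
have lc := @lin_gtens_comp R Om Env n.
move: (coact w); apply: lin_homog_tens_ext => [||k l x y xk yl]; try by lin_tac.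
rewrite (gtens_compE _ xk yl); case: eqP => [<-|_].
  by rewrite !swE// hcomp_mull// (f'E _ _ yl).
by rewrite (lin0 (lin_sw bf)) (lin0 (lin_sw bf')) linear0.
Qed.

Lemma lin_convolution f g : lin f -> lin g -> lin (convolution calc f g).
Proof. by move=> lf lg; rewrite /convolution; lin_tac. Qed.

Lemma lin_conv_unit : lin (conv_unit calc).
Proof. by apply: (@lin_scalel _ _ _ (e_counit (dc_hopf calc))); apply: lin_e_counit. Qed.

Lemma gauge_of_bijective f g : lin f -> lin g -> covariant f ->
  convolution calc f g = conv_unit calc -> convolution calc g f = conv_unit calc ->
  bijective (gauge_of f).
Proof.
move=> lf lg cf fg gf.
have cg : covariant g by apply: (covariant_inverse lf lg cf) => t; rewrite ?fg ?gf.
exists (gauge_of g) => w.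
  rewrite -[LHS](gauge_of_convolution lf lg) ?fg ?gauge_of_conv_unit//.
  exact/covariantP.
rewrite -[LHS](gauge_of_convolution lg lf) ?gf ?gauge_of_conv_unit//.
exact/covariantP.
Qed.

Lemma gauge_of_transformation f :
  conv_invertible_maps calc f -> gauge_transformations calc (gauge_of f).
Proof.
move=> [gf f1 Af [g [[lg _] fg gfu]]]; have lf : lin f by case: gf.
have cf : covariant f by apply/Ad_covariantP.
split.
- exact: gauge_of_graded.
- exact: gauge_of_bijective fg gfu.
- exact: gauge_of_base_linear.
- by rewrite gauge_of1.
- exact/covariantP.
Qed.

Lemma gauge_transformation_inverse F F' : gauge_transformations calc F ->
  cancel F F' -> cancel F' F -> gauge_transformations calc F'.
Proof.
move=> [[lF hF] _ Fb F1 Fc] FK F'K; have {}lF : lin F by [].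
have lF' : lin F' by move=> a u v; apply: (can_inj FK); rewrite lF !F'K.
have F_hcomp k w : hcomp Om k (F w) = F (hcomp Om k w).
  move: w; apply: lin_homog_ext => [||l w wl]; try by lin_tac.
  rewrite (hcomp_homog _ (hF _ _ wl)) (hcomp_homog _ wl).
  by case: eqP; rewrite ?(lin0 lF).
split.
- by split=> // k w wk; apply: (can_inj FK); rewrite -F_hcomp F'K.
- by exists F.
- by move=> mu w mub; apply: (can_inj FK); rewrite Fb// !F'K.
- by apply: (can_inj FK); rewrite F'K.
move=> w; rewrite -[in LHS](F'K w) -Fc [LHS]sw_tmap; last by lin_tac.
by rewrite -[RHS]sw_id; apply: eq_tlift => a t; rewrite FK.
Qed.

Lemma gauge_transformation_comp F1 F2 :
  gauge_transformations calc F1 -> gauge_transformations calc F2 ->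
  gauge_transformations calc (gauge_comp calc F1 F2).
Proof.
move=> [[l1 h1] b1 m1 u1 c1] [[l2 h2] b2 m2 u2 c2].
have {}l1 : lin F1 by []. have {}l2 : lin F2 by [].
split.
- by split=> [|k w wk]; [apply: (lin_comp l2 l1) | apply/h2/h1].
- exact: bij_comp.
- by move=> mu w mub; rewrite /gauge_comp m1// m2.
- by rewrite /gauge_comp u1.
move=> w; rewrite /gauge_comp -c2 -c1 [RHS]sw_tmap//; by lin_tac.
Qed.

Lemma gauge_transformation_id : gauge_transformations calc id.
Proof.
split=> //; first by exists id.
by move=> w; rewrite /tmap sw_id.
Qed.

Lemma gauge_transformations_group :
  group_on (gauge_transformations calc) (gauge_comp calc) id.
Proof.
split=> //.
- exact: gauge_transformation_id.
- exact: gauge_transformation_comp.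
move=> F gF; have [_ [F' FK F'K] _ _ _] := gF.
exists F'; split; first exact: gauge_transformation_inverse gF FK F'K.
  by apply/funext => w; rewrite /gauge_comp FK.
by apply/funext => w; rewrite /gauge_comp F'K.
Qed.

Lemma gauge_transformation_lift F : gauge_transformations calc F ->
  exists2 f, [/\ graded_linear f, covariant f & f 1 = 1] & gauge_of f = F.
Proof.
move=> [[lF hF] _ Fb F1 Fc]; have [f lf fF] := base_linear_gauge_of lF Fb.
have {}fF : gauge_of f = F by apply/funext.
exists f => //; split.
- by apply: graded_gauge_of; rewrite ?fF.
- by apply/covariantP; rewrite ?fF.
- by rewrite -gauge_of1// fF.
Qed.

(** The convolution inverse is the lift of the inverse transformation: both convolution products
    have the identity as image, as does the convolution unit. *)
Lemma gauge_of_surjective F : gauge_transformations calc F ->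
  exists2 f, conv_invertible_maps calc f & gauge_of f = F.
Proof.
move=> gF; have [_ [F' FK F'K] _ _ _] := gF.
have gF' := gauge_transformation_inverse gF FK F'K.
have [f [gf cf f1] fF] := gauge_transformation_lift gF.
have [g [gg cg _] gF'E] := gauge_transformation_lift gF'.
have lf : lin f by case: gf. have lg : lin g by case: gg.
exists f => //; split=> //; first exact/Ad_covariantP.
exists g; split=> //; apply/funext; apply: gauge_of_inj; try exact: lin_convolution.
- exact: lin_conv_unit.
- move=> w; rewrite gauge_of_convolution//; last exact/covariantP.
  by rewrite gauge_of_conv_unit fF gF'E /gauge_comp FK.
- exact: lin_conv_unit.
- move=> w; rewrite gauge_of_convolution//; last exact/covariantP.
  by rewrite gauge_of_conv_unit fF gF'E /gauge_comp F'K.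
Qed.

Lemma gauge_of_eq f g : lin f -> lin g -> gauge_of f = gauge_of g -> f = g.
Proof. by move=> lf lg fg; apply/funext/gauge_of_inj => // w; rewrite fg. Qed.

Lemma conv_invertible_lin f : conv_invertible_maps calc f -> lin f.
Proof. by case=> -[]. Qed.

Lemma gauge_of_conv f g : conv_invertible_maps calc f -> conv_invertible_maps calc g ->
  gauge_of (convolution calc f g) = gauge_comp calc (gauge_of f) (gauge_of g).
Proof.
move=> cf cg; apply/funext/gauge_of_convolution; try exact: conv_invertible_lin.
by have [_ _ _ _] := gauge_of_transformation cf.
Qed.

Lemma gauge_of_reflect f : lin f ->
  gauge_transformations calc (gauge_of f) -> conv_invertible_maps calc f.
Proof.
move=> lf /gauge_of_surjective[g cg /gauge_of_eq <-]//.
exact: conv_invertible_lin.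
Qed.

(** [gauge_of] is injective and turns convolution into composition, so every axiom, associativity
    included, is pulled back from the gauge transformations; [gauge_of_reflect] gives closure. *)
Lemma conv_invertible_group :
  group_on (conv_invertible_maps calc) (convolution calc) (conv_unit calc).
Proof.
have [_ gD gA g1 gV] := gauge_transformations_group.
have unitE : gauge_of (conv_unit calc) = id by apply/funext/gauge_of_conv_unit.
have cu : conv_invertible_maps calc (conv_unit calc).
  by apply: gauge_of_reflect; [apply: lin_conv_unit | rewrite unitE; apply: gauge_transformation_id].
have cM f g : conv_invertible_maps calc f -> conv_invertible_maps calc g ->
    conv_invertible_maps calc (convolution calc f g).
  move=> cf cg; apply: gauge_of_reflect.
    by apply: lin_convolution; apply: conv_invertible_lin.
  by rewrite gauge_of_conv//; apply: gD; apply: gauge_of_transformation.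
have cE f g : conv_invertible_maps calc f -> conv_invertible_maps calc g ->
    gauge_of f = gauge_of g -> f = g.
  by move=> /conv_invertible_lin lf /conv_invertible_lin lg; apply: gauge_of_eq.
split=> //.
- move=> f g h cf cg ch; have cfg := cM _ _ cf cg; have cgh := cM _ _ cg ch.
  by apply: cE; rewrite ?gauge_of_conv//; apply: cM.
- move=> f cf; have [e1 e2] := g1 _ (gauge_of_transformation cf).
  by split; apply: cE; rewrite ?gauge_of_conv ?unitE//; apply: cM.
move=> f cf; have [F [gF e1 e2]] := gV _ (gauge_of_transformation cf).
have [g cg gE] := gauge_of_surjective gF; exists g; split=> //.
  by apply: cE; rewrite ?gauge_of_conv ?unitE ?gE//; apply: cM.
by apply: cE; rewrite ?gauge_of_conv ?unitE ?gE//; apply: cM.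
Qed.

End GaugeGroup.

(* [ssrfun] makes [id] an abbreviation for [fun x => x]. *)
Import Corelib.Init.Datatypes.

Theorem proposition3p4 (R : realType) (G : cmqg R) (zeta : qpbundle G)
    (hB : cstar_completable (qp_base zeta)) (calc : diff_calculus zeta) :
  group_on (conv_invertible_maps calc) (convolution calc) (conv_unit calc) /\
  group_on (gauge_transformations calc) (gauge_comp calc) id /\
  group_isomorphic
    (conv_invertible_maps calc) (convolution calc)
    (gauge_transformations calc) (gauge_comp calc).
Proof.
split; first exact: conv_invertible_group.
split; first exact: gauge_transformations_group.
exists (fun f => gauge_of f); split; last by move=> f g; apply: gauge_of_conv.
split.
- by move=> f; apply: gauge_of_transformation.
- move=> f g /set_mem/conv_invertible_lin lf /set_mem/conv_invertible_lin lg.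
  exact: gauge_of_eq.
- by move=> F /gauge_of_surjective[f cf <-]; exists f.
Qed.
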